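(* Let $f:\mathbb{C}\to\hat{\mathbb{C}}$ be a nonconstant, nonlinear meromorphic function, let $S_0$ be a finite set of critical values of $f$ and let $D\in\mathbb{N}$. Suppose that $\Omega$ is an $(S_0,D)$-regular set, and let $N=D^{\#S_0}$ and $C_0=N_0\cdot N\cdot C(N,2/3)$. Then every point of $\Omega$ is $N$-regular. More precisely, let $z_0\in\Omega$ and let $\delta>0$ be sufficiently small to ensure that $\mathbb{D}_{2\delta}(z_0)\subset\Omega$ and $\operatorname{diam}_{\Omega}(\mathbb{D}_{2\delta}(z_0))\le C_0$. Set $V_0:=\mathbb{D}_{\delta}(z_0)$. Let $n\ge 0$, and suppose that $V$ is a component of $f^{-n}(V_0)$ with $V\cap\mathcal{P}(f)\ne\emptyset$. Then (1) $V$ is simply connected and $\deg(f^n:V\to V_0)\le N$, and (2) $\operatorname{diam}_{\Omega}(V)\le C_0$.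
   Context: $\hat{\mathbb{C}}=\mathbb{C}\cup\{\infty\}$. ''Nonlinear'' means that $f$ is not a Möbius transformation. $\mathbb{D}_r(z)$ is the Euclidean disk of radius $r$ around $z$, and $\mathbb{D}$ is the unit disk. $\operatorname{diam}_\Omega$ denotes diameter in the hyperbolic metric of the open set $\Omega\subset\mathbb{C}$ (which is understood to carry a hyperbolic metric). $S(f)\subset\hat{\mathbb{C}}$ is the closure of the set of critical and asymptotic values of $f$ (including $\infty$ if it is a critical or asymptotic value), and $\mathcal{P}(f)=\overline{\{f^n(s): s\in S(f),\ n\ge 0\}}\subset\hat{\mathbb{C}}$ (iterates taken whenever defined). Regular points: a point $z_0\in\mathbb{C}$ is $\Delta$-regular ($\Delta\in\mathbb{N}$) if there is $\delta>0$ such that: if $n\in\mathbb{N}$ and $U$ is a connected component of $f^{-n}(\mathbb{D}_\delta(z_0))$ with $U\cap\mathcal{P}(f)\ne\emptyset$, then $U$ is simply connected and $f^n:U\to\mathbb{D}_\delta(z_0)$ is a branched covering of degree at most $\Delta$. Constants: $N_0\in\mathbb{N}$ is the smallest number such that $\mathbb{D}$ can be covered by $N_0$ disks of radius $1/3$ with centers in $\mathbb{D}$. For $N\in\mathbb{N}$ and $0<\eta<1$, $C(N,\eta)$ is a fixed constant with the following property (such a constant exists by a known lemma, and it tends to $0$ as $\eta\to0$ for fixed $N$): whenever $z_0\in\mathbb{C}$, $\delta>0$, $U\subset\mathbb{C}$ is simply connected and $g:U\to\mathbb{D}_\delta(z_0)$ is a proper holomorphic map of degree at most $N$, every component of $g^{-1}(\mathbb{D}_{\eta\delta}(z_0))$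 has diameter at most $C(N,\eta)$ in the hyperbolic metric of $U$. Regular sets: let $S_0$ be a finite set of critical values of $f$ and $D\in\mathbb{N}$, and set $N:=D^{\#S_0}$, $C_0:=N_0\cdot N\cdot C(N,2/3)$. A non-empty open set $\Omega\subset\mathbb{C}$ with $f^{-1}(\Omega)\subset\Omega$ is an $(S_0,D)$-regular set if the following holds. Let $V\subset\Omega$ be an arbitrary simply connected domain and let $U$ be a component of $f^{-1}(V)$. Assume that there is some $W\subset\Omega$ with $V\subset W$ and $\operatorname{diam}_\Omega(W)\le 2C_0$ such that the component of $f^{-1}(W)$ containing $U$ intersects $\mathcal{P}(f)$. Then $f:U\to V$ is a proper map of degree at most $D$ with at most one branched value (in particular $U$ is simply connected); furthermore, if there is a branched value $s$ of this map, then $s\in S_0$ and $f^j(s)\notin U$ for all $j\ge0$. *)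

(* Defs.v *)
From HB Require Import structures.
From mathcomp Require Import all_boot all_order all_algebra finmap.
From mathcomp Require Import all_classical all_reals all_analysis.
From mathcomp Require Import complex.
Import numFieldNormedType.Exports.
Import Order.TTheory GRing.Theory Num.Theory.

Set Implicit Arguments.
Unset Strict Implicit.
Unset Printing Implicit Defensive.

Local Open Scope classical_set_scope.
Local Open Scope ring_scope.
Local Open Scope complex_scope.

(* [R[i]] carries no topology of its own in the library; seen as a
   [numClosedFieldType] it inherits the normed-field topology. *)
Definition Cplx (R : realType) : numClosedFieldType := R[i].

Definition Sphere (R : realType) : topologicalType :=
  one_point_compactification (Cplx R).

Section Topology.
Context {R : realType}.
Local Notation C := (Cplx R).
Implicit Types (U V W A B : set C).

Definition finite_pt (z : C) : Sphere R := Some z.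
Definition infty_pt : Sphere R := None.

Definition disk (z : C) (r : R) : set C := ball z (r%:C : C).

Definition is_component A U := exists2 x, A x & U = connected_component A x.

(* Only the values on [0, 1] matter. *)
Definition path_in A (g : R -> C) :=
  {within `[0%R, 1%R], continuous g} /\ forall t, t \in `[0, 1] -> A (g t).

Definition path_connected A :=
  forall x y, A x -> A y -> exists g, [/\ path_in A g, g 0 = x & g 1 = y].

Definition null_homotopic A (g : R -> C) :=
  exists H : R * R -> C,
    [/\ {within `[0%R, 1%R] `*` `[0%R, 1%R], continuous H},
        forall s t, s \in `[0, 1] -> t \in `[0, 1] -> A (H (s, t)),
        forall t, t \in `[0, 1] -> H (0, t) = g t,
        forall t, t \in `[0, 1] -> H (1, t) = g 0 &
        forall s, s \in `[0, 1] -> H (s, 0) = g 0 /\ H (s, 1) = g 0].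

Definition simply_connected A :=
  path_connected A /\
  forall g, path_in A g -> g 0 = g 1 -> null_homotopic A g.

Definition simply_connected_domain A :=
  [/\ A !=set0, open A & simply_connected A].

Definition homeo (h k : C -> C) A B :=
  [/\ {within A, continuous h}, {within B, continuous k},
      h @` A = B, k @` B = A & {in A, cancel h k}].

End Topology.

Section Maps.
Context {R : realType}.
Local Notation C := (Cplx R).
Implicit Types (U V W A B : set C) (g : C -> C).

Definition holomorphic_on U g := forall z, U z -> derivable g z 1.

Definition has_multiplicity g (z : C) (k : nat) :=
  [/\ (0 < k)%N, derive1n k g z != 0 &
      forall j, (0 < j < k)%N -> derive1n j g z = 0].

Definition has_degree g U V (d : nat) :=
  forall w, V w -> exists (s : {fset C}) (m : C -> nat),
    [/\ [set` s] = U `&` g @^-1` [set w],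
        forall z, z \in s -> has_multiplicity g z (m z) &
        (\sum_(z <- s) m z)%N = d].

Definition proper_holomorphic g U V :=
  [/\ g @` U `<=` V, holomorphic_on U g &
      forall K, compact K -> K `<=` V -> compact (U `&` g @^-1` K)].

Definition proper_of_degree_le g U V (N : nat) :=
  proper_holomorphic g U V /\ exists2 d, (d <= N)%N & has_degree g U V d.

(* Up to homeomorphisms, [g : (A, a) -> (W, w)] is z |-> z ^ k on the disk. *)
Definition power_model g A W (a w : C) (k : nat) :=
  exists phi phi' psi psi' : C -> C,
    [/\ homeo phi phi' A (disk 0 1), homeo psi psi' W (disk 0 1),
        phi a = 0, psi w = 0 & forall x, A x -> psi (g x) = phi x ^+ k].

Definition branched_covering g U V (d : nat) :=
  g @` U `<=` V /\
  forall w, V w -> exists W (s : {fset C}) (A : C -> set C) (k : C -> nat),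
    [/\ [/\ open W, W w & W `<=` V],
        [set` s] = U `&` g @^-1` [set w],
        forall a, a \in s ->
          [/\ open (A a), (0 < k a)%N & power_model g (A a) W a w (k a)],
        trivIset [set` s] A /\
          \bigcup_(a in [set` s]) A a = U `&` g @^-1` W &
        (\sum_(a <- s) k a)%N = d].

Definition holomorphic_covering g U V :=
  [/\ holomorphic_on U g, g @` U = V &
      forall w, V w -> exists W (F : set (set C)),
        [/\ [/\ open W, W w & W `<=` V],
            forall A, F A -> open A /\ exists k, homeo g k A W,
            trivIset F id & \bigcup_(A in F) A = U `&` g @^-1` W]].

End Maps.

Section HyperbolicMetric.
Context {R : realType}.
Local Notation C := (Cplx R).
Implicit Types (U V W : set C) (g : R -> C).

Definition universal_cover_at (Omega : set C) (z : C) (p : C -> C) :=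
  holomorphic_covering p (disk 0 1) (connected_component Omega z).

Definition carries_hyperbolic_metric (Omega : set C) :=
  forall z, Omega z -> exists p, universal_cover_at Omega z p.

Definition cabs (z : C) : R := complex.Re `|z|.

(* rho (p x) * |p' x| = 2 / (1 - |x|^2) (curvature -1) for every covering p of
   the component by the unit disk.  The value does not depend on the choice of
   p and x, so the infimum is over a singleton; it is +oo where the component
   carries no hyperbolic metric. *)
Definition hyp_density (Omega : set C) (z : C) : \bar R :=
  ereal_inf [set r : \bar R | exists p x,
    [/\ universal_cover_at Omega z p, disk 0 1 x, p x = z &
        r = (2 / ((1 - cabs x ^+ 2) * cabs (derive1 p x)))%:E]].

Definition re_part g : R -> R := fun t => complex.Re (g t).
Definition im_part g : R -> R := fun t => complex.Im (g t).

Definition C1 g :=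
  forall h : R -> R, h = re_part g \/ h = im_part g ->
    (forall t : R, derivable h t 1) /\ continuous (derive1 h).

Definition speed g (t : R) : R :=
  Num.sqrt (derive1 (re_part g) t ^+ 2 + derive1 (im_part g) t ^+ 2).

Definition arc_length (Omega : set C) g : \bar R :=
  \int[lebesgue_measure]_(t in `[0%R, 1%R])
    (hyp_density Omega (g t) * (speed g t)%:E)%E.

(* Piecewise C^1 curves from z to w are finite concatenations of C^1 arcs
   parametrized by [0, 1]. *)
Fixpoint piecewise_C1 (Omega : set C) (z : C) (s : seq (R -> C)) (w : C) :=
  if s is g :: s' then
    [/\ C1 g, forall t, t \in `[0, 1] -> Omega (g t), g 0 = z &
        piecewise_C1 Omega (g 1) s' w]
  else z = w.

(* +oo between different components of Omega. *)
Definition hyp_dist (Omega : set C) (z w : C) : \bar R :=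
  ereal_inf [set (\sum_(g <- s) arc_length Omega g)%E
            | s in [set s | piecewise_C1 Omega z s w]].

Definition hyp_diam (Omega W : set C) : \bar R :=
  ereal_sup [set hyp_dist Omega x.1 x.2 | x in W `*` W].

End HyperbolicMetric.

Section Dynamics.
Context {R : realType}.
Local Notation C := (Cplx R).
Local Notation Chat := (Sphere R).
Implicit Types (U V W Omega : set C) (f : C -> Chat).

(* Value 0 at infinity; only used where the argument is finite. *)
Definition finite_part (q : Chat) : C := odflt 0 (q : option C).

(* The chart of the sphere at p: the identity if p is finite, and inversion if
   p is infinity. *)
Definition chart (p q : Chat) : C :=
  match (p : option C), (q : option C) with
  | Some _, _ => finite_part q
  | None, Some w => w^-1
  | None, None => 0
  end.

Definition meromorphic f :=
  forall z : C, {for z, continuous f} /\ derivable (chart (f z) \o f) z 1.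

Definition nonconstant f := ~ exists q, forall z, f z = q.

Definition moebius (a b c d z : C) : Chat :=
  if c * z + d == 0 then infty_pt else finite_pt ((a * z + b) / (c * z + d)).

Definition nonlinear f :=
  ~ exists a b c d : C, a * d - b * c != 0 /\ f =1 moebius a b c d.

Definition critical_point f (z : C) := derive1 (chart (f z) \o f) z = 0.

Definition critical_value f (q : Chat) :=
  exists2 z, critical_point f z & f z = q.

Definition asymptotic_value f (q : Chat) :=
  exists g : R -> C,
    [/\ {within `[0%R, +oo[, continuous g},
        finite_pt (g t) @[t --> +oo] --> infty_pt &
        f (g t) @[t --> +oo] --> q].

Definition singular_set f : set Chat :=
  closure (critical_value f `|` asymptotic_value f).

(* The outer [None] means "undefined": f is not defined at infinity. *)
Definition iterate f (n : nat) (q : Chat) : option Chat :=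
  iter n (obind (fun p : Chat => omap f (p : option C))) (Some q).

Definition postsingular_set f : set Chat :=
  closure [set q | exists s n, singular_set f s /\ iterate f n s = Some q].

Definition meets_postsingular f U := exists2 z, U z & postsingular_set f (finite_pt z).

Definition iterate_preimage f (n : nat) V : set C :=
  [set z | exists2 w, V w & iterate f n (finite_pt z) = Some (finite_pt w)].

(* f^n as a C-valued map, meaningful on f^{-n}(C). *)
Definition iterate_map f (n : nat) (z : C) : C :=
  oapp finite_part 0 (iterate f n (finite_pt z)).

Definition regular_point f (Delta : nat) (z0 : C) :=
  exists2 delta : R, 0 < delta &
    forall (n : nat) U,
      is_component (iterate_preimage f n (disk z0 delta)) U ->
      meets_postsingular f U ->
      simply_connected U /\
      exists2 d, (d <= Delta)%N &
        branched_covering (iterate_map f n) U (disk z0 delta) d.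

Definition coverable (n : nat) :=
  exists c : 'I_n -> C,
    (forall i, disk 0 1 (c i)) /\
    disk 0 1 `<=` \bigcup_(i in [set: 'I_n]) disk (c i) (3^-1).

Definition is_covering_number (n : nat) :=
  coverable n /\ forall m, coverable m -> (n <= m)%N.

Definition component_diam_bound (N : nat) (eta c : R) :=
  forall (z0 : C) (delta : R) U (g : C -> C),
    0 < delta -> simply_connected_domain U ->
    proper_of_degree_le g U (disk z0 delta) N ->
    forall A, is_component (U `&` g @^-1` disk z0 (eta * delta)) A ->
      (hyp_diam U A <= c%:E)%E.

Definition branched_value f U (s : Chat) :=
  exists u, [/\ U u, critical_point f u & f u = s].

(* Simple connectivity of U is a consequence of the first two clauses when V is
   simply connected (Riemann-Hurwitz); it is kept as part of the definition. *)
Definition controlled_branching f (S0 : {fset Chat}) (D : nat) U V :=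
  [/\ proper_of_degree_le (finite_part \o f) U V D,
      forall s s', branched_value f U s -> branched_value f U s' -> s = s',
      simply_connected U &
      forall s, branched_value f U s ->
        s \in S0 /\
        forall j z, iterate f j s = Some (finite_pt z) -> ~ U z].

Definition regular_N (S0 : {fset Chat}) (D : nat) : nat := (D ^ #|` S0|)%N.

Definition regular_C0 (N0 : nat) (Cst : nat -> R -> R)
    (S0 : {fset Chat}) (D : nat) : R :=
  N0%:R * (regular_N S0 D)%:R * Cst (regular_N S0 D) (2 / 3).

Definition regular_set (N0 : nat) (Cst : nat -> R -> R) f
    (S0 : {fset Chat}) (D : nat) Omega :=
  [/\ Omega !=set0, open Omega, carries_hyperbolic_metric Omega,
      iterate_preimage f 1 Omega `<=` Omega &
      forall V U,
        V `<=` Omega -> simply_connected_domain V ->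
        is_component (iterate_preimage f 1 V) U ->
        (exists W U',
          [/\ W `<=` Omega, V `<=` W,
              (hyp_diam Omega W <= (2 * regular_C0 N0 Cst S0 D)%:E)%E,
              is_component (iterate_preimage f 1 W) U' /\ U `<=` U' &
              meets_postsingular f U']) ->
        controlled_branching f S0 D U V].

End Dynamics.

(* Main.v *)
Require Import Defs.
From HB Require Import structures.
From mathcomp Require Import all_boot all_order all_algebra finmap.
From mathcomp Require Import all_classical all_reals all_analysis.
From mathcomp Require Import complex ring lra.
Import numFieldNormedType.Exports.
Import Order.TTheory GRing.Theory Num.Theory.
Set Implicit Arguments.
Unset Strict Implicit.
Unset Printing Implicit Defensive.
Local Open Scope classical_set_scope.
Local Open Scope ring_scope.

(** Let V_n be a component of f^-n(D_delta(z0)) that meets P(f), and for k < n let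
    V_k be the component of f^-k(D_delta(z0)) that contains f^(n-k)(V_n).  As
    P(f) is forward invariant, every V_k meets P(f).

    Degrees.  If V_k has diameter at most C0, then W = V_k is admissible in the
    definition of a regular set, and f : V_(k+1) -> V_k has degree at most D and
    at most one branched value s, which lies in S0 and whose orbit avoids
    V_(k+1).  The orbit of s then avoids all further pullbacks too, so no s can
    serve twice: at most #S0 of the maps are branched.  The others have degree
    one, since over a simply connected set a proper map without critical points
    is injective.  Hence f^n : V_n -> V_0 has degree at most N = D^#S0
    ([tower_degree]).

    Diameters.  The bound C0 is proved by induction on n, for all z0 and delta
    at once ([all_controlled]).  Cover D_delta(z0) by N0 disks of radius delta/3
    with centres w_i, and pull the disks D_(delta/2)(w_i) back along the V_k.
    Such a pullback U_k has a point in common with V_k.  If U_k meets P(f), then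
    U_k and V_k both have diameter at most C0 by induction, and W = U_k u V_k,
    whose diameter is at most 2 C0, is admissible.  If U_k does not meet P(f),
    it contains no singular value, and f is conformal over it
    ([conformal_controlled]).  In both cases the step U_(k+1) -> U_k is
    controlled ([half_disk_tower]), so that the degree of U_n -> D_(delta/2)(w_i)
    is at most N, and every component over D_(delta/3)(w_i) has diameter at most
    C(N, 2/3) in U_n.  By the Schwarz-Pick lemma the same bound holds in Omega
    ([hyp_density_anti]).  The components of this kind that touch V_n contain a
    point of V_n over w_i ([proper_component_surj]), so there are at most N0 N of
    them.  They are open and cover the connected set V_n, so two points of V_n
    are joined by a chain of them ([chain_diam]), and the diameter of V_n is at
    most N0 N C(N, 2/3) = C0 ([pullback_diam]).

    The first assertion follows: C0 is positive ([component_diam_bound_pos]), so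
    every point of Omega has a disk small enough for the second assertion
    ([small_hyp_disk]), and a proper map with a degree is a branched covering,
    because it looks like a power near every point
    ([proper_branched_covering]).

    The function theory behind this starts from derivatives stated with real
    moduli ([cder]).  Goursat's subdivision argument gives primitives on disks.
    Averages over roots of unity replace circle integrals in Cauchy's estimate
    ([cauchy_estimate]); applied to difference quotients, the estimate shows that
    derivatives are holomorphic ([hol_derive]).  Splitting off powers of z - a
    yields multiplicities, and local inversion yields the normal form
    z |-> z ^ k.  Finally, real induction lifts paths and homotopies through
    local biholomorphisms ([path_lifting_cluster], [monodromy], [disk_lift]).
    This serves three times: for coverings by the unit disk, for proper maps,
    and for f over a set without singular values, where a path whose lift leaves
    every compact set would lead to an asymptotic value
    ([escaping_lift_asymptotic]). *)

(** * Moduli and disks *)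

Section Basics.
Context {R : realType}.
Local Notation C := (Cplx R).
Implicit Types (z w : C) (r e : R).

Definition toC (r : R) : C := (r%:C)%C.

Lemma normCE (z : C) : `|z| = toC (cabs z).
Proof. by rewrite /cabs /toC; case: z => a b; rewrite /= normc_def. Qed.
Lemma toCD : {morph toC : x y / x + y}. Proof. by move=> x y; rewrite /toC rmorphD. Qed.
Lemma toCM : {morph toC : x y / x * y}. Proof. by move=> x y; rewrite /toC rmorphM. Qed.
Lemma toC_lt x y : (toC x < toC y) = (x < y). Proof. by rewrite /toC ltcR. Qed.
Lemma toC_le x y : (toC x <= toC y) = (x <= y). Proof. by rewrite /toC lecR. Qed.
Lemma toC_inj : injective toC. Proof. by move=> x y [] . Qed.
Lemma cabs_ge0 z : 0 <= cabs z.
Proof. by rewrite -toC_le -normCE /toC normr_ge0. Qed.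
Lemma cabsM z w : cabs (z * w) = cabs z * cabs w.
Proof. by apply: toC_inj; rewrite toCM -!normCE normrM. Qed.
Lemma cabsD z w : cabs (z + w) <= cabs z + cabs w.
Proof. by rewrite -toC_le toCD -!normCE ler_normD. Qed.
Lemma cabsN z : cabs (- z) = cabs z.
Proof. by apply: toC_inj; rewrite -!normCE normrN. Qed.
Lemma cabsB z w : cabs (z - w) = cabs (w - z).
Proof. by rewrite -cabsN opprB. Qed.
Lemma cabs0 : cabs 0 = 0 :> R.
Proof. by apply: toC_inj; rewrite -!normCE normr0. Qed.
Lemma cabs1 : cabs 1 = 1 :> R.
Proof. by apply: toC_inj; rewrite -!normCE normr1. Qed.
Lemma cabs_eq0 z : (cabs z == 0) = (z == 0).
Proof. by rewrite -[RHS]normr_eq0 normCE; apply/eqP/eqP => [->//|/toC_inj]. Qed.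
Lemma cabs_gt0 z : (0 < cabs z) = (z != 0).
Proof. by rewrite lt_neqAle cabs_ge0 andbT eq_sym cabs_eq0. Qed.
Lemma cabsV z : cabs z^-1 = (cabs z)^-1.
Proof. by apply: toC_inj; rewrite /toC fmorphV -!/(toC _) -!normCE normfV. Qed.
Lemma cabsX z n : cabs (z ^+ n) = cabs z ^+ n.
Proof. by elim: n => [|n IH]; rewrite ?expr0 ?cabs1 // !exprS cabsM IH. Qed.
Lemma cabs_real r : cabs (toC r) = `|r|.
Proof. by apply: toC_inj; rewrite -normCE /toC normc_def /= expr0n addr0 sqrtr_sqr. Qed.
Lemma diskE z r w : disk z r w <-> cabs (z - w) < r.
Proof. by rewrite /disk -ball_normE /ball_ /= normCE toC_lt. Qed.
End Basics.

(** * Continuity and derivatives in terms of moduli *)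

Section Basics.
Context {R : realType}.
Local Notation C := (Cplx R).
Implicit Types (z w : C) (r e : R).

Lemma diskP z r w : disk z r w <-> cabs (w - z) < r.
Proof. by rewrite diskE cabsB. Qed.

Lemma posC (e : C) : 0 < e -> 0 < complex.Re e /\ e = toC (complex.Re e).
Proof.
move=> e0; have eR : e = toC (complex.Re e).
  by case: e e0 => a b; rewrite ltcE /= => /andP[/eqP -> _].
by split=> //; rewrite -toC_lt -eR.
Qed.

Lemma nbhs_diskP z (A : set C) : nbhs z A <-> exists2 r, 0 < r & disk z r `<=` A.
Proof.
split.
  move=> /nbhs_ballP[e /= /posC[e0 ->] eA]; by exists (complex.Re e).
move=> [r r0 rA]; apply/nbhs_ballP; exists (toC r) => //=.
by rewrite /toC ltcR.
Qed.

Lemma openP_disk (A : set C) :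
  open A <-> forall z, A z -> exists2 r, 0 < r & disk z r `<=` A.
Proof.
rewrite openE; split=> H z Az.
  by apply/nbhs_diskP; exact: H.
by rewrite /interior /=; apply/nbhs_diskP; exact: H.
Qed.

Lemma open_disk z r : open (disk z r).
Proof.
apply/openP_disk => w /diskP wz; exists (r - cabs (w - z)); first lra.
move=> u /diskP uw; apply/diskP; have := cabsD (u - w) (w - z).
have -> : u - w + (w - z) = u - z by ring.
lra.
Qed.

Lemma disk_center z r : 0 < r -> disk z r z.
Proof. by move=> r0; apply/diskP; rewrite subrr cabs0. Qed.

Lemma normRe z : `|complex.Re z| <= cabs z.
Proof.
case: z => a b; rewrite /cabs /= -sqrtr_sqr ler_sqrt ?addr_ge0 ?sqr_ge0 //.
by rewrite lerDl sqr_ge0.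
Qed.
Lemma normIm z : `|complex.Im z| <= cabs z.
Proof.
case: z => a b; rewrite /cabs /= -sqrtr_sqr ler_sqrt ?addr_ge0 ?sqr_ge0 //.
by rewrite lerDr sqr_ge0.
Qed.
Lemma cabs_ReIm z : cabs z <= `|complex.Re z| + `|complex.Im z|.
Proof.
case: z => a b; rewrite /cabs /=.
rewrite -[leRHS]ger0_norm ?addr_ge0 // -sqrtr_sqr ler_sqrt ?sqr_ge0 //.
rewrite sqrrD !real_normK ?num_real // -addrA lerD2l lerDr.
by rewrite mulrn_wge0 // mulr_ge0.
Qed.

Lemma cvgC_atP (T : topologicalType) (F : set_system T) (FF : Filter F)
    (g : T -> C) l :
  (g @ F --> l) <-> forall e, 0 < e -> \forall x \near F, cabs (g x - l) < e.
Proof.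
split.
  move=> gl e e0; have Hl : nbhs l (disk l e) by apply/nbhs_diskP; exists e.
  have Hd : F (g @^-1` disk l e) := gl _ Hl.
  by apply: filterS Hd => x /diskP.
move=> H A /nbhs_diskP[e e0 eA].
have He := H _ e0.
have : F (g @^-1` A) by apply: filterS He => x xl; apply: eA; apply/diskP.
by [].
Qed.

Lemma contC_atP (T : topologicalType) (g : T -> C) x :
  {for x, continuous g} <->
  forall e, 0 < e -> \forall y \near x, cabs (g y - g x) < e.
Proof. exact: (@cvgC_atP T (nbhs x) _ g (g x)). Qed.

Lemma contCCP (g : C -> C) z :
  {for z, continuous g} <-> forall e, 0 < e -> exists2 d, 0 < d &
    forall w, cabs (w - z) < d -> cabs (g w - g z) < e.
Proof.
apply: (iff_trans (contC_atP _ _)); split=> H e /H.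
  by move=> /nbhs_diskP[d d0 dH]; exists d => // w wz; apply: dH; apply/diskP.
by move=> [d d0 dH]; apply/nbhs_diskP; exists d => // w /diskP; exact: dH.
Qed.

(** The error is measured by real moduli because the norm of the complex numbers
    takes complex values. *)
Definition cder (g : C -> C) z (d : C) := forall e : R, 0 < e ->
  exists2 del, 0 < del & forall w, cabs (w - z) < del ->
    cabs (g w - g z - d * (w - z)) <= e * cabs (w - z).

Lemma is_deriveP (g : C -> C) z (d : C) : is_derive z (1 : C) g d <-> cder g z d.
Proof.
have E : forall h : C, h != 0 -> 
   cabs (h^-1 *: (g (h *: (1:C) + z) - g z) - d) * cabs h = cabs (g (z + h) - g z - d * h).
  move=> h h0; rewrite -cabsM; congr cabs.
  rewrite /GRing.scale /= mulr1 mulrBl mulrAC mulVf // mul1r (addrC h). by [].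
split.
  case=> D Dd e e0.
  have /cvgC_atP /(_ _ e0) : h^-1 *: (g (h *: (1:C) + z) - g z) @[h --> (0:C)^'] --> d by rewrite -Dd; exact: D.
  rewrite near_withinE => /nbhs_diskP[del del0 H]; exists del => // w wz.
  have [->|wz0] := eqVneq w z; first by rewrite !subrr mulr0 subr0 cabs0 mulr0.
  have h0 : w - z != 0 by rewrite subr_eq0.
  have := H (w - z); rewrite diskP subr0 => /(_ wz h0) Hw.
  have := E _ h0; rewrite (_ : z + (w - z) = w); last by ring.
  move=> <-.
  by rewrite ler_wpM2r ?cabs_ge0 // ltW.
move=> H; 
have K : h^-1 *: (g (h *: (1:C) + z) - g z) @[h --> (0:C)^'] --> d.
  apply/cvgC_atP => e e0; have e20 : 0 < e / 2 by lra.
  have [del del0 Hd] := H _ e20.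
  rewrite near_withinE; apply/nbhs_diskP; exists del => // h /diskP.
  rewrite subr0 => hd h0.
  have := Hd (z + h); rewrite (_ : z + h - z = h); last by ring.
  move=> /(_ hd).
  rewrite -E // ler_pM2r ?cabs_gt0 // => ?; lra.
by split; [apply/cvg_ex; exists d | exact: cvg_lim K].
Qed.
End Basics.

(** * Derivatives and the mean value inequality *)

Section Calculus.
Context {R : realType}.
Local Notation C := (Cplx R).
Implicit Types (z w : C) (r e : R).

Lemma toCB : {morph @toC R : x y / x - y}. Proof. by move=> x y; rewrite /toC rmorphB. Qed.
Lemma toC0 : toC 0 = 0 :> C. Proof. by rewrite /toC rmorph0. Qed.
Lemma toC1 : toC 1 = 1 :> C. Proof. by rewrite /toC rmorph1. Qed.
Lemma toCV (x : R) : toC x^-1 = (toC x)^-1. Proof. by rewrite /toC fmorphV. Qed.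

Lemma cabs_small z : (forall e, 0 < e -> cabs z <= e) -> z = 0.
Proof.
move=> H; apply/eqP; rewrite -cabs_eq0 eq_le cabs_ge0 andbT.
apply/ler_addgt0Pr => e e0; rewrite add0r; exact: H.
Qed.

(** The supremum of the parameters up to which [P] holds satisfies [P] by the
    second hypothesis, and the third one pushes beyond it unless it is 1. *)
Lemma real_induction (P : R -> Prop) :
  P 0 ->
  (forall t, 0 < t <= 1 -> (forall s, 0 <= s < t -> P s) -> P t) ->
  (forall t, 0 <= t < 1 -> P t -> 
     exists2 d, 0 < d & forall s, t < s < t + d -> s <= 1 -> P s) ->
  forall t : R, 0 <= t <= 1 -> P t.
Proof.
move=> P0 Pl Pr.
pose S := [set t | 0 <= t <= 1 /\ forall s, 0 <= s <= t -> P s].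
have S0 : S 0 by split; [lra | move=> s s0; have -> : s = 0 by lra].
have Sb : ubound S 1 by move=> t [/andP[]].
have hS : has_sup S by split; [exists 0 | exists 1].
set m := sup S.
have m0 : 0 <= m by apply: sup_upper_bound.
have m1 : m <= 1 by apply: ge_sup => //; exists 0.
have Pm s : 0 <= s < m -> P s.
  move=> /andP[s0 sm]; have := @sup_adherent _ S (m - s).
  rewrite subr_gt0 => /(_ sm hS) [t [t01 Pt] st]; apply: Pt.
  by rewrite s0 /=; move: st; rewrite -/m; lra.
have PPm : P m.
  have [->//|mn0] := eqVneq m 0; apply: Pl => //.
  by rewrite m1 lt_neqAle eq_sym mn0 m0.
have Sm : S m.
  split; first by rewrite m0.
  move=> s /andP[s0]; rewrite le_eqVlt => /orP[/eqP->//|sm].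
  by apply: Pm; rewrite s0.
have [m_eq|mlt] : m = 1 \/ m < 1 by move: m1; rewrite le_eqVlt => /orP[/eqP|]; [left|right].
  by move=> t t01; case: Sm => _; apply; rewrite m_eq.
have [d d0 Hd] : exists2 d, 0 < d & forall s, m < s < m + d -> s <= 1 -> P s.
  by apply: Pr => //; rewrite m0.
pose u := Num.min 1 (m + d / 2).
have mu : m < u by rewrite /u lt_min mlt; lra.
have u1 : u <= 1 by rewrite /u ge_min lexx.
have ud : u <= m + d / 2 by rewrite /u ge_min lexx orbT.
have : S u.
  split; first by rewrite u1 andbT; lra.
  move=> s /andP[s0 su]; have [sm|ms] := leP s m.
    by case: Sm => _; apply; rewrite s0.
  by apply: Hd; [rewrite ms /=; lra | exact: le_trans u1].
by move=> /(sup_upper_bound hS); rewrite -/m; lra.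
Qed.

(** Real induction for properties that propagate locally in both directions of
    approach: to [t] from nearby earlier parameters, and from [t] to later ones. *)
Lemma interval_induction (P : R -> Prop) : P 0 ->
  (forall t, 0 <= t <= 1 -> exists2 eta, 0 < eta & forall t1 t2, 0 <= t1 <= t2 -> t2 <= 1 ->
     `|t1 - t| < eta -> `|t2 - t| < eta -> P t1 -> P t2) ->
  forall t : R, 0 <= t <= 1 -> P t.
Proof.
move=> P0 step; apply: real_induction => //.
- move=> t /andP[t0 t1] IH; have [|eta eta0 He] := step t; first by rewrite (ltW t0).
  pose v := Num.max 0 (t - eta / 2).
  have v0 : 0 <= v by rewrite /v le_max lexx.
  have vt : v < t by rewrite /v gt_max t0; lra.
  have vd : t - eta / 2 <= v by rewrite /v le_max lexx orbT.
  apply: (He v t) => //; first by rewrite v0 ltW.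
  + by rewrite distrC gtr0_norm ?subr_gt0 //; lra.
  + by rewrite subrr normr0.
  + by apply: IH; rewrite v0.
- move=> t /andP[t0 t1] Pt; have [|eta eta0 He] := step t; first by rewrite t0 ltW.
  exists eta => // s /andP[ts se] s1; apply: (He t s) => //.
  + by rewrite t0 ltW.
  + by rewrite subrr normr0.
  + by rewrite gtr0_norm ?subr_gt0 //; lra.
Qed.

Definition rcder (g : R -> C) (t : R) (d : C) := forall e : R, 0 < e ->
  exists2 del, 0 < del & forall s, `|s - t| < del ->
    cabs (g s - g t - toC (s - t) * d) <= e * `|s - t|.

Lemma cabs_le_of_diff z w : cabs z <= cabs (z - w) + cabs w.
Proof. by have := cabsD (z - w) w; rewrite subrK. Qed.

(** By real induction with a slope slightly larger than [M], so that the error of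
    the linear approximation is absorbed. *)
Lemma mean_ineq (g d : R -> C) (M : R) :
  (forall t : R, 0 <= t <= 1 -> rcder g t (d t)) ->
  (forall t : R, 0 <= t <= 1 -> cabs (d t) <= M) -> cabs (g 1 - g 0) <= M.
Proof.
move=> Hd HM; apply/ler_addgt0Pr => e e0.
have M0 : 0 <= M by apply: le_trans (HM 0 _); rewrite ?cabs_ge0 ?lexx ?ler01.
have K t : 0 <= t <= 1 -> exists2 del, 0 < del &
    forall s, `|s - t| < del -> cabs (g s - g t) <= (M + e) * `|s - t|.
  move=> t01; have [del del0 H] := Hd t t01 e e0; exists del => // s /H Hs.
  have := cabs_le_of_diff (g s - g t) (toC (s - t) * d t).
  rewrite cabsM cabs_real => Q; rewrite mulrDl.
  have : `|s - t| * cabs (d t) <= M * `|s - t| by rewrite mulrC ler_wpM2r // HM.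
  lra.
suff P t : 0 <= t <= 1 -> cabs (g t - g 0) <= (M + e) * t.
  by have := P 1; rewrite mulr1 => -> //; rewrite ler01 lexx.
move: t; apply: real_induction.
- by rewrite subrr cabs0 mulr0.
- move=> t /andP[t0 t1] IH; have [|del del0 H] := K t; first by rewrite ltW.
  pose s := Num.max 0 (t - del / 2).
  have s0 : 0 <= s by rewrite /s le_max lexx.
  have st : s < t by rewrite /s gt_max t0; lra.
  have sd : t - del / 2 <= s by rewrite /s le_max lexx orbT.
  have st' : `|s - t| = t - s by rewrite distrC gtr0_norm // subr_gt0.
  have := H s; rewrite st' => /(_ ltac:(lra)) Hs.
  have := IH s; rewrite s0 st => /(_ isT) Is.
  have := cabsD (g t - g s) (g s - g 0); rewrite addrA subrK cabsB.
  by move: Hs Is; nra.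
- move=> t /andP[t0 t1] IH; have [|del del0 H] := K t; first by rewrite t0 ltW.
  exists del => // s /andP[ts sd] s1.
  have st' : `|s - t| = s - t by rewrite gtr0_norm // subr_gt0.
  have := H s; rewrite st' => /(_ ltac:(lra)) Hs.
  have := cabsD (g s - g t) (g t - g 0); rewrite addrA subrK.
  by move: Hs IH; nra.
Qed.

Lemma cder_cont g z (d : C) : cder g z d -> {for z, continuous g}.
Proof.
move=> H; apply/contCCP => e e0.
have [del del0 Hd] := H 1 ltr01.
pose K := 1 + cabs d.
have K0 : 0 < K by rewrite /K; have := cabs_ge0 d; lra.
exists (Num.min del (e / K)); first by rewrite lt_min del0 divr_gt0.
move=> w; rewrite lt_min => /andP[/Hd wd we].
have := cabs_le_of_diff (g w - g z) (d * (w - z)); rewrite cabsM.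
move: we; rewrite ltr_pdivlMr // /K; move: wd; lra.
Qed.

Lemma cder_uniq g z (d1 d2 : C) : cder g z d1 -> cder g z d2 -> d1 = d2.
Proof. by move=> /is_deriveP H1 /is_deriveP H2; rewrite -(@derive_val _ _ _ _ _ _ _ H1) (@derive_val _ _ _ _ _ _ _ H2). Qed.
Lemma cder_cst (c z : C) : cder (fun=> c) z 0.
Proof. by apply/is_deriveP; exact: is_derive_cst. Qed.
Lemma cder_id (z : C) : cder id z 1.
Proof. by apply/is_deriveP; exact: is_derive_id. Qed.
Lemma cder_eq g z (d d' : C) : cder g z d -> d = d' -> cder g z d'.
Proof. by move=> ? <-. Qed.
Lemma cder_ext g h z (d : C) : (forall w, g w = h w) -> cder g z d -> cder h z d.
Proof. by move=> /funext ->. Qed.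
Lemma cderD g h z (a b : C) : cder g z a -> cder h z b -> cder (fun w => g w + h w) z (a + b).
Proof. by move=> /is_deriveP ? /is_deriveP ?; apply/is_deriveP; exact: is_deriveD. Qed.
Lemma cderN g z (a : C) : cder g z a -> cder (fun w => - g w) z (- a).
Proof. by move=> /is_deriveP ?; apply/is_deriveP; exact: is_deriveN. Qed.
Lemma cderB g h z (a b : C) : cder g z a -> cder h z b -> cder (fun w => g w - h w) z (a - b).
Proof. by move=> ? ?; apply: cderD => //; apply: cderN. Qed.
Lemma cderM g h z (a b : C) : cder g z a -> cder h z b -> cder (fun w => g w * h w) z (a * h z + g z * b).
Proof.
move=> /is_deriveP H1 /is_deriveP H2; apply/is_deriveP.
have K : is_derive z (1:C) (fun w => g w * h w) _ := is_deriveM H1 H2.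
apply: (is_derive_eq K).
by rewrite /GRing.scale /= addrC (mulrC a).
Qed.
Lemma cderZ (c : C) g z (a : C) : cder g z a -> cder (fun w => c * g w) z (c * a).
Proof. by move=> H; apply: cder_eq (cderM (cder_cst c z) H) _; rewrite mul0r add0r. Qed.
Lemma cderX g z (a : C) n : cder g z a -> cder (fun w => g w ^+ n) z (n%:R * g z ^+ n.-1 * a).
Proof.
move=> H; elim: n => [|n IH].
  by apply: (@cder_ext (fun=> 1)) => //; rewrite !mul0r; exact: cder_cst.
apply: (@cder_ext (fun w => g w * g w ^+ n)); first by move=> w; rewrite exprS.
apply: cder_eq (cderM H IH) _; case: n {IH} => [|n] /=; rewrite ?exprS; ring.
Qed.
Lemma cderV g z (a : C) : g z != 0 -> cder g z a -> cder (fun w => (g w)^-1) z (- a / g z ^+ 2).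
Proof.
move=> g0 /is_deriveP H; have [D E] := H; apply/is_deriveP.
have K : is_derive z (1:C) (fun w => (g w)^-1) _ := derivableP (derivableV g0 D).
apply: (is_derive_eq K).
by rewrite deriveV // E /GRing.scale /= !mulNr mulrC.
Qed.
(** The chain rule for inner functions of a complex and of a real variable at
    once: [ell w] is the increment of the variable, and [dist w] its modulus. *)
Lemma chain_rule (T : Type) g (h : T -> C) (ell : T -> C) (dist : T -> R) (c a b : C) :
  cder g c a -> (forall w : T, cabs (ell w) = dist w) ->
  (forall e, 0 < e -> exists2 del, 0 < del & forall w : T, dist w < del ->
     cabs (h w - c - b * ell w) <= e * dist w) ->
  forall e, 0 < e -> exists2 del, 0 < del & forall w : T, dist w < del ->
     cabs (g (h w) - g c - a * b * ell w) <= e * dist w.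
Proof.
move=> Hg dE Hh e e0.
have d0 (w : T) : 0 <= dist w by rewrite -dE cabs_ge0.
pose K := 1 + cabs b; have K0 : 0 < K by rewrite /K; have := cabs_ge0 b; lra.
have eK : 0 < e / (2 * K) by rewrite divr_gt0 // mulr_gt0.
have [d1 d10 H1] := Hg _ eK.
pose L := 1 + cabs a; have L0 : 0 < L by rewrite /L; have := cabs_ge0 a; lra.
have eL : 0 < Num.min 1 (e / (2 * L)) by rewrite lt_min ltr01 divr_gt0 // mulr_gt0.
have [d2 d20 H2] := Hh _ eL.
exists (Num.min d2 (d1 / K)); first by rewrite lt_min d20 divr_gt0.
move=> w; rewrite lt_min => /andP[/H2 w2 w3].
have hw : cabs (h w - c) <= K * dist w.
  have := cabs_le_of_diff (h w - c) (b * ell w); rewrite cabsM dE.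
  have : Num.min 1 (e / (2 * L)) * dist w <= 1 * dist w.
    by rewrite ler_wpM2r // ge_min lexx.
  rewrite /K; move: w2; lra.
have /H1 w1 : cabs (h w - c) < d1.
  by apply: le_lt_trans hw _; rewrite mulrC -ltr_pdivlMr.
have -> : g (h w) - g c - a * b * ell w =
  (g (h w) - g c - a * (h w - c)) + a * (h w - c - b * ell w) by ring.
apply: (le_trans (cabsD _ _)); rewrite cabsM.
have A : e / (2 * K) * cabs (h w - c) <= e / 2 * dist w.
  have -> : e / 2 * dist w = e / (2 * K) * (K * dist w) by field; rewrite gt_eqF.
  by rewrite ler_wpM2l // ltW.
have B : cabs a * cabs (h w - c - b * ell w) <= e / 2 * dist w.
  have : Num.min 1 (e / (2 * L)) * dist w <= e / (2 * L) * dist w.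
    by rewrite ler_wpM2r // ge_min lexx orbT.
  move=> Q; apply: (@le_trans _ _ (L * (e / (2 * L) * dist w))).
    apply: ler_pM; rewrite ?cabs_ge0 //; last exact: le_trans w2 Q.
    by rewrite /L; lra.
  by rewrite [leLHS](_ : _ = e / 2 * dist w) //; field; rewrite gt_eqF.
by move: w1 A B; lra.
Qed.
Lemma cder_comp g h z (a b : C) : cder g (h z) a -> cder h z b -> cder (fun w => g (h w)) z (a * b).
Proof. by move=> Hg Hh; exact (@chain_rule _ g h _ _ _ _ _ Hg (fun=> erefl) Hh). Qed.
Lemma cder_local g h z (d : C) r : 0 < r -> (forall w, disk z r w -> g w = h w) ->
  cder g z d -> cder h z d.
Proof.
move=> r0 E H e e0; have [del del0 K] := H e e0.
exists (Num.min r del); first by rewrite lt_min r0.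
move=> w; rewrite lt_min => /andP[/diskP wr wd].
by rewrite -!E //; [exact: K | exact: disk_center].
Qed.

Lemma hol_cder (U : set C) g : holomorphic_on U g -> forall z, U z -> cder g z (derive1 g z).
Proof.
move=> H z Uz; apply/is_deriveP; rewrite derive1E; apply: derivableP; exact: H.
Qed.
Lemma cder_hol (U : set C) g : (forall z, U z -> exists d, cder g z d) -> holomorphic_on U g.
Proof. by move=> H z /H[d /is_deriveP []]. Qed.
Lemma cder_derive1 g z (d : C) : cder g z d -> derive1 g z = d.
Proof. by move=> /is_deriveP H; rewrite derive1E derive_val. Qed.

Lemma rcder_comp g h t (a b : C) : cder g (h t) a -> rcder h t b -> rcder (fun s => g (h s)) t (a * b).
Proof.
move=> Hg Hh e e0.
have Hh' e' : 0 < e' -> exists2 del, 0 < del & forall s, `|s - t| < del ->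
    cabs (h s - h t - b * toC (s - t)) <= e' * `|s - t|.
  by move=> /Hh[del del0 H]; exists del => // s /H; rewrite mulrC.
have [del del0 H] := chain_rule Hg (fun s => cabs_real (s - t)) Hh' e0.
by exists del => // s /H; rewrite (mulrC (toC _)).
Qed.

Lemma rcderB g h t (a b : C) : rcder g t a -> rcder h t b -> rcder (fun s => g s - h s) t (a - b).
Proof.
move=> Hg Hh e e0; have e2 : 0 < e / 2 by lra.
have [d1 d10 H1] := Hg _ e2; have [d2 d20 H2] := Hh _ e2.
exists (Num.min d1 d2); first by rewrite lt_min d10.
move=> s; rewrite lt_min => /andP[/H1 s1 /H2 s2].
have -> : g s - h s - (g t - h t) - toC (s - t) * (a - b) =
  (g s - g t - toC (s - t) * a) + - (h s - h t - toC (s - t) * b) by ring.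
apply: (le_trans (cabsD _ _)); rewrite cabsN; lra.
Qed.
Lemma rcder_affine g (a b t : R) (d : C) : rcder g (a + b * t) d ->
  rcder (fun s => g (a + b * s)) t (toC b * d).
Proof.
move=> Hg e e0; pose K := 1 + `|b|.
have K0 : 0 < K by rewrite /K; have := normr_ge0 b; lra.
have [d1 d10 H1] := Hg _ (divr_gt0 e0 K0).
exists (d1 / K); first by rewrite divr_gt0.
move=> s; rewrite ltr_pdivlMr // => sd.
have E : a + b * s - (a + b * t) = b * (s - t) by ring.
have bK : `|b * (s - t)| <= `|s - t| * K.
  by rewrite normrM mulrC ler_wpM2l // /K; lra.
have := H1 (a + b * s); rewrite E => /(_ (le_lt_trans bK sd)).
rewrite toCM (mulrC (toC b)) -mulrA => /le_trans; apply.
by rewrite mulrAC ler_pdivrMr // -mulrA ler_wpM2l // ltW.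
Qed.
Lemma rcder_line (a b : C) t : rcder (fun s => a + toC s * b) t b.
Proof.
move=> e e0; exists 1 => // s _; rewrite toCB.
have -> : a + toC s * b - (a + toC t * b) - (toC s - toC t) * b = 0 by ring.
by rewrite cabs0 mulr_ge0 // ltW.
Qed.

(** Subtracting the linear map of slope [c] turns the bound on the derivative into
    a bound on the error of linear approximation; with [c] the derivative at [a]
    this replaces Taylor's formula. *)
Lemma mean_ineq_seg (g d : C -> C) (a b c : C) (M : R) :
  (forall t : R, 0 <= t <= 1 -> cder g (a + toC t * (b - a)) (d (a + toC t * (b - a)))) ->
  (forall t : R, 0 <= t <= 1 -> cabs (d (a + toC t * (b - a)) - c) <= M) ->
  cabs (g b - g a - c * (b - a)) <= M * cabs (b - a).
Proof.
move=> Hd HM.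
have := @mean_ineq (fun t => g (a + toC t * (b - a)) - c * (a + toC t * (b - a)))
   (fun t => (d (a + toC t * (b - a)) - c) * (b - a)) (M * cabs (b - a)).
rewrite toC0 toC1 mul0r mul1r addr0 (addrC a) subrK.
have -> : g b - c * b - (g a - c * a) = g b - g a - c * (b - a) by ring.
apply.
  move=> t t01; rewrite mulrBl; apply: rcderB.
    by apply: (rcder_comp (Hd _ t01)); exact: rcder_line.
  have := @rcder_comp (fun z => c * z) _ t _ _ _ (rcder_line a (b - a) t); apply.
  by have := cderZ c (cder_id (a + toC t * (b - a))); rewrite mulr1.
by move=> t t01; rewrite cabsM ler_wpM2r ?cabs_ge0 // HM.
Qed.
End Calculus.

(** * Integrals along segments *)

Section SegmentIntegrals.
Context {R : realType}.
Local Notation C := (Cplx R).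
Implicit Types (z w : C) (r e : R).

Lemma le_or_lt (x y : R) : x <= y \/ y < x.
Proof. by case: (leP x y); [left|right]. Qed.

(** The retraction of the line onto [0, 1]: it extends a function given on [0, 1]
    continuously to all parameters. *)
Definition clamp (t : R) : R := Num.max 0 (Num.min 1 t).
Lemma clamp01 t : 0 <= clamp t <= 1.
Proof. by rewrite /clamp le_max lexx /= ge_max ler01 ge_min lexx. Qed.
Lemma clamp_id t : 0 <= t <= 1 -> clamp t = t.
Proof. by move=> /andP[t0 t1]; rewrite /clamp (min_idPr t1) (max_idPr t0). Qed.
Lemma clamp_lip s t : `|clamp s - clamp t| <= `|s - t|.
Proof.
have K u : (u <= 0 /\ clamp u = 0) \/ (0 <= u <= 1 /\ clamp u = u) \/ (1 <= u /\ clamp u = 1).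
  have [u0|u0] := le_or_lt u 0.
    by left; split=> //; apply/max_idPl; rewrite ge_min u0 orbT.
  have [u1|u1] := le_or_lt u 1.
    have u01 : 0 <= u <= 1 by lra.
    by right; left; rewrite (clamp_id u01).
  by right; right; rewrite /clamp (min_idPl (ltW u1)) (max_idPr ler01) (ltW u1).
rewrite ler_norml; have := ler_norm (s - t); have := ler_norm (t - s); rewrite (distrC t).
case: (K s) => [[? ->]|[[/andP[? ?] ->]|[? ->]]]; case: (K t) => [[? ->]|[[/andP[? ?] ->]|[? ->]]] => ? ?;
 apply/andP; split; lra.
Qed.

Lemma contRCP (g : R -> C) t :
  {for t, continuous g} <-> forall e, 0 < e -> exists2 d, 0 < d &
    forall s, `|s - t| < d -> cabs (g s - g t) < e.
Proof.
apply: (iff_trans (contC_atP _ _)); split=> H e /H.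
  move=> /nbhs_ballP[d d0 dH]; exists d => // s st; apply: dH.
  by rewrite /ball /= distrC.
move=> [d d0 dH]; apply/nbhs_ballP; exists d => // s; rewrite /ball /= distrC.
exact: dH.
Qed.

(** The lower end -1 lies strictly to the left of [0, 1], so that the fundamental
    theorem of calculus applies in the interior and gives two-sided derivatives
    also at 0 and 1. *)
Lemma real_primitive_exists (h : R -> R) : continuous h ->
  exists H : R -> R, forall t : R, 0 <= t <= 1 -> is_derive t (1:R) H (h t).
Proof.
move=> ch; exists (fun x => \int[lebesgue_measure]_(t in [set` `[(-1)%R, x]]) h t)%R.
move=> t t01.
have [] := @continuous_FTC1_closed R h (-1) t 2.
- lra.
- apply: continuous_compact_integrable; first exact: segment_compact.
  by apply: continuous_subspaceT => x; exact: ch.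
- lra.
- exact: ch.
by move=> D E; split; [exact D | rewrite -derive1E; exact E].
Qed.

Lemma real_derive_eps (H : R -> R) (t : R) (d : R) : is_derive t (1:R) H d ->
  forall e, 0 < e -> exists2 del, 0 < del & forall s, `|s - t| < del ->
   `|H s - H t - (s - t) * d| <= e * `|s - t|.
Proof.
case=> D Dd e e0.
have : h^-1 *: (H (h *: (1:R) + t) - H t) @[h --> (0:R)^'] --> d by rewrite -Dd; exact: D.
move=> /cvgrPdist_lt /(_ _ e0); rewrite near_withinE => /nbhs_ballP[del del0 K].
exists del => // s sd; have [->|st] := eqVneq s t.
  by rewrite !subrr mul0r subr0 normr0 mulr0.
have st0 : s - t != 0 by rewrite subr_eq0.
have := K (s - t); rewrite /ball /= sub0r normrN => /(_ sd st0).
rewrite /GRing.scale /= mulr1 subrK => Q.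
rewrite -ler_pdivrMr ?normr_gt0 // -normfV -normrM.
have -> : (H s - H t - (s - t) * d) / (s - t) = - (d - (s - t)^-1 * (H s - H t)) by field.
by rewrite normrN ltW.
Qed.

Lemma primitive_exists (h : R -> C) : continuous h ->
  exists G : R -> C, forall t : R, 0 <= t <= 1 -> rcder G t (h t).
Proof.
move=> ch.
have [|A HA] := @real_primitive_exists (fun t => complex.Re (h t)).
  move=> t; apply/cvgrPdist_lt => e e0; have /contRCP /(_ _ e0)[d d0 Hd] := ch t.
  apply/nbhs_ballP; exists d => // s; rewrite /ball /= distrC => /Hd.
  apply: le_lt_trans; rewrite distrC -raddfB; exact: (normRe (h s - h t)).
have [|B HB] := @real_primitive_exists (fun t => complex.Im (h t)).
  move=> t; apply/cvgrPdist_lt => e e0; have /contRCP /(_ _ e0)[d d0 Hd] := ch t.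
  apply/nbhs_ballP; exists d => // s; rewrite /ball /= distrC => /Hd.
  apply: le_lt_trans; rewrite distrC -raddfB; exact: (normIm (h s - h t)).
exists (fun t => (A t +i* B t)%C) => t t01 e e0; have e2 : 0 < e / 2 by lra.
have [d1 d10 H1] := real_derive_eps (HA t t01) e2.
have [d2 d20 H2] := real_derive_eps (HB t t01) e2.
exists (Num.min d1 d2); first by rewrite lt_min d10.
move=> s; rewrite lt_min => /andP[/H1 s1 /H2 s2].
apply: (le_trans (cabs_ReIm _)); move: s1 s2; rewrite /=.
case: (h t) => x y /=; rewrite !mul0r ?subr0 ?addr0; lra.
Qed.

Lemma halfC : toC (2^-1 : R) = 2^-1 :> C.
Proof. by rewrite toCV; congr (_^-1); rewrite /toC rmorph_nat. Qed.

(** Encoding the integral by a primitive along the segment makes the mean value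
    inequality the only estimate that integrals need. *)
Definition is_seg_integral (g : C -> C) (a b v : C) := exists G : R -> C,
  (forall t : R, 0 <= t <= 1 -> rcder G t ((b - a) * g (a + toC t * (b - a)))) /\
  G 1 - G 0 = v.

Lemma rcder_eq (g : R -> C) t (d d' : C) : rcder g t d -> d = d' -> rcder g t d'.
Proof. by move=> H <-. Qed.

Lemma seg_integral_exists g (a b : C) :
  (forall t : R, 0 <= t <= 1 -> {for a + toC t * (b - a), continuous g}) ->
  exists v, is_seg_integral g a b v.
Proof.
move=> cg; pose h t := (b - a) * g (a + toC (clamp t) * (b - a)).
have [G HG] : exists G : R -> C, forall t : R, 0 <= t <= 1 -> rcder G t (h t).
  apply: primitive_exists => t; apply/contRCP => e e0.
  pose K := 1 + cabs (b - a); have K0 : 0 < K by rewrite /K; have := cabs_ge0 (b - a); lra.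
  have /contCCP /(_ (e / K) (divr_gt0 e0 K0)) [d d0 Hd] := cg _ (clamp01 t).
  exists (d / K); first by rewrite divr_gt0.
  move=> s; rewrite ltr_pdivlMr // => st.
  rewrite /h -mulrBr cabsM.
  have : cabs (g (a + toC (clamp s) * (b - a)) - g (a + toC (clamp t) * (b - a))) < e / K.
    apply: Hd; rewrite (_ : _ - _ = toC (clamp s - clamp t) * (b - a)); last by rewrite toCB; ring.
    rewrite cabsM cabs_real; apply: le_lt_trans st; apply: ler_pM; rewrite ?cabs_ge0 //.
      exact: clamp_lip.
    by rewrite /K; lra.
  rewrite ltr_pdivlMr // mulrC; apply: le_lt_trans.
  by rewrite ler_wpM2r ?cabs_ge0 // /K; lra.
exists (G 1 - G 0), G; split=> // t t01; have := HG _ t01; rewrite /h clamp_id //.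
Qed.

(** If the integrand is close to one that has a primitive [P], the integral is
    close to the increment of [P]. *)
Lemma seg_integral_bound g (P p : C -> C) (a b v : C) (M : R) :
  is_seg_integral g a b v ->
  (forall t : R, 0 <= t <= 1 -> cder P (a + toC t * (b - a)) (p (a + toC t * (b - a)))) ->
  (forall t : R, 0 <= t <= 1 -> cabs (g (a + toC t * (b - a)) - p (a + toC t * (b - a))) <= M) ->
  cabs (v - (P b - P a)) <= M * cabs (b - a).
Proof.
move=> [G [HG <-]] HP HM.
have := @mean_ineq _ (fun t => G t - P (a + toC t * (b - a)))
   (fun t => (b - a) * g (a + toC t * (b - a)) - p (a + toC t * (b - a)) * (b - a))
   (M * cabs (b - a)).
rewrite toC0 toC1 mul0r mul1r addr0 (addrC a) subrK.
have -> : G 1 - P b - (G 0 - P a) = G 1 - G 0 - (P b - P a) by ring.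
apply.
  move=> t t01; apply: rcderB; first exact: HG.
  by apply: (rcder_comp (HP _ t01)); exact: rcder_line.
move=> t t01; rewrite (mulrC (b - a)) -mulrBl cabsM.
by apply: ler_wpM2r; [exact: cabs_ge0|exact: HM].
Qed.

Lemma seg_integral_uniq g (a b v w : C) : is_seg_integral g a b v -> is_seg_integral g a b w -> v = w.
Proof.
move=> [G [HG <-]] [H [HH <-]]; apply/eqP; rewrite -subr_eq0 -cabs_eq0 eq_le cabs_ge0 andbT.
have -> : G 1 - G 0 - (H 1 - H 0) = (G 1 - H 1) - (G 0 - H 0) by ring.
apply: (@mean_ineq _ (fun t => G t - H t) (fun=> 0)); last by rewrite cabs0.
by move=> t t01; apply: rcder_eq (rcderB (HG _ t01) (HH _ t01)) _; rewrite subrr.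
Qed.

Lemma seg_integral_sub g (a b v : C) (m n : R) : 0 <= m <= 1 -> 0 <= n <= 1 ->
  is_seg_integral g a b v ->
  exists G : R -> C, [/\ G 1 - G 0 = v, is_seg_integral g a b (G 1 - G 0) &
    is_seg_integral g (a + toC m * (b - a)) (a + toC n * (b - a)) (G n - G m)].
Proof.
move=> /andP[m0 m1] /andP[n0 n1] [G [HG <-]]; exists G; split=> //; first by exists G.
exists (fun t => G (m + (n - m) * t)); split; last by congr (G _ - G _); ring.
move=> t /andP[t0 t1].
have K : 0 <= m + (n - m) * t <= 1.
  rewrite (_ : _ + _ = m * (1 - t) + n * t); last by ring.
  by apply/andP; split; nra.
apply: rcder_eq (rcder_affine (HG _ K)) _.
rewrite toCB (toCD m) toCM toCB.
have -> : a + toC m * (b - a) + toC t * (a + toC n * (b - a) - (a + toC m * (b - a)))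
   = a + (toC m + (toC n - toC m) * toC t) * (b - a) by ring.
by ring.
Qed.

Section Disk.
Variables (g : C -> C) (c : C) (rho : R).
Hypothesis gcont : forall z, disk c rho z -> {for z, continuous g}.

Lemma disk_convex r (a b : C) t : disk c r a -> disk c r b -> 0 <= t <= 1 ->
  disk c r (a + toC t * (b - a)).
Proof.
move=> /diskP ar /diskP br /andP[t0 t1]; apply/diskP.
have -> : a + toC t * (b - a) - c = toC (1 - t) * (a - c) + toC t * (b - c).
  by rewrite toCB toC1; ring.
apply: le_lt_trans (cabsD _ _) _; rewrite !cabsM !cabs_real !ger0_norm ?subr_ge0 //.
by move: t0; rewrite le_eqVlt => /predU1P[<-|t0]; nra.
Qed.

Definition seg_integral (a b : C) : C := xget 0 [set v | is_seg_integral g a b v].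

Lemma seg_integralP (a b : C) : disk c rho a -> disk c rho b -> is_seg_integral g a b (seg_integral a b).
Proof.
move=> ar br; apply: xgetPex; apply: seg_integral_exists => t t01.
by apply: gcont; exact: disk_convex.
Qed.

Lemma seg_integral_rev (a b : C) : disk c rho a -> disk c rho b -> seg_integral b a = - seg_integral a b.
Proof.
move=> ar br.
have I1 : 0 <= (1 : R) <= 1 by rewrite ler01 lexx.
have I0 : 0 <= (0 : R) <= 1 by rewrite ler01 lexx.
have [G [E _ H]] := seg_integral_sub I1 I0 (seg_integralP ar br).
have e1 : a + toC 1 * (b - a) = b by rewrite toC1; ring.
have e0 : a + toC 0 * (b - a) = a by rewrite toC0; ring.
rewrite e1 e0 in H.
by rewrite (seg_integral_uniq (seg_integralP br ar) H) -E opprB.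
Qed.

Lemma seg_integral_mid (a b : C) : disk c rho a -> disk c rho b ->
  seg_integral a b = seg_integral a ((a + b) / 2) + seg_integral ((a + b) / 2) b.
Proof.
move=> ar br.
have I1 : 0 <= (1 : R) <= 1 by rewrite ler01 lexx.
have I0 : 0 <= (0 : R) <= 1 by rewrite ler01 lexx.
have Ih : 0 <= (2^-1 : R) <= 1 by apply/andP; split; lra.
have mr := disk_convex ar br Ih.
have mE : a + toC (2^-1 : R) * (b - a) = (a + b) / 2 by rewrite halfC; field.
rewrite mE in mr.
have [G HG] := seg_integralP ar br.
have S1 : is_seg_integral g a ((a + b) / 2) (G (2^-1) - G 0).
  exists (fun t => G (0 + 2^-1 * t)); rewrite !mulr1 !mulr0 !add0r; split=> // t t01.
  have K : 0 <= 0 + 2^-1 * t <= 1 by lra.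
  apply: rcder_eq (rcder_affine (HG.1 _ K)) _.
  rewrite !add0r toCM halfC.
  have -> : a + toC t * ((a + b) / 2 - a) = a + 2^-1 * toC t * (b - a) by field.
  by field.
have S2 : is_seg_integral g ((a + b) / 2) b (G 1 - G (2^-1)).
  exists (fun t => G (2^-1 + 2^-1 * t)); rewrite !mulr1 !mulr0 addr0; split.
    move=> t t01.
    have K : 0 <= 2^-1 + 2^-1 * t <= 1 by lra.
    apply: rcder_eq (rcder_affine (HG.1 _ K)) _.
    rewrite toCD toCM halfC.
    have -> : (a + b) / 2 + toC t * (b - (a + b) / 2) = a + (2^-1 + 2^-1 * toC t) * (b - a) by field.
    by field.
  congr (G _ - _); by field.
rewrite (seg_integral_uniq (seg_integralP ar mr) S1) (seg_integral_uniq (seg_integralP mr br) S2) -HG.2; ring.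
Qed.

Definition triangle_integral (a b d : C) : C := seg_integral a b + seg_integral b d + seg_integral d a.

Lemma disk_mid r (a b : C) : disk c r a -> disk c r b -> disk c r ((a + b) / 2).
Proof.
move=> ar br; have Ih : 0 <= (2^-1 : R) <= 1 by apply/andP; split; lra.
by have := disk_convex ar br Ih; rewrite halfC (_ : a + _ = (a + b) / 2) //; field.
Qed.

Lemma triangle_integral_split (a b d : C) : disk c rho a -> disk c rho b -> disk c rho d ->
  triangle_integral a b d = triangle_integral a ((a + b) / 2) ((d + a) / 2) + triangle_integral ((a + b) / 2) b ((b + d) / 2)
   + triangle_integral ((d + a) / 2) ((b + d) / 2) d + triangle_integral ((a + b) / 2) ((b + d) / 2) ((d + a) / 2).
Proof.
move=> ar br dr; rewrite /triangle_integral.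
have m1 := disk_mid ar br; have m2 := disk_mid br dr; have m3 := disk_mid dr ar.
rewrite (seg_integral_mid ar br) (seg_integral_mid br dr) (seg_integral_mid dr ar).
rewrite (seg_integral_rev m1 m2) (seg_integral_rev m2 m3) (seg_integral_rev m3 m1); ring.
Qed.

End Disk.
End SegmentIntegrals.

(** * Goursat's theorem and primitives on disks *)

Section Goursat.
Context {R : realType}.
Local Notation C := (Cplx R).
Implicit Types (z w : C) (r e : R).

Lemma half_pow_small (L e : R) : 0 <= L -> 0 < e -> exists n, L / 2 ^+ n < e.
Proof.
move=> L0 e0; pose n := Num.bound (L / e); exists n.
rewrite ltr_pdivrMr ?exprn_gt0 // mulrC -ltr_pdivrMr //.
have := @archi_boundP _ (L / e) (divr_ge0 L0 (ltW e0)); rewrite -/n => /lt_le_trans; apply.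
by rewrite -natrX ler_nat ltnW // ltn_expl.
Qed.

Lemma geom_seq_limit (x : nat -> R) (L : R) :
  (forall n, `|x n.+1 - x n| <= L / 2 ^+ n.+1) ->
  exists l, forall n, `|x n - l| <= L / 2 ^+ n.
Proof.
move=> H; pose lo n := x n - L / 2 ^+ n; pose hi n := x n + L / 2 ^+ n.
have hs n : L / 2 ^+ n.+1 = L / 2 ^+ n / 2.
  by rewrite exprSr invfM mulrA.
have lo_incr n m : (n <= m)%N -> lo n <= lo m.
  move=> nm; rewrite -(subnK nm); elim: (m - n)%N => [//|k IH]; rewrite addSn.
  apply: le_trans IH _; rewrite /lo; have := H (k + n)%N.
  by rewrite hs ler_norml => /andP[? _]; lra.
have hi_decr n m : (n <= m)%N -> hi m <= hi n.
  move=> nm; rewrite -(subnK nm); elim: (m - n)%N => [//|k IH]; rewrite addSn.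
  apply: le_trans IH; rewrite /hi; have := H (k + n)%N.
  by rewrite hs ler_norml => /andP[_ ?]; lra.
have L0 n : 0 <= L / 2 ^+ n.
  have : 0 <= L / 2 ^+ n.+1 by apply: le_trans (H n).
  by rewrite hs; lra.
have lohi n m : lo n <= hi m.
  apply: (@le_trans _ _ (lo (maxn n m))); first by apply: lo_incr; exact: leq_maxl.
  apply: (@le_trans _ _ (hi (maxn n m))).
    by rewrite /lo /hi; have := L0 (maxn n m); lra.
  by apply: hi_decr; exact: leq_maxr.
pose S := range lo.
have hS : has_sup S.
  by split; [exists (lo 0%N), 0%N | exists (hi 0%N) => _ [n _ <-]].
exists (sup S) => n; rewrite ler_norml.
have h1 : lo n <= sup S by apply: sup_upper_bound => //; exists n.
have h2 : sup S <= hi n by apply: ge_sup; [exists (lo 0%N), 0%N | move=> _ [m _ <-]].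
by move: h1 h2; rewrite /lo /hi => ? ?; apply/andP; split; lra.
Qed.

(** Steps that shrink by halves make a Cauchy sequence with an explicit rate of
    convergence, which is what nested triangles provide. *)
Lemma geom_seq_limitC (x : nat -> C) (L : R) :
  (forall n, cabs (x n.+1 - x n) <= L / 2 ^+ n.+1) ->
  exists l, forall n, cabs (x n - l) <= 2 * (L / 2 ^+ n).
Proof.
move=> H.
have [a Ha] := @geom_seq_limit (fun n => complex.Re (x n)) L (fun n =>
  le_trans (eq_ind _ (fun y => `|y| <= _) (normRe (x n.+1 - x n)) _ (raddfB _ _ _)) (H n)).
have [b Hb] := @geom_seq_limit (fun n => complex.Im (x n)) L (fun n =>
  le_trans (eq_ind _ (fun y => `|y| <= _) (normIm (x n.+1 - x n)) _ (raddfB _ _ _)) (H n)).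
exists (a +i* b)%C => n; apply: le_trans (cabs_ReIm _) _.
rewrite !raddfB /=; have := Ha n; have := Hb n; lra.
Qed.

Section Tri.
Variables (g dg : C -> C) (c : C) (rho : R).
Hypothesis gder : forall z, disk c rho z -> cder g z (dg z).

Let gcont z : disk c rho z -> {for z, continuous g}.
Proof. by move=> /gder/cder_cont. Qed.

Definition triangle_within (L s : R) (T : C * C * C) :=
  [/\ cabs (T.1.1 - T.1.2) <= L, cabs (T.1.2 - T.2) <= L & cabs (T.2 - T.1.1) <= L] /\
  [/\ cabs (T.1.1 - c) <= s, cabs (T.1.2 - c) <= s & cabs (T.2 - c) <= s].

Definition triangle_integral3 (T : C * C * C) := triangle_integral g T.1.1 T.1.2 T.2.

Lemma cabs_half (z : C) : cabs (z / 2) = cabs z / 2.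
Proof. by rewrite cabsM cabsV -(_ : toC 2 = 2) ?cabs_real ?ger0_norm // /toC rmorph_nat. Qed.

Lemma cabs_mid (a b : C) s : cabs (a - c) <= s -> cabs (b - c) <= s ->
  cabs ((a + b) / 2 - c) <= s.
Proof.
move=> ? ?; have -> : (a + b) / 2 - c = ((a - c) + (b - c)) / 2 by field.
rewrite cabs_half; have := cabsD (a - c) (b - c); lra.
Qed.

(** The integral is the sum over the four triangles cut out by the midpoints, so one
    of them carries at least a quarter of it. *)
Lemma triangle_step (L s : R) (T : C * C * C) : s < rho -> triangle_within L s T ->
  exists T' : C * C * C, [/\ triangle_within (L / 2) s T', cabs (T'.1.1 - T.1.1) <= L / 2 &
    cabs (triangle_integral3 T) <= 4 * cabs (triangle_integral3 T')].
Proof.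
case: T => [[a b] d] sr [/= [ab bd da] [ac bc dc]].
have D z : cabs (z - c) <= s -> disk c rho z by move=> ?; apply/diskP; lra.
have E := triangle_integral_split gcont (D _ ac) (D _ bc) (D _ dc).
set m1 := (a + b) / 2 in E; set m2 := (b + d) / 2 in E; set m3 := (d + a) / 2 in E.
have m1c : cabs (m1 - c) <= s by apply: cabs_mid.
have m2c : cabs (m2 - c) <= s by apply: cabs_mid.
have m3c : cabs (m3 - c) <= s by apply: cabs_mid.
have H x y w : w = (x - y) / 2 -> cabs (x - y) <= L -> cabs w <= L / 2.
  by move=> -> ?; rewrite cabs_half; lra.
have H' x y w : w = (y - x) / 2 -> cabs (x - y) <= L -> cabs w <= L / 2.
  by move=> -> ?; rewrite cabs_half cabsB; lra.
have L0 : 0 <= L by apply: le_trans ab; exact: cabs_ge0.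
pose N (T' : C * C * C) := [/\ triangle_within (L / 2) s T', cabs (T'.1.1 - a) <= L / 2 &
    cabs (triangle_integral3 (a, b, d)) <= 4 * cabs (triangle_integral3 T')].
have P1 : triangle_within (L / 2) s (a, m1, m3) /\ cabs (a - a) <= L / 2.
  split; last by rewrite subrr cabs0; lra.
  split; split=> //=; [apply: (H _ _ _ _ ab)|apply: (H _ _ _ _ bd)|apply: (H _ _ _ _ da)]; rewrite /m1 /m3; by field.
have P2 : triangle_within (L / 2) s (m1, b, m2) /\ cabs (m1 - a) <= L / 2.
  split; last by apply: (H' _ _ _ _ ab); rewrite /m1; field.
  split; split=> //=; [apply: (H _ _ _ _ ab)|apply: (H _ _ _ _ bd)|apply: (H _ _ _ _ da)]; rewrite /m1 /m2; by field.
have P3 : triangle_within (L / 2) s (m3, m2, d) /\ cabs (m3 - a) <= L / 2.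
  split; last by apply: (H _ _ _ _ da); rewrite /m3; field.
  split; split=> //=; [apply: (H _ _ _ _ ab)|apply: (H _ _ _ _ bd)|apply: (H _ _ _ _ da)]; rewrite /m3 /m2; by field.
have P4 : triangle_within (L / 2) s (m1, m2, m3) /\ cabs (m1 - a) <= L / 2.
  split; last by apply: (H' _ _ _ _ ab); rewrite /m1; field.
  split; split=> //=; [apply: (H' _ _ _ _ da)|apply: (H' _ _ _ _ ab)|apply: (H' _ _ _ _ bd)]; rewrite /m1 /m3 /m2; by field.
have Q : cabs (triangle_integral3 (a, b, d)) <= cabs (triangle_integral3 (a, m1, m3)) + cabs (triangle_integral3 (m1, b, m2))
    + cabs (triangle_integral3 (m3, m2, d)) + cabs (triangle_integral3 (m1, m2, m3)).
  rewrite /triangle_integral3 /= E; apply: le_trans (cabsD _ _) _; rewrite lerD2r.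
  by apply: le_trans (cabsD _ _) _; rewrite lerD2r; exact: cabsD.
have [h1|h1] := @le_or_lt R (cabs (triangle_integral3 (a, b, d))) (4 * cabs (triangle_integral3 (a, m1, m3))).
  by exists (a, m1, m3); case: P1.
have [h2|h2] := @le_or_lt R (cabs (triangle_integral3 (a, b, d))) (4 * cabs (triangle_integral3 (m1, b, m2))).
  by exists (m1, b, m2); case: P2.
have [h3|h3] := @le_or_lt R (cabs (triangle_integral3 (a, b, d))) (4 * cabs (triangle_integral3 (m3, m2, d))).
  by exists (m3, m2, d); case: P3.
have [h4|h4] := @le_or_lt R (cabs (triangle_integral3 (a, b, d))) (4 * cabs (triangle_integral3 (m1, m2, m3))).
  by exists (m1, m2, m3); case: P4.
by exfalso; lra.
Qed.

Lemma disk_seg z0 r (a b : C) t : cabs (a - z0) <= r -> cabs (b - z0) <= r -> 0 <= t <= 1 ->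
  cabs (a + toC t * (b - a) - z0) <= r.
Proof.
move=> ar br /andP[t0 t1].
have -> : a + toC t * (b - a) - z0 = toC (1 - t) * (a - z0) + toC t * (b - z0).
  by rewrite toCB toC1; ring.
apply: le_trans (cabsD _ _) _; rewrite !cabsM !cabs_real !ger0_norm ?subr_ge0 //.
by nra.
Qed.

(** Subdivide repeatedly, keeping a triangle that carries a quarter of the
    integral. Near the limit point the integrand is affine up to an error that is
    small compared with the side, and affine functions have primitives; so the
    integral over the n-th triangle is o(4^-n). *)
Lemma goursat (a b d : C) : disk c rho a -> disk c rho b -> disk c rho d ->
  triangle_integral g a b d = 0.
Proof.
move=> /diskP ar /diskP br /diskP dr.
pose s := Num.max (cabs (a - c)) (Num.max (cabs (b - c)) (cabs (d - c))).
have sr : s < rho by rewrite /s !gt_max ar br dr.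
pose L := cabs (a - b) + cabs (b - d) + cabs (d - a).
have H0 : triangle_within L s (a, b, d).
  split; last by split=> /=; rewrite /s !le_max lexx ?orbT.
  have := cabs_ge0 (a - b); have := cabs_ge0 (b - d); have := cabs_ge0 (d - a).
  by move=> ? ? ?; split=> /=; rewrite /L; lra.
have L0 : 0 <= L by rewrite /L; have := cabs_ge0 (a - b); have := cabs_ge0 (b - d); have := cabs_ge0 (d - a); lra.
have /choice[F HF] : forall p : R * (C * C * C), exists T', triangle_within p.1 s p.2 ->
  [/\ triangle_within (p.1 / 2) s T', cabs (T'.1.1 - p.2.1.1) <= p.1 / 2 &
    cabs (triangle_integral3 p.2) <= 4 * cabs (triangle_integral3 T')].
  move=> [l T]; have [h|h] := pselect (triangle_within l s T).
    by have [T' HT'] := triangle_step sr h; exists T'.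
  by exists T.
pose T n := nat_rect (fun=> (C * C * C)%type) (a, b, d) (fun n U => F (L / 2 ^+ n, U)) n.
have hs n : L / 2 ^+ n.+1 = L / 2 ^+ n / 2 by rewrite exprSr invfM mulrA.
have HT n : triangle_within (L / 2 ^+ n) s (T n).
  elim: n => [|n IH]; first by rewrite expr0 divr1.
  by rewrite hs; have [] := HF (L / 2 ^+ n, T n) IH.
have HT1 n : cabs ((T n.+1).1.1 - (T n).1.1) <= L / 2 ^+ n.+1.
  by rewrite hs; have [] := HF (L / 2 ^+ n, T n) (HT n).
have HK n : cabs (triangle_integral g a b d) <= 4 ^+ n * cabs (triangle_integral3 (T n)).
  elim: n => [|n IH]; first by rewrite expr0 mul1r.
  apply: le_trans IH _; have [_ _ Q] := HF (L / 2 ^+ n, T n) (HT n).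
  by rewrite exprSr -mulrA ler_wpM2l // exprn_ge0.
have [z Hz] := geom_seq_limitC HT1.
have zs : cabs (z - c) <= s.
  apply/ler_addgt0Pr => e e0; have [n Hn] := half_pow_small L0 (divr_gt0 e0 (ltr0n _ 2)).
  have [_ [h _ _]] := HT n; have := Hz n; rewrite cabsB => h2.
  have := cabsD (z - (T n).1.1) ((T n).1.1 - c); rewrite addrA subrK; lra.
have zr : disk c rho z by apply/diskP; lra.
apply: cabs_small => e e0.
(* The three sides have length at most l and stay within 3 l of the limit point,
   which gives 9 l^2; the summand 1 covers the case L = 0. *)
pose K := 9 * (1 + L) ^+ 2.
have K0 : 0 < K by rewrite /K mulr_gt0 // exprn_gt0 //; lra.
have [del del0 Hd] := gder zr (divr_gt0 e0 K0).
have [n Hn] := half_pow_small L0 (divr_gt0 del0 (ltr0n _ 3)).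
set l := L / 2 ^+ n in Hn.
have l0 : 0 <= l by rewrite /l divr_ge0 // exprn_ge0.
have [[T1 T2 T3] [T1c T2c T3c]] := HT n.
have Tz := Hz n; rewrite -/l in T1 T2 T3 Tz.
have HKn := HK n; rewrite /triangle_integral3 in HKn.
case: (T n) T1 T2 T3 T1c T2c T3c Tz HKn => [[p q] u] /= pq qu up pc qc uc pz HKn.
have qz : cabs (q - z) <= 3 * l.
  by have := cabsD (q - p) (p - z); rewrite addrA subrK cabsB; lra.
have uz : cabs (u - z) <= 3 * l.
  by have := cabsD (u - p) (p - z); rewrite addrA subrK; lra.
have pz' : cabs (p - z) <= 3 * l by lra.
have D y : cabs (y - c) <= s -> disk c rho y by move=> ?; apply/diskP; lra.
pose P y := (g z - dg z * z) * y + dg z / 2 * y ^+ 2.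
pose pp y := g z + dg z * (y - z).
have HP y : cder P y (pp y).
  apply: cder_eq (cderD (cderZ _ (cder_id y)) (cderZ _ (cderX 2 (cder_id y)))) _.
  by rewrite /pp expr1; field.
have B x y : cabs (x - c) <= s -> cabs (y - c) <= s -> cabs (x - z) <= 3 * l -> cabs (y - z) <= 3 * l ->
    cabs (x - y) <= l -> cabs (seg_integral g x y - (P y - P x)) <= e / K * (3 * l) * l.
  move=> xc yc xz yz xy.
  apply: (@le_trans _ _ (e / K * (3 * l) * cabs (y - x))).
    apply: (seg_integral_bound (p := pp) (seg_integralP gcont (D _ xc) (D _ yc))) => // t t01.
    set v := x + _; have vz : cabs (v - z) <= 3 * l by apply: disk_seg.
    have -> : g v - pp v = g v - g z - dg z * (v - z) by rewrite /pp; ring.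
    apply: le_trans (Hd v _) _; first by lra.
    by rewrite ler_wpM2l // divr_ge0 // ltW.
  rewrite ler_wpM2l //; last by rewrite cabsB.
  by apply: mulr_ge0; [apply: divr_ge0; exact: ltW|lra].
have B1 := B _ _ pc qc pz' qz pq.
have B2 := B _ _ qc uc qz uz qu.
have B3 := B _ _ uc pc uz pz' up.
have Q : cabs (triangle_integral g p q u) <= e / K * 9 * l ^+ 2.
  rewrite /triangle_integral; have -> : seg_integral g p q + seg_integral g q u + seg_integral g u p =
   (seg_integral g p q - (P q - P p)) + (seg_integral g q u - (P u - P q)) + (seg_integral g u p - (P p - P u)) by ring.
  apply: le_trans (cabsD _ _) _; have := cabsD (seg_integral g p q - (P q - P p)) (seg_integral g q u - (P u - P q)).
  move: B1 B2 B3; lra.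
apply: (le_trans HKn); apply: (@le_trans _ _ (4 ^+ n * (e / K * 9 * l ^+ 2))).
  by rewrite ler_wpM2l // exprn_ge0.
have -> : 4 ^+ n * (e / K * 9 * l ^+ 2) = e * (L / (1 + L)) ^+ 2.
  have h4 : 4 ^+ n = (2 ^+ n) ^+ 2 :> R by rewrite -exprM mulnC exprM; congr (_ ^+ n); ring.
  rewrite h4 /l /K; field.
  by rewrite expf_neq0 // andbT gt_eqF //; lra.
rewrite ger_pMr // exprn_ile1 //; first by rewrite divr_ge0 //; lra.
by rewrite ler_pdivrMr; lra.
Qed.

(** The integral from the centre is a primitive: by Goursat's theorem its increments
    are integrals over short segments. *)
Lemma primitive_disk : 0 < rho ->
  exists F : C -> C, forall z, disk c rho z -> cder F z (g z).
Proof.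
move=> rho0; exists (fun z => seg_integral g c z) => z zr e e0.
have cc := disk_center c rho0.
have /contCCP /(_ _ e0)[d d0 Hd] := gcont zr.
have /openP_disk /(_ _ zr)[r r0 Hr] := @open_disk R c rho.
exists (Num.min d r); first by rewrite lt_min d0.
move=> w; rewrite lt_min => /andP[wd wr].
have wrho : disk c rho w by apply: Hr; apply/diskP.
have := goursat cc zr wrho; rewrite /triangle_integral (seg_integral_rev gcont cc wrho) => E.
have -> : seg_integral g c w - seg_integral g c z - g z * (w - z) = seg_integral g z w - (g z * w - g z * z).
  have -> : seg_integral g z w = seg_integral g c w - seg_integral g c z.
    by apply/eqP; rewrite -subr_eq0 -E; apply/eqP; ring.
  by ring.
apply: (seg_integral_bound (P := fun y => g z * y) (p := fun=> g z) (seg_integralP gcont zr wrho)) => t t01.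
  by have := cderZ (g z) (cder_id (z + toC t * (w - z))); rewrite mulr1.
apply/ltW/Hd; have -> : z + toC t * (w - z) - z = toC t * (w - z) by ring.
rewrite cabsM cabs_real ger0_norm; last by case/andP: t01.
apply: le_lt_trans wd; rewrite -[leRHS]mul1r.
by apply: ler_wpM2r; [exact: cabs_ge0|case/andP: t01].
Qed.
End Tri.
End Goursat.

(** * Compactness and Cauchy's estimate *)

Section CauchyEst.
Context {R : realType}.
Local Notation C := (Cplx R).
Implicit Types (z w : C) (r e : R).

Definition cdisk z r : set C := [set w | cabs (w - z) <= r].

Lemma contCRI (h : C -> R) (z : C) :
  (forall e, 0 < e -> exists2 d, 0 < d & forall w, cabs (w - z) < d -> `|h w - h z| < e) ->
  {for z, continuous h}.
Proof.
move=> H A /nbhs_ballP[e e0 eA]; have [d d0 Hd] := H _ e0.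
have : nbhs z (h @^-1` A).
  apply/nbhs_diskP; exists d => // w /diskP /Hd wz; apply: eA.
  by rewrite /ball /= distrC.
by [].
Qed.

Lemma cont_cabs_sub (z w : C) : {for w, continuous (fun u => cabs (u - z))}.
Proof.
apply: contCRI => e e0; exists e => // u uw /=.
apply: le_lt_trans uw; rewrite ler_norml.
have := cabsD (u - w) (w - z); have := cabsD (w - u) (u - z).
by rewrite !addrA !subrK (cabsB w u) => ? ?; apply/andP; split; lra.
Qed.

Lemma closed_cdisk z r : closed (cdisk z r).
Proof.
rewrite -openC; apply/openP_disk => w /negP; rewrite -ltNge => h.
exists (cabs (w - z) - r); first lra.
move=> u /diskP uw; apply/negP; rewrite -ltNge.
by have := cabsD (w - u) (u - z); rewrite addrA subrK (cabsB w u); lra.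
Qed.

Lemma compact_cdisk z r : compact (cdisk z r).
Proof.
pose h (p : R * R) : C := z + (p.1 +i* p.2)%C.
have ch : continuous h.
  move=> [x y]; apply/contC_atP => e e0; have e2 : 0 < e / 2 by lra.
  exists (ball x (e / 2), ball y (e / 2)) => /=; first by split; apply: nbhsx_ballx.
  move=> [u v] [/=]; rewrite /ball /= => ux vy; rewrite /h.
  have -> : z + (u +i* v)%C - (z + (x +i* y)%C) = ((u - x) +i* (v - y))%C :> C.
    by apply/eqP; rewrite eq_complex /=; case: (z) => ? ? /=; apply/andP; split; apply/eqP; ring.
  by apply: le_lt_trans (cabs_ReIm _) _ => /=; rewrite (distrC u) (distrC v); lra.
apply: (@subclosed_compact _ _ (h @` (`[- r, r]%classic `*` `[- r, r]%classic))).
- exact: closed_cdisk.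
- apply: continuous_compact; first exact: continuous_subspaceT.
  by apply: compact_setX; exact: segment_compact.
move=> w wz; exists (complex.Re (w - z), complex.Im (w - z)).
  have := le_trans (normRe _) wz; have := le_trans (normIm _) wz.
  by rewrite !ler_norml /= !in_itv /=.
have e : (complex.Re (w - z) +i* complex.Im (w - z))%C = w - z by case: (w - z).
by rewrite /h [X in z + X]e; ring.
Qed.

(** If every point of a compact set has a radius that is good for its neighbours,
    one radius is good everywhere: a Lebesgue number argument. *)
Lemma compact_uniform_radius (K : set C) (Good : C -> R -> Prop) : compact K ->
  (forall x, K x -> exists2 d, 0 < d & forall y e, cabs (y - x) < d -> 0 < e < d -> Good y e) ->
  exists2 d, 0 < d & forall y, K y -> Good y d.
Proof.
move=> /compact_near_coveringP cK H.
have := cK R (at_right 0) (fun d y => Good y d) _.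
have Q : forall x, K x -> \forall x' \near x & i \near (0:R)^'+, Good x' i.
  move=> x /H[d d0 Hd]; exists (disk x d, [set e | 0 < e < d]) => /=.
    split; first by apply/nbhs_diskP; exists d.
    suff : \forall e \near (0:R)^'+, 0 < e < d by [].
    rewrite /at_right near_withinE; apply/nbhs_ballP; exists d => // e /=.
    rewrite /ball /= sub0r normrN => ed e0; rewrite e0 /=.
    by apply: le_lt_trans (ler_norm _) ed.
  by move=> [y e] /= [/diskP yx ed]; exact: Hd.
move=> /(_ _ Q) QQ.
have : \forall d \near (0:R)^'+, 0 < d /\ K `<=` Good^~ d.
  by apply: filterS2 (nbhs_right_gt (0:R)) QQ => d d0 Kd; split.
by move=> /filter_ex [d [d0 Kd]]; exists d.
Qed.

Lemma heine_cantor (K : set C) (f : C -> C) : compact K ->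
  (forall x, K x -> {for x, continuous f}) -> forall e, 0 < e ->
  exists2 d, 0 < d & forall x y, K x -> cabs (y - x) < d -> cabs (f y - f x) < e.
Proof.
move=> cK cf e e0; have e2 : 0 < e / 2 by lra.
have [|d d0 Hd] := @compact_uniform_radius K (fun x d => forall y, cabs (y - x) < d -> cabs (f y - f x) < e) cK.
  move=> x Kx; have /contCCP /(_ _ e2)[d d0 Hd] := cf _ Kx.
  exists (d / 2); first lra.
  move=> y e' yx /andP[e'0 e'd] w wy.
  have h1 : cabs (f y - f x) < e / 2 by apply: Hd; lra.
  have h2 : cabs (f w - f x) < e / 2.
    by apply: Hd; have := cabsD (w - y) (y - x); rewrite addrA subrK; lra.
  have := cabsD (f w - f x) (f x - f y); rewrite addrA subrK (cabsB (f x)); lra.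
by exists d => // x y Kx; exact: Hd.
Qed.

Lemma cabs_sqr (z : C) : cabs z ^+ 2 = complex.Re z ^+ 2 + complex.Im z ^+ 2.
Proof. by case: z => a b; rewrite /cabs /= sqr_sqrtr // addr_ge0 // sqr_ge0. Qed.

(** Of the two square roots u and -u, one has |u + 1|^2 >= 2 by the parallelogram
    law, and u^2 - 1 = (u - 1) (u + 1). *)
Lemma root_unity_step (om : C) (m : nat) : om ^+ m = 1 -> cabs om = 1 -> om != 1 ->
  exists om' : C, [/\ om' ^+ (2 * m) = 1, cabs om' = 1, om' != 1 &
     cabs (om' - 1) <= 3 / 4 * cabs (om - 1)].
Proof.
move=> om1 oma omn.
have sq : sqrtC om ^+ 2 = om by rewrite sqrtCK.
have aux (u : C) : u ^+ 2 = om -> 2 <= cabs (u + 1) ^+ 2 ->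
   exists om' : C, [/\ om' ^+ (2 * m) = 1, cabs om' = 1, om' != 1 &
     cabs (om' - 1) <= 3 / 4 * cabs (om - 1)].
  move=> u2 hu; exists u; split.
  - by rewrite exprM u2.
  - apply/eqP; rewrite -(@eqrXn2 _ 2) ?cabs_ge0 //; by rewrite -cabsX u2 oma expr1n.
  - by apply: contra_neq omn => u1; rewrite -u2 u1 expr1n.
  - have -> : om - 1 = (u - 1) * (u + 1) by rewrite -u2; ring.
    rewrite cabsM; have := cabs_ge0 (u - 1); have := cabs_ge0 (u + 1) => h1 h2.
    have : 4 / 3 <= cabs (u + 1).
      by rewrite -(@ler_pXn2r _ 2) ?nnegrE //; lra.
    by move=> ?; nra.
set u := sqrtC om in sq.
have ua : cabs u ^+ 2 = 1 by rewrite -cabsX sq.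
have par : cabs (u + 1) ^+ 2 + cabs (- u + 1) ^+ 2 = 4.
  move: ua; rewrite !cabs_sqr; case: (u) => a b /=; lra.
have [h|h] := le_or_lt 2 (cabs (u + 1) ^+ 2); first exact: (aux u).
by apply: (aux (- u)); [rewrite sqrrN | lra].
Qed.

(** Three successive square roots bring the distance to 1 below one half of what
    it was, as (3/4)^3 < 1/2. *)
Lemma root_unity_near1 (eta : R) : 0 < eta ->
  exists (om : C) (m : nat), [/\ (0 < m)%N, om ^+ m = 1, cabs om = 1, om != 1 & cabs (om - 1) < eta].
Proof.
move=> eta0.
have [n Hn] := half_pow_small (ler0n R 2) eta0.
suff [om [m [m0 H1 H2 H3 H4]]] : exists (om : C) (m : nat),
   [/\ (0 < m)%N, om ^+ m = 1, cabs om = 1, om != 1 & cabs (om - 1) <= 2 / 2 ^+ n].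
  by exists om, m; split=> //; apply: le_lt_trans Hn.
elim: n {Hn} => [|n [om [m [m0 H1 H2 H3 H4]]]].
  exists (-1), 2%N; rewrite expr0 divr1; split=> //.
  - by rewrite sqrrN expr1n.
  - by rewrite cabsN cabs1.
  - by rewrite eq_sym -subr_eq0 opprK (_ : 1 + 1 = 2%:R) ?pnatr_eq0.
  - by rewrite -opprD cabsN (_ : 1 + 1 = toC 2 :> C) ?cabs_real ?ger0_norm // /toC rmorph_nat.
have [u1 [A1 B1 C1 D1]] := root_unity_step H1 H2 H3.
have [u2 [A2 B2 C2 D2]] := root_unity_step A1 B1 C1.
have [u3 [A3 B3 C3 D3]] := root_unity_step A2 B2 C2.
exists u3, (2 * (2 * (2 * m)))%N; split=> //; first by rewrite !muln_gt0.
rewrite exprSr invfM mulrA; have := cabs_ge0 (om - 1); lra.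
Qed.

Lemma cder_sum (n : nat) (h : nat -> C -> C) (z : C) (d : nat -> C) :
  (forall k, (k < n)%N -> cder (h k) z (d k)) ->
  cder (fun w => \sum_(k < n) h k w) z (\sum_(k < n) d k).
Proof.
elim: n => [|n IH] H.
  apply: (@cder_ext _ (fun=> 0)); first by move=> w; rewrite big_ord0.
  by rewrite big_ord0; exact: cder_cst.
apply: (@cder_ext _ (fun w => \sum_(k < n) h k w + h n w)).
  by move=> w; rewrite big_ord_recr.
rewrite big_ord_recr; apply: cderD; last exact: H.
by apply: IH => k kn; apply: H; exact: ltnW.
Qed.

Lemma cabs_sum (n : nat) (h : nat -> C) (B : R) :
  (forall k, (k < n)%N -> cabs (h k) <= B) -> cabs (\sum_(k < n) h k) <= n%:R * B.
Proof.
elim: n => [|n IH] H; first by rewrite big_ord0 cabs0 mul0r.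
rewrite big_ord_recr /= -natr1 mulrDl mul1r; apply: le_trans (cabsD _ _) _.
by apply: lerD; [apply: IH => k kn; apply: H; exact: ltnW|exact: H].
Qed.

(** The derivative at the centre is the average over the circle of radius S of
    F(z + S u) / (S u), up to an error that vanishes with S, and this average does
    not depend on S. Here the average runs over the m-th roots of unity om^k, and
    it changes by little between S = p and S = r when om is close to 1: its
    derivative in S is a sum that telescopes up to the errors of linear
    approximation along the chords between neighbouring points. *)
Lemma cauchy_estimate (F f : C -> C) (z : C) (rho r M : R) :
  0 < r < rho -> (forall w, disk z rho w -> cder F w (f w)) ->
  (forall w, disk z rho w -> {for w, continuous f}) ->
  (forall w, cabs (w - z) = r -> cabs (F w) <= M) ->
  cabs (f z) <= M / r.
Proof.
move=> /andP[r0 rrho] HF Hf HM.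
suff S e : 0 < e -> cabs (f z) <= M / r + e + e.
  apply/ler_addgt0Pr => e e0; have := S (e / 2) (divr_gt0 e0 (ltr0n _ 2)); lra.
move=> e0.
have D w : cabs (w - z) <= r -> disk z rho w by move=> ?; apply/diskP; lra.
have [p [p0 pr Hp]] : exists p, [/\ 0 < p, p <= r & forall w, cabs (w - z) <= p -> cabs (f w - f z) <= e].
  have /contCCP /(_ _ e0)[p p0 Hp] : {for z, continuous f}.
    by apply: Hf; apply: D; rewrite subrr cabs0 ltW.
  exists (Num.min (p / 2) r); split.
  - by rewrite lt_min r0 divr_gt0.
  - by rewrite ge_min lexx orbT.
  - by move=> w; rewrite le_min => /andP[h _]; apply/ltW/Hp; lra.
have ep : 0 < e * p / r by rewrite divr_gt0 // mulr_gt0.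
have [eta eta0 Heta] := @heine_cantor _ f (@compact_cdisk z r) (fun w h => Hf w (D w h)) _ ep.
have [om [m [m0 omm oma omn ometa]]] := root_unity_near1 (divr_gt0 eta0 r0).
have om0 : om != 0 by rewrite -cabs_eq0 oma oner_eq0.
have mC0 : (m%:R : C) != 0 by rewrite pnatr_eq0 -lt0n.
have mR0 : 0 < (m%:R : R) by rewrite ltr0n.
have cabsm : cabs (m%:R : C) = m%:R.
  by rewrite (_ : m%:R = toC m%:R) ?cabs_real ?ger0_norm // /toC rmorph_nat.
pose A (S : C) := \sum_(k < m) om ^- k * F (z + S * om ^+ k).
pose phi (S : C) := A S / (m%:R * S).
pose A' (S : C) := \sum_(k < m) f (z + S * om ^+ k).
pose phi' (S : C) := (A' S * S - A S) / (m%:R * S ^+ 2).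
have pt k s : 0 <= s -> cabs (z + toC s * om ^+ k - z) = s.
  move=> s0; rewrite (_ : _ - z = toC s * om ^+ k); last by ring.
  by rewrite cabsM cabsX oma expr1n mulr1 cabs_real ger0_norm.
have cphi s : p <= s <= r -> cder phi (toC s) (phi' (toC s)).
  move=> /andP[ps sr]; have s0 : 0 < s by lra.
  have sC : toC s != 0 by rewrite -toC0 (inj_eq toC_inj) gt_eqF.
  have HA : cder A (toC s) (A' (toC s)).
    apply: (@cder_sum m (fun k S => om ^- k * F (z + S * om ^+ k)) _ (fun k => f (z + toC s * om ^+ k))).
    move=> k km; have okn : om ^+ k != 0 by rewrite expf_neq0.
    have Hl : cder (fun S => z + S * om ^+ k) (toC s) (om ^+ k).
      apply: cder_eq (cderD (cder_cst z _) (cderM (cder_id _) (cder_cst (om ^+ k) _))) _.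
      by ring.
    have HFk : cder F (z + toC s * om ^+ k) (f (z + toC s * om ^+ k)).
      by apply: HF; apply: D; rewrite pt //; lra.
    apply: cder_eq (cderZ (om ^- k) (@cder_comp _ F (fun S => z + S * om ^+ k) _ _ _ HFk Hl)) _.
    by field.
  have Hm : cder (fun S => m%:R * S) (toC s) (m%:R : C).
    by apply: cder_eq (cderZ _ (cder_id _)) _; rewrite mulr1.
  have mS : m%:R * toC s != 0 by rewrite mulf_neq0.
  have Hv := @cderV _ (fun S => m%:R * S) _ _ mS Hm.
  apply: (cder_eq (cderM HA Hv)).
  by rewrite /phi'; field; rewrite sC mC0.
have bphi s : p <= s <= r -> cabs (phi' (toC s)) <= e / r.
  move=> /andP[ps sr]; have s0 : 0 < s by lra.
  have sC : toC s != 0 by rewrite -toC0 (inj_eq toC_inj) gt_eqF.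
  pose zk k := z + toC s * om ^+ k.
  (* Multiplication by om shifts the index of A by one, and om^m = 1 closes the sum. *)
  have E1 : (om - 1) * (A' (toC s) * toC s - A (toC s)) =
    \sum_(k < m) - (om ^- k * (F (zk k.+1) - F (zk k) - f (zk k) * (zk k.+1 - zk k))).
    pose G k := om ^- k * F (zk k).
    have sh : \sum_(k < m) G k.+1 = \sum_(k < m) G k.
      apply/eqP; rewrite -subr_eq0 -sumrB.
      have := @telescope_sumr _ 0 m G (leq0n _); rewrite big_mkord => ->.
      rewrite /G /zk omm expr0 invr1; apply/eqP; ring.
    have : om * \sum_(k < m) G k.+1 = \sum_(k < m) om ^- k * F (zk k.+1).
      rewrite mulr_sumr; apply: eq_bigr => k _; rewrite /G exprS invfM.
      by rewrite !mulrA mulfV // mul1r.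
    have aE : A (toC s) = \sum_(k < m) G k by [].
    rewrite sh -aE => E2.
    have -> : (om - 1) * (A' (toC s) * toC s - A (toC s)) =
      (om - 1) * (A' (toC s) * toC s) - (om * A (toC s) - A (toC s)) by ring.
    rewrite E2 aE /A' mulr_suml mulr_sumr -!sumrB; apply: eq_bigr => k _.
    have okn : om ^+ k != 0 by rewrite expf_neq0.
    rewrite /G /zk exprS; field => //.
  have E3 : cabs (om - 1) * cabs (A' (toC s) * toC s - A (toC s)) <=
      m%:R * (e * p / r * (s * cabs (om - 1))).
    rewrite -cabsM E1; apply: (@cabs_sum m (fun k => - (om ^- k * (F (zk k.+1) - F (zk k) - f (zk k) * (zk k.+1 - zk k))))).
    move=> k km; rewrite cabsN cabsM cabsV cabsX oma expr1n invr1 mul1r.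
    have dz : cabs (zk k.+1 - zk k) = s * cabs (om - 1).
      rewrite (_ : zk k.+1 - zk k = toC s * om ^+ k * (om - 1)); last by rewrite /zk exprS; ring.
      by rewrite !cabsM cabsX oma expr1n mulr1 cabs_real ger0_norm // ltW.
    rewrite -dz; apply: (@mean_ineq_seg _ F f) => t t01.
      apply: HF; apply/diskP; apply: le_lt_trans rrho.
      by apply: disk_seg => //; rewrite pt; lra.
    apply/ltW/Heta; first by rewrite /cdisk /= pt; lra.
    rewrite (_ : _ - zk k = toC t * (zk k.+1 - zk k)); last by ring.
    rewrite cabsM dz cabs_real ger0_norm; last by case/andP: t01.
    move: ometa; rewrite ltr_pdivlMr // => ometa.
    have := cabs_ge0 (om - 1); case/andP: t01 => t0 t1 h.
    apply: le_lt_trans ometa; apply: (@le_trans _ _ (1 * (s * cabs (om - 1)))).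
      by rewrite ler_wpM2r // mulr_ge0 // ltW.
    by rewrite mul1r mulrC ler_wpM2l.
  have omp : 0 < cabs (om - 1) by rewrite cabs_gt0 subr_eq0.
  rewrite /phi' cabsM cabsV cabsM cabsm cabsX cabs_real (ger0_norm (ltW s0)).
  have : cabs (A' (toC s) * toC s - A (toC s)) <= m%:R * (e * p / r * s).
    rewrite -(ler_pM2l omp); apply: le_trans E3 _; rewrite le_eqVlt; apply/orP; left; apply/eqP; ring.
  move=> E4; rewrite ler_pdivrMr; last by rewrite mulr_gt0 // exprn_gt0.
  apply: le_trans E4 _.
  rewrite (_ : e / r * (m%:R * s ^+ 2) = m%:R * (e / r * s * s)); last by ring.
  rewrite ler_wpM2l // ?ler0n //.
  rewrite (_ : e * p / r * s = e / r * s * p); last by ring.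
  by rewrite ler_wpM2l // mulr_ge0 ?divr_ge0 // ltW.
have d1 : cabs (phi (toC r) - phi (toC p)) <= e.
  have E t : toC p + toC t * (toC r - toC p) = toC (p + t * (r - p)).
    by rewrite toCD toCM toCB.
  have I t : 0 <= t <= 1 -> p <= p + t * (r - p) <= r.
    by move=> /andP[t0 t1]; apply/andP; split; nra.
  have := @mean_ineq_seg _ phi phi' (toC p) (toC r) 0 (e / r).
  rewrite mul0r subr0 => Q; apply: le_trans (Q _ _) _.
  - by move=> t t01; rewrite E; apply: cphi; exact: I.
  - by move=> t t01; rewrite E subr0; apply: bphi; exact: I.
  rewrite -toCB cabs_real ger0_norm ?subr_ge0 // mulrAC ler_pdivrMr //.
  by rewrite ler_wpM2l ?ltW //; lra.
(* The constant term F z drops out because the m-th roots of unity sum to 0. *)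
have d2 : cabs (phi (toC p) - f z) <= e.
  have pC : toC p != 0 by rewrite -toC0 (inj_eq toC_inj) gt_eqF.
  have Z : \sum_(k < m) om ^- k = 0.
    have iom : om^-1 != 1 by rewrite invr_eq1.
    have : (om^-1 - 1) * \sum_(k < m) om^-1 ^+ k = 0.
      by rewrite -subrX1 exprVn omm invr1 subrr.
    move=> /eqP; rewrite mulf_eq0 subr_eq0 (negPf iom) /= => /eqP E; rewrite -[RHS]E.
    by apply: eq_bigr => k _; rewrite exprVn.
  have -> : phi (toC p) - f z = (\sum_(k < m) om ^- k * (F (z + toC p * om ^+ k) - F z - f z * (z + toC p * om ^+ k - z))) / (m%:R * toC p).
    have -> : \sum_(k < m) om ^- k * (F (z + toC p * om ^+ k) - F z - f z * (z + toC p * om ^+ k - z)) =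
      A (toC p) - F z * (\sum_(k < m) om ^- k) - \sum_(k < m) f z * toC p.
      rewrite /A mulr_sumr -!sumrB; apply: eq_bigr => k _.
      have okn : om ^+ k != 0 by rewrite expf_neq0.
      by field.
    rewrite Z mulr0 subr0 sumr_const card_ord -mulr_natl /phi.
    by field; rewrite pC mC0.
  rewrite cabsM cabsV cabsM cabsm cabs_real (ger0_norm (ltW p0)) ler_pdivrMr ?mulr_gt0 //.
  rewrite (_ : e * (m%:R * p) = m%:R * (e * p)); last by ring.
  apply: (@cabs_sum m (fun k => om ^- k * (F (z + toC p * om ^+ k) - F z - f z * (z + toC p * om ^+ k - z)))).
  move=> k km; rewrite cabsM cabsV cabsX oma expr1n invr1 mul1r.
  have -> : e * p = e * cabs (z + toC p * om ^+ k - z) by rewrite (pt k p (ltW p0)).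
  apply: (@mean_ineq_seg _ F f) => t t01.
    apply: HF; apply: D; apply: disk_seg => //; first by rewrite subrr cabs0 ltW.
    by rewrite pt // ltW.
  apply: Hp; apply: disk_seg => //; first by rewrite subrr cabs0 ltW.
  by rewrite pt // ltW.
have d3 : cabs (phi (toC r)) <= M / r.
  rewrite /phi cabsM cabsV cabsM cabsm cabs_real (ger0_norm (ltW r0)).
  rewrite ler_pdivrMr ?mulr_gt0 // (_ : M / r * (m%:R * r) = m%:R * M); last by field; rewrite gt_eqF.
  apply: (@cabs_sum m (fun k => om ^- k * F (z + toC r * om ^+ k))) => k km.
  by rewrite cabsM cabsV cabsX oma expr1n invr1 mul1r; apply: HM; rewrite pt // ltW.
have t1 := cabs_le_of_diff (f z) (phi (toC p)).
have t2 := cabs_le_of_diff (phi (toC p)) (phi (toC r)).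
rewrite cabsB in t1; rewrite cabsB in t2; lra.
Qed.
End CauchyEst.

(** * Derivatives of holomorphic functions *)

Section Regularity.
Context {R : realType}.
Local Notation C := (Cplx R).
Implicit Types (z w : C) (r e : R).

Lemma punctured_point (d : R) : 0 < d -> exists h : C, 0 < cabs h < d.
Proof. by move=> d0; exists (toC (d / 2)); rewrite cabs_real ger0_norm; lra. Qed.

(** Completeness for functions near 0: the limit is the supremum of the eventual
    lower bounds. *)
Lemma cauchy_limitR (q : C -> R) :
  (forall e : R, 0 < e -> exists2 d, 0 < d & forall h k, 0 < cabs h < d -> 0 < cabs k < d ->
     `|q h - q k| <= e) ->
  exists l : R, forall e, 0 < e -> exists2 d, 0 < d & forall h, 0 < cabs h < d -> `|q h - l| <= e.
Proof.
move=> H; pose S := [set x | exists2 d, 0 < d & forall h, 0 < cabs h < d -> x <= q h].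
have Sin e d h : (forall h k, 0 < cabs h < d -> 0 < cabs k < d -> `|q h - q k| <= e) ->
    0 < cabs h < d -> S (q h - e).
  move=> Hd hd; exists d; first by case/andP: hd; lra.
  by move=> k kd; have := Hd _ _ hd kd; rewrite ler_norml => /andP[_ ?]; lra.
have Sub e d h x : (forall h k, 0 < cabs h < d -> 0 < cabs k < d -> `|q h - q k| <= e) ->
    0 < cabs h < d -> S x -> x <= q h + e.
  move=> Hd hd [d' d'0 Hd'].
  have [k /andP[k0]] : exists k : C, 0 < cabs k < Num.min d d'.
    by apply: punctured_point; rewrite lt_min d'0 andbT; case/andP: hd; lra.
  rewrite lt_min => /andP[kd kd'].
  have := Hd' k; rewrite k0 kd' => /(_ isT) => ?.
  have := Hd _ k hd; rewrite k0 kd => /(_ isT); rewrite ler_norml => /andP[? _]; lra.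
have hS : has_sup S.
  have [d d0 Hd] := H 1 ltr01; have [h hd] := punctured_point d0.
  split; first by exists (q h - 1); exact: Sin hd.
  by exists (q h + 1) => x; apply: Sub hd.
exists (sup S) => e e0; have [d d0 Hd] := H e e0; exists d => // h hd.
have h1 : q h - e <= sup S by apply: sup_upper_bound => //; apply: Sin hd.
have h2 : sup S <= q h + e by apply: ge_sup; [case: hS | move=> x; apply: Sub hd].
by rewrite ler_norml; apply/andP; split; lra.
Qed.

Lemma cauchy_limitC (q : C -> C) :
  (forall e : R, 0 < e -> exists2 d, 0 < d & forall h k, 0 < cabs h < d -> 0 < cabs k < d ->
     cabs (q h - q k) <= e) ->
  exists l : C, forall e, 0 < e -> exists2 d, 0 < d & forall h, 0 < cabs h < d -> cabs (q h - l) <= e.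
Proof.
move=> H.
have [|a Ha] := @cauchy_limitR (fun h => complex.Re (q h)).
  move=> e /H[d d0 Hd]; exists d => // h k hd kd; rewrite -raddfB.
  exact: le_trans (normRe (q h - q k)) (Hd _ _ hd kd).
have [|b Hb] := @cauchy_limitR (fun h => complex.Im (q h)).
  move=> e /H[d d0 Hd]; exists d => // h k hd kd; rewrite -raddfB.
  exact: le_trans (normIm (q h - q k)) (Hd _ _ hd kd).
exists (a +i* b)%C => e e0; have e2 : 0 < e / 2 by lra.
have [d1 d10 H1] := Ha _ e2; have [d2 d20 H2] := Hb _ e2.
exists (Num.min d1 d2); first by rewrite lt_min d10.
move=> h; rewrite lt_min => /and3P[h0 hd1 hd2].
apply: le_trans (cabs_ReIm _) _; rewrite !raddfB /=.
have := H1 h; have := H2 h; rewrite h0 hd1 hd2 => /(_ isT) + /(_ isT); lra.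
Qed.

(** The difference quotients Q_h of F converge to f uniformly on a disk. Cauchy's
    estimate for Q_h - Q_k, whose derivative is q_h - q_k, shows that the difference
    quotients q_h of f are uniformly Cauchy on a smaller disk; so f has a
    derivative, which is a uniform limit of continuous functions. *)
Lemma derivative_regular (F f : C -> C) (c : C) (rho : R) : 0 < rho ->
  (forall w, disk c rho w -> cder F w (f w)) ->
  (forall w, disk c rho w -> {for w, continuous f}) ->
  exists d : C -> C, forall z, disk c (rho / 4) z -> cder f z (d z) /\ {for z, continuous d}.
Proof.
move=> rho0 HF Hf.
have D w : cabs (w - c) < rho -> disk c rho w by move/diskP.
pose Q (h z : C) := (F (z + h) - F z) / h.
pose q (h z : C) := (f (z + h) - f z) / h.
(* For z within rho/4 of c the circle of radius rho/4 about z stays within rho/2, and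
   increments below rho/8 do not leave the disk. *)
have U e : 0 < e -> exists2 del, 0 < del & forall z h k, disk c (rho / 4) z ->
    0 < cabs h < del -> 0 < cabs k < del -> cabs (q h z - q k z) <= e.
  move=> e0; have er : 0 < e * rho / 8 by apply: divr_gt0 => //; apply: mulr_gt0.
  have fK w : cdisk c (rho / 2) w -> {for w, continuous f}.
    by rewrite /cdisk /= => wc; apply/Hf/D; lra.
  have [del del0 Hdel] := @heine_cantor _ _ f (@compact_cdisk _ c (rho / 2)) fK _ er.
  exists (Num.min del (rho / 8)); first by rewrite lt_min del0; lra.
  move=> z h k /diskP zc; rewrite !lt_min => /and3P[h0 hdel hr] /and3P[k0 kdel kr].
  have BQ (l w : C) : 0 < cabs l -> cabs l < del -> cabs l < rho / 8 -> cabs (w - c) <= rho / 2 ->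
      cabs (Q l w - f w) <= e * rho / 8.
    move=> l0 ldel lr wc.
    have l0' : l != 0 by rewrite -cabs_gt0.
    have -> : Q l w - f w = (F (w + l) - F w - f w * (w + l - w)) / l by rewrite /Q; field.
    rewrite cabsM cabsV ler_pdivrMr //.
    have -> : e * rho / 8 * cabs l = e * rho / 8 * cabs (w + l - w) by congr (_ * cabs _); ring.
    have E t : w + toC t * (w + l - w) - w = toC t * l by ring.
    have T t : 0 <= t <= 1 -> cabs (toC t * l) <= cabs l.
      move=> /andP[t0 t1]; rewrite cabsM cabs_real ger0_norm //.
      by rewrite -[leRHS]mul1r; apply: ler_wpM2r; first exact: cabs_ge0.
    apply: (@mean_ineq_seg _ F f) => t t01.
      apply: HF; apply: D.
      have := cabsD (w + toC t * (w + l - w) - w) (w - c); rewrite addrA subrK E.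
      by have := T t t01; lra.
    apply/ltW/Hdel => //; rewrite E; have := T t t01; lra.
  have dQ (l w : C) : 0 < cabs l -> cabs l < rho / 8 -> cabs (w - c) < rho / 8 * 7 ->
      cder (Q l) w (q l w).
    move=> l0 lr wc; apply: (@cder_ext _ (fun w => l^-1 * (F (w + l) - F w))).
      by move=> v; rewrite /Q mulrC.
    have H1 : cder (fun w => w + l) w (1 + 0) := cderD (cder_id w) (cder_cst l w).
    have H2 : cder F (w + l) (f (w + l)).
      by apply: HF; apply: D; have := cabsD (w - c) l; rewrite addrAC; lra.
    have H3 : cder F w (f w) by apply: HF; apply: D; lra.
    apply: cder_eq (cderZ l^-1 (cderB (@cder_comp _ F (fun w => w + l) _ _ _ H2 H1) H3)) _.
    by rewrite /q addr0 mulr1 mulrC.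
  have cq (l w : C) : 0 < cabs l -> cabs l < rho / 8 -> cabs (w - c) < rho / 8 * 7 ->
      {for w, continuous (q l)}.
    move=> l0 lr wc; have l0' : l != 0 by rewrite -cabs_gt0.
    apply/contCCP => a a0; have al : 0 < a * cabs l / 2.
      by apply: divr_gt0 => //; apply: mulr_gt0.
    have /contCCP /(_ _ al)[d1 d10 H1] : {for (w + l), continuous f}.
      by apply: Hf; apply: D; have := cabsD (w - c) l; rewrite addrAC; lra.
    have /contCCP /(_ _ al)[d2 d20 H2] : {for w, continuous f} by apply: Hf; apply: D; lra.
    exists (Num.min d1 d2); first by rewrite lt_min d10.
    move=> v; rewrite lt_min => /andP[v1 v2].
    have -> : q l v - q l w = ((f (v + l) - f (w + l)) - (f v - f w)) / l by rewrite /q; field.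
    rewrite cabsM cabsV ltr_pdivrMr //; apply: le_lt_trans (cabsD _ _) _; rewrite cabsN.
    have := H2 v v2; have := H1 (v + l); rewrite (_ : v + l - (w + l) = v - w); last by ring.
    by move=> /(_ v1); lra.
  have nb w : cabs (w - z) < rho / 8 * 5 -> cabs (w - c) < rho / 8 * 7.
    by move=> wz; have := cabsD (w - z) (z - c); rewrite addrA subrK; lra.
  have := @cauchy_estimate _ (fun w => Q h w - Q k w) (fun w => q h w - q k w) z (rho / 8 * 5) (rho / 4) (e * rho / 4).
  have -> : e * rho / 4 / (rho / 4) = e by field; rewrite gt_eqF.
  apply; first by lra.
  - move=> w /diskP /nb wc; apply: cderB; exact: dQ.
  - move=> w /diskP /nb wc; apply/contCCP => a a0; have a2 : 0 < a / 2 by lra.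
    have /contCCP /(_ _ a2)[d1 d10 H1] := cq _ _ h0 hr wc.
    have /contCCP /(_ _ a2)[d2 d20 H2] := cq _ _ k0 kr wc.
    exists (Num.min d1 d2); first by rewrite lt_min d10.
    move=> v; rewrite lt_min => /andP[/H1 v1 /H2 v2].
    rewrite (_ : _ - _ = (q h v - q h w) - (q k v - q k w)); last by ring.
    by apply: le_lt_trans (cabsD _ _) _; rewrite cabsN; lra.
  - move=> w wz; have wc : cabs (w - c) <= rho / 2.
      by have := cabsD (w - z) (z - c); rewrite addrA subrK; lra.
    rewrite (_ : Q h w - Q k w = (Q h w - f w) - (Q k w - f w)); last by ring.
    apply: le_trans (cabsD _ _) _; rewrite cabsN.
    by have := BQ _ _ h0 hdel hr wc; have := BQ _ _ k0 kdel kr wc; lra.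
have /choice[d Hd] : forall z, exists l : C, disk c (rho / 4) z ->
    forall e, 0 < e -> exists2 d, 0 < d & forall h, 0 < cabs h < d -> cabs (q h z - l) <= e.
  move=> z; have [zc|] := pselect (disk c (rho / 4) z); last by exists 0.
  have [|l Hl] := @cauchy_limitC (fun h => q h z); last by exists l.
  by move=> e /U[del del0 H]; exists del => // h k; exact: H.
have V e : 0 < e -> exists2 del, 0 < del & forall z h, disk c (rho / 4) z ->
    0 < cabs h < del -> cabs (q h z - d z) <= e.
  move=> /U[del del0 H]; exists del => // z h zc hdel.
  apply/ler_addgt0Pr => a a0; have [d1 d10 H1] := Hd z zc _ a0.
  have [k /andP[k0]] : exists k : C, 0 < cabs k < Num.min del d1.
    by apply: punctured_point; rewrite lt_min del0.
  rewrite lt_min => /andP[kdel kd1].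
  have := H1 k; rewrite k0 kd1 => /(_ isT) h1.
  have := H z h k zc hdel; rewrite k0 kdel => /(_ isT) h2.
  by have := cabsD (q h z - q k z) (q k z - d z); rewrite addrA subrK; lra.
have cd z : disk c (rho / 4) z -> cder f z (d z).
  move=> zc e /V[del del0 H]; exists del => // w wz.
  have [->|wz0] := eqVneq w z; first by rewrite !subrr mulr0 subr0 cabs0 mulr0.
  have h0 : w - z != 0 by rewrite subr_eq0.
  have -> : f w - f z - d z * (w - z) = (q (w - z) z - d z) * (w - z).
    by rewrite /q (_ : z + (w - z) = w); [field | ring].
  rewrite cabsM; apply: ler_wpM2r; first exact: cabs_ge0.
  by apply: H => //; rewrite cabs_gt0 h0.
exists d => z zc; split; first exact: cd.
apply/contCCP => e e0; have e4 : 0 < e / 4 by lra.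
have [del del0 H] := V _ e4.
have mn0 : 0 < Num.min del (rho / 8) by rewrite lt_min del0; lra.
have [h hdel] := punctured_point mn0.
move: hdel; rewrite lt_min => /and3P[h0 hdel hr].
have l0' : h != 0 by rewrite -cabs_gt0.
have al : 0 < e / 4 * cabs h / 2 by apply: divr_gt0 => //; apply: mulr_gt0.
have /diskP zc' := zc.
have /contCCP /(_ _ al)[d1 d10 H1] : {for (z + h), continuous f}.
  by apply: Hf; apply: D; have := cabsD (z - c) h; rewrite addrAC; lra.
have /contCCP /(_ _ al)[d2 d20 H2] : {for z, continuous f} by apply: Hf; apply: D; lra.
have /openP_disk /(_ _ zc)[r r0 Hr] := @open_disk _ c (rho / 4).
exists (Num.min r (Num.min d1 d2)); first by rewrite !lt_min r0 d10.
move=> w; rewrite !lt_min => /and3P[wr w1 w2].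
have wc : disk c (rho / 4) w by apply: Hr; apply/diskP.
have A1 : cabs (q h w - q h z) <= e / 4.
  have -> : q h w - q h z = ((f (w + h) - f (z + h)) - (f w - f z)) / h by rewrite /q; field.
  rewrite cabsM cabsV ler_pdivrMr //; apply: le_trans (cabsD _ _) _; rewrite cabsN.
  have := H2 w w2; have := H1 (w + h); rewrite (_ : w + h - (z + h) = w - z); last by ring.
  by move=> /(_ w1); lra.
have A2 := H z h zc; rewrite h0 hdel in A2; have {}A2 := A2 isT.
have A3 := H w h wc; rewrite h0 hdel in A3; have {}A3 := A3 isT.
rewrite (_ : d w - d z = (q h w - q h z) - (q h w - d w) + (q h z - d z)); last by ring.
have := cabsD (q h w - q h z - (q h w - d w)) (q h z - d z).
have := cabsD (q h w - q h z) (- (q h w - d w)); rewrite cabsN; lra.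
Qed.

(** A holomorphic function is the derivative of its primitive, hence has a
    continuous derivative; the same argument then applies to that derivative. *)
Lemma hol_derive (U : set C) g : open U -> holomorphic_on U g -> holomorphic_on U (derive1 g).
Proof.
move=> /openP_disk oU hg; apply: cder_hol => z Uz.
have [rho rho0 Hr] := oU z Uz.
have gd w : disk z rho w -> cder g w (derive1 g w) by move=> /Hr; exact: hol_cder.
have [F HF] := primitive_disk gd rho0.
have [d Hd] := derivative_regular rho0 HF (fun w h => cder_cont (gd w h)).
have r4 : 0 < rho / 4 by lra.
have sub w : disk z (rho / 4) w -> disk z rho w by move=> /diskP ?; apply/diskP; lra.
have E w : disk z (rho / 4) w -> derive1 g w = d w.
  by move=> wz; apply: cder_uniq (gd w (sub w wz)) (Hd _ wz).1.
have gd4 w : disk z (rho / 4) w -> cder g w (d w) by move=> wz; rewrite -E //; exact/gd/sub.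
have [d2 Hd2] := derivative_regular r4 gd4 (fun w h => (Hd w h).2).
have r16 : 0 < rho / 4 / 4 by lra.
exists (d2 z); apply: (@cder_local _ d _ _ _ _ r4).
  by move=> w wz; rewrite E.
exact: (Hd2 _ (disk_center z r16)).1.
Qed.

Lemma hol_cont (U : set C) g : holomorphic_on U g -> forall z, U z -> {for z, continuous g}.
Proof. by move=> h z Uz; exact: cder_cont (hol_cder h Uz). Qed.
End Regularity.

(** * Multiplicities and the inverse function theorem *)

Section Local.
Context {R : realType}.
Local Notation C := (Cplx R).
Implicit Types (z w a : C) (r e : R) (g h : C -> C) (U : set C).

Lemma derive1_local g h a r : (forall w, disk a r w -> g w = h w) ->
  forall w, disk a r w -> derive1 g w = derive1 h w.
Proof.
move=> E w wr; rewrite !derive1E; apply: near_eq_derive.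
have /openP_disk /(_ _ wr)[s s0 Hs] := @open_disk _ a r.
by apply/nbhs_diskP; exists s => // u /Hs /E.
Qed.

Lemma derive1n_local n g h a r : (forall w, disk a r w -> g w = h w) ->
  forall w, disk a r w -> derive1n n g w = derive1n n h w.
Proof.
move=> E; elim: n => [|n IH] w wr; first exact: E.
by rewrite !derive1nS; apply: derive1_local wr.
Qed.

(** The quotient by z - a, completed at [a] so that it stays holomorphic. *)
Definition divided_diff g a z : C := if z == a then derive1 g a else (g z - g a) / (z - a).

Lemma divided_diffE g a z : g z = g a + (z - a) * divided_diff g a z.
Proof.
rewrite /divided_diff; case: eqVneq => [->|za]; first by rewrite subrr mul0r addr0.
have za0 : z - a != 0 by rewrite subr_eq0.
by field.
Qed.

(** At [a] the derivative is half the second derivative of [g]: once the quadratic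
    term is subtracted, the mean value inequality applies, because the derivative of
    [g] is itself differentiable at [a]. *)
Lemma hol_divided_diff U g a : open U -> holomorphic_on U g -> U a -> holomorphic_on U (divided_diff g a).
Proof.
move=> oU hg Ua; apply: cder_hol => z Uz.
have [->|za] := eqVneq z a; last first.
  have za0 : z - a != 0 by rewrite subr_eq0.
  have cza : 0 < cabs (z - a) by rewrite cabs_gt0.
  eexists; apply: (@cder_local _ (fun z => (g z - g a) * (z - a)^-1) _ _ _ _ cza).
    move=> w /diskP wz; rewrite /divided_diff; case: eqVneq => // wa.
    by move: wz; rewrite wa cabsB ltxx.
  apply: cderM; first by apply: cderB; [exact: hol_cder hg _ Uz|exact: cder_cst].
  exact: (@cderV _ (fun z => z - a) _ _ za0 (cderB (cder_id z) (cder_cst a z))).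
set d2 := derive1 (derive1 g) a.
exists (d2 / 2) => e e0.
have [del del0 Hdel] := hol_cder (hol_derive oU hg) Ua e0.
have /openP_disk /(_ _ Ua)[r r0 Hr] := oU.
exists (Num.min del r); first by rewrite lt_min del0.
move=> w; rewrite lt_min => /andP[wdel wr].
have [->|wa] := eqVneq w a; first by rewrite !subrr mulr0 subr0 cabs0 mulr0.
have wa0 : w - a != 0 by rewrite subr_eq0.
rewrite {1}/divided_diff (negPf wa) {1}/divided_diff eqxx.
have -> : (g w - g a) / (w - a) - derive1 g a - d2 / 2 * (w - a) =
   ((g w - d2 / 2 * (w - a) ^+ 2) - (g a - d2 / 2 * (a - a) ^+ 2) - derive1 g a * (w - a)) / (w - a).
  by field.
have wapos : 0 < cabs (w - a) by rewrite cabs_gt0.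
rewrite cabsM cabsV ler_pdivrMr //.
have E t : a + toC t * (w - a) - a = toC t * (w - a) by ring.
have T t : 0 <= t <= 1 -> cabs (toC t * (w - a)) <= cabs (w - a).
  move=> /andP[t0 t1]; rewrite cabsM cabs_real ger0_norm //.
  by rewrite -[leRHS]mul1r; apply: ler_wpM2r; first exact: cabs_ge0.
apply: (@mean_ineq_seg _ (fun z => g z - d2 / 2 * (z - a) ^+ 2) (fun z => derive1 g z - d2 * (z - a))) => t t01;
  set v := a + _; have va : cabs (v - a) <= cabs (w - a) by rewrite E; exact: T.
  apply: cderB; first by apply: (hol_cder hg); apply: Hr; apply/diskP; lra.
  apply: cder_eq (cderZ _ (cderX 2 (cderB (cder_id v) (cder_cst a v)))) _.
  by rewrite subr0 mulr1 /=; field.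
have -> : derive1 g v - d2 * (v - a) - derive1 g a = derive1 g v - derive1 g a - d2 * (v - a) by exact: addrAC.
apply: le_trans (Hdel v _) _; first by lra.
by rewrite ler_wpM2l // ltW.
Qed.

(** Differentiating lowers the exponent of w - a by one and keeps a holomorphic
    factor, whence the induction on the exponent. *)
Lemma derive1n_factor n g h (c : C) a r : 0 < r -> holomorphic_on (disk a r) h ->
  (forall w, disk a r w -> g w = c + (w - a) ^+ n.+1 * h w) ->
  (forall j, (0 < j < n.+1)%N -> derive1n j g a = 0) /\
  derive1n n.+1 g a = (n.+1)`!%:R * h a.
Proof.
move=> r0; elim: n g h c => [|n IH] g h c hh E.
  split; first by case=> [|[]].
  rewrite derive1n1 (derive1_local E (disk_center a r0)) mul1r.
  apply: cder_derive1.
  apply: cder_eq (cderD (cder_cst c a) (cderM (cderX 1 (cderB (cder_id a) (cder_cst a a)))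
     (hol_cder hh (disk_center a r0)))) _.
  by rewrite subrr /=; ring.
pose k w := n.+2%:R * h w + (w - a) * derive1 h w.
have ha := disk_center a r0.
have hk : holomorphic_on (disk a r) k.
  apply: cder_hol => w wr; eexists; apply: cderD; first exact: cderZ (hol_cder hh wr).
  apply: cderM; first exact: cderB (cder_id w) (cder_cst a w).
  by apply: (hol_cder (hol_derive (@open_disk _ a r) hh)).
have E' w : disk a r w -> derive1 g w = 0 + (w - a) ^+ n.+1 * k w.
  move=> wr; rewrite (derive1_local E wr); apply: cder_derive1.
  apply: cder_eq (cderD (cder_cst c w) (cderM (cderX n.+2 (cderB (cder_id w) (cder_cst a w)))
     (hol_cder hh wr))) _.
  by rewrite /k /= (exprS _ n.+1); ring.
have [H1 H2] := IH _ _ _ hk E'.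
split.
  move=> [|[|j]] //.
    by move=> _; rewrite derive1n1 E' // subrr expr0n mul0r addr0.
  by move=> jn; rewrite derive1Sn; apply: H1; move: jn; rewrite !ltnS.
rewrite derive1Sn H2 /k subrr mul0r addr0 (factS n.+1) mulnC natrM; ring.
Qed.

(** Divided differences split off one factor z - a at a time; the vanishing of the
    next derivative makes the next division possible. *)
Lemma hol_factor U g a n : open U -> holomorphic_on U g -> U a ->
  (forall j, (0 < j < n.+1)%N -> derive1n j g a = 0) ->
  exists h, [/\ holomorphic_on U h, forall z, g z = g a + (z - a) ^+ n.+1 * h z &
    derive1n n.+1 g a = (n.+1)`!%:R * h a].
Proof.
move=> oU hg Ua; have /openP_disk /(_ _ Ua)[r r0 Hr] := oU.
have D n0 h : holomorphic_on U h -> (forall z, g z = g a + (z - a) ^+ n0.+1 * h z) ->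
   derive1n n0.+1 g a = (n0.+1)`!%:R * h a.
  move=> hh E; have hh' : holomorphic_on (disk a r) h by move=> w /Hr; exact: hh.
  by have [] := derive1n_factor r0 hh' (fun w _ => E w).
elim: n => [|n IH] H.
  exists (divided_diff g a); split; first exact: hol_divided_diff.
    by move=> z; rewrite expr1; exact: divided_diffE.
  by apply: D; [exact: hol_divided_diff | move=> z; rewrite expr1; exact: divided_diffE].
have [|h [hh E dn]] := IH.
  by move=> j /andP[j0 jn]; apply: H; rewrite j0 ltnW.
have ha : h a = 0.
  move: dn; rewrite H ?ltnSn // => /esym/eqP; rewrite mulf_eq0 pnatr_eq0.
  by rewrite (gtn_eqF (fact_gt0 _)) /= => /eqP.
have E' z : g z = g a + (z - a) ^+ n.+2 * divided_diff h a z.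
  by rewrite (E z) {1}(divided_diffE h a z) ha add0r mulrA -exprSr.
have hd : holomorphic_on U (divided_diff h a) by exact: hol_divided_diff.
by exists (divided_diff h a); split; [exact: hd | exact: E' | exact: (D n.+1 _ hd E')].
Qed.

Lemma multiplicity_factor U g a k : open U -> holomorphic_on U g -> U a ->
  has_multiplicity g a k ->
  exists h, [/\ holomorphic_on U h, h a != 0 & forall z, g z = g a + (z - a) ^+ k * h z].
Proof.
move=> oU hg Ua [k0 kn kj]; case: k k0 kn kj => // n _ kn kj.
have [h [hh E dn]] := hol_factor oU hg Ua kj.
by exists h; split=> //; apply: contra_neq kn => ha; rewrite dn ha mulr0.
Qed.

Lemma factor_multiplicity g h (c : C) a k r : 0 < r -> holomorphic_on (disk a r) h -> h a != 0 ->
  (0 < k)%N -> (forall w, disk a r w -> g w = c + (w - a) ^+ k * h w) -> has_multiplicity g a k.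
Proof.
move=> r0 hh ha; case: k => // n _ E.
have [H1 H2] := derive1n_factor r0 hh E.
split=> //; rewrite H2 mulf_neq0 // pnatr_eq0 -lt0n fact_gt0 //.
Qed.

Lemma multiplicity_uniq g a k l : has_multiplicity g a k -> has_multiplicity g a l -> k = l.
Proof.
move=> [k0 kn kj] [l0 ln lj]; case: (ltngtP k l) => // h.
  by move: kn; rewrite lj ?k0 // eqxx.
by move: ln; rewrite kj ?l0 // eqxx.
Qed.

Lemma hol_comp U V g h : holomorphic_on V g -> holomorphic_on U h -> (forall z, U z -> V (h z)) ->
  holomorphic_on U (fun z => g (h z)).
Proof.
move=> hg hh UV; apply: cder_hol => z Uz; eexists.
exact: (@cder_comp _ g h _ _ _ (hol_cder hg (UV _ Uz)) (hol_cder hh Uz)).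
Qed.
Lemma holM U g h : holomorphic_on U g -> holomorphic_on U h -> holomorphic_on U (fun z => g z * h z).
Proof.
move=> hg hh; apply: cder_hol => z Uz; eexists.
exact: cderM (hol_cder hg Uz) (hol_cder hh Uz).
Qed.
Lemma holX U g n : holomorphic_on U g -> holomorphic_on U (fun z => g z ^+ n).
Proof. by move=> hg; apply: cder_hol => z Uz; eexists; exact: cderX (hol_cder hg Uz). Qed.
Lemma hol_sub U V g : V `<=` U -> holomorphic_on U g -> holomorphic_on V g.
Proof. by move=> VU hg z /VU; exact: hg. Qed.

(** Substituting one factorization into the other multiplies the exponents. *)
Lemma multiplicity_comp U V f g a k l : open U -> open V -> holomorphic_on U f ->
  holomorphic_on V g -> U a -> V (f a) ->
  has_multiplicity f a k -> has_multiplicity g (f a) l ->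
  has_multiplicity (fun z => g (f z)) a (l * k).
Proof.
move=> oU oV hf hg Ua Vfa mf mg.
have [p [hp pa Ep]] := multiplicity_factor oU hf Ua mf.
have [q [hq qa Eq]] := multiplicity_factor oV hg Vfa mg.
have [r r0 Hr] : exists2 r, 0 < r & forall z, disk a r z -> U z /\ V (f z).
  have /openP_disk /(_ _ Ua)[s s0 Hs] := oU.
  have /openP_disk /(_ _ Vfa)[t t0 Ht] := oV.
  have /contCCP /(_ _ t0)[d d0 Hd] := hol_cont hf Ua.
  exists (Num.min s d); first by rewrite lt_min s0.
  move=> z /diskP; rewrite lt_min => /andP[zs zd]; split; first by apply: Hs; apply/diskP.
  by apply: Ht; apply/diskP; exact: Hd.
have sU : disk a r `<=` U by move=> z /Hr[].
apply: (@factor_multiplicity _ (fun z => p z ^+ l * q (f z)) (g (f a)) _ _ _ r0).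
- apply: holM; first exact: holX (hol_sub sU hp).
  by apply: (hol_comp hq (hol_sub sU hf)) => z /Hr[].
- by rewrite mulf_neq0 // expf_neq0.
- by case: mf mg => [k0 _ _] [l0 _ _]; rewrite muln_gt0 l0.
move=> w wr; rewrite Eq; congr (_ + _).
rewrite (Ep w) addrC addKr -Ep exprMn mulnC exprM; ring.
Qed.

Lemma cabs_triangle_sub z w : cabs z - cabs w <= cabs (z - w).
Proof. by have := cabs_le_of_diff z w; lra. Qed.

(** A map with nonzero derivative is open to first order: moving in the direction
    -v/d lowers the modulus. *)
Lemma nonzero_step (v d : C) : d != 0 -> v != 0 -> forall g z, g z = v -> cder g z d ->
  forall e, 0 < e -> exists2 w, cabs (w - z) < e & cabs (g w) < cabs v.
Proof.
move=> d0 v0 g z gz H e e0.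
pose u := - v / d.
have u0 : u != 0 by rewrite mulf_neq0 ?oppr_eq0 // invr_eq0.
have vp : 0 < cabs v by rewrite cabs_gt0.
have up : 0 < cabs u by rewrite cabs_gt0.
have eps : 0 < cabs v / (2 * cabs u) by rewrite divr_gt0 // mulr_gt0.
have [del del0 Hd] := H _ eps.
pose t := Num.min (1 / 2) (Num.min (e / (2 * cabs u)) (del / (2 * cabs u))).
have t0 : 0 < t by rewrite !lt_min; rewrite !divr_gt0 // mulr_gt0.
have t1 : t <= 1 / 2 by rewrite /t ge_min lexx.
have te : t * cabs u < e.
  have : t <= e / (2 * cabs u) by rewrite /t !ge_min lexx orbT.
  by rewrite ler_pdivlMr ?mulr_gt0 //; lra.
have td : t * cabs u < del.
  have : t <= del / (2 * cabs u) by rewrite /t !ge_min lexx !orbT.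
  by rewrite ler_pdivlMr ?mulr_gt0 //; lra.
have cw : cabs (z + toC t * u - z) = t * cabs u.
  by rewrite (_ : _ - z = toC t * u) ?cabsM ?cabs_real ?gtr0_norm //; ring.
exists (z + toC t * u); first by rewrite cw.
have := Hd (z + toC t * u); rewrite cw => /(_ td).
rewrite gz (_ : z + toC t * u - z = toC t * u); last by ring.
have -> : d * (toC t * u) = - toC t * v by rewrite /u; field.
have -> : cabs v / (2 * cabs u) * (t * cabs u) = t / 2 * cabs v by field; rewrite gt_eqF.
move=> h.
have := cabs_le_of_diff (g (z + toC t * u)) (toC (1 - t) * v).
rewrite cabsM cabs_real ger0_norm; last by lra.
rewrite (_ : g (z + toC t * u) - toC (1 - t) * v = g (z + toC t * u) - v - - toC t * v); last first.
  by rewrite toCB toC1; ring.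
by move=> h2; apply: le_lt_trans h2 _; nra.
Qed.

Lemma cabs_continuous_comp g (w z : C) : {for z, continuous g} ->
  {for z, continuous (fun u => cabs (g u - w))}.
Proof.
move=> /contCCP H; apply: contCRI => e /H[d d0 Hd]; exists d => // u /Hd uz.
apply: le_lt_trans uz; rewrite ler_norml.
have := cabs_triangle_sub (g u - w) (g z - w); have := cabs_triangle_sub (g z - w) (g u - w).
rewrite (_ : g z - w - (g u - w) = g z - g u); last by ring.
rewrite (_ : g u - w - (g z - w) = g u - g z); last by ring.
by rewrite (cabsB (g z) (g u)) => ? ?; apply/andP; split; lra.
Qed.

Lemma continuous_withinC (A : set C) (h : C -> R) : (forall z, A z -> {for z, continuous h}) ->
  {within A, continuous h}.
Proof.
move=> H; apply: continuous_in_subspaceT => z; rewrite inE; exact: H.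
Qed.

(** On a disk where the derivative varies by at most half of its modulus at the
    centre, g stretches distances by at least a fixed factor and is injective. A
    value w close to g(a) is attained at the minimum of |g - w| over a closed disk:
    the minimum is interior, and there it could be lowered if it were not 0. *)
Lemma inverse_function U g a : open U -> holomorphic_on U g -> U a -> derive1 g a != 0 ->
  forall e, 0 < e -> exists r rho (sg : C -> C),
  [/\ 0 < r <= e, 0 < rho, disk a r `<=` U,
    (forall x y, disk a r x -> disk a r y -> g x = g y -> x = y) &
    (forall x, disk a r x -> derive1 g x != 0) /\
    (forall w, disk (g a) rho w -> [/\ disk a r (sg w), g (sg w) = w &
       cder sg w (derive1 g (sg w))^-1])].
Proof.
move=> oU hg Ua d0 e e0.
(* An opaque name for the derivative keeps arithmetic from unfolding it. *)
have [dg [Hdg Edg cdg]] : exists dg : C -> C, [/\ forall x, U x -> cder g x (dg x),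
    derive1 g = dg & {for a, continuous dg}].
  by exists (derive1 g); split=> //; [exact: hol_cder hg | exact: hol_cont (hol_derive oU hg) _ Ua].
rewrite !Edg in d0 *.
have [d dE] : exists d, d = dg a by exists (dg a).
rewrite -dE in d0.
have [m mE] : exists m, m = cabs d by exists (cabs d).
have m0 : 0 < m by rewrite mE cabs_gt0.
have /openP_disk /(_ _ Ua)[s s0 Hs] := oU.
have m2 : 0 < m / 2 by lra.
have /contCCP /(_ _ m2)[t t0 Ht] := cdg.
pose r := Num.min e (Num.min s t).
have r0 : 0 < r by rewrite !lt_min e0 s0.
have re : r <= e by rewrite /r ge_min lexx.
have rs : r <= s by rewrite /r !ge_min lexx orbT.
have rt : r <= t by rewrite /r !ge_min lexx !orbT.
have rU : disk a r `<=` U by move=> z /diskP zr; apply: Hs; apply/diskP; lra.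
have dn x : disk a r x -> cabs (dg x - d) <= m / 2.
  by move=> /diskP xr; rewrite dE; apply/ltW/Ht; lra.
have dp x : disk a r x -> m / 2 <= cabs (dg x).
  by move=> /dn; rewrite cabsB => h; have := cabs_triangle_sub d (dg x); rewrite -mE; lra.
have dnz x : disk a r x -> dg x != 0.
  by move=> /dp h; rewrite -cabs_gt0; lra.
have low x y : disk a r x -> disk a r y -> m / 2 * cabs (x - y) <= cabs (g x - g y).
  move=> xr yr.
  have h : cabs (g x - g y - d * (x - y)) <= m / 2 * cabs (x - y).
    apply: (@mean_ineq_seg _ g (dg)) => u u01; have ur := disk_convex yr xr u01.
      exact: Hdg (rU _ ur).
    exact: dn.
  have := cabs_triangle_sub (d * (x - y)) (g x - g y).
  by rewrite cabsB cabsM -mE; rewrite cabsB in h; move: h; rewrite cabsB; lra.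
have inj x y : disk a r x -> disk a r y -> g x = g y -> x = y.
  move=> xr yr E; have := low _ _ xr yr; rewrite E subrr cabs0 => h.
  apply/eqP; rewrite -subr_eq0 -cabs_eq0 eq_le cabs_ge0 andbT.
  by rewrite -(pmulr_rle0 _ m2).
(* On the circle of radius r1, |g - w| > m r1 / 2 - rho = rho > |g(a) - w|, so the
   minimum is not attained there. *)
pose r1 := r / 2; pose rho := m * r1 / 4.
have rho0 : 0 < rho by rewrite /rho /r1; apply: divr_gt0 => //; apply: mulr_gt0 => //; lra.
have ar := disk_center a r0.
have sub1 z : cabs (z - a) <= r1 -> disk a r z by rewrite /r1 => h; apply/diskP; lra.
have surj w : disk (g a) rho w -> exists z, disk a r z /\ g z = w.
  move=> /diskP wr.
  have [||z0 z0K zmin] := @compact_EVT_min _ _ (fun z => cabs (g z - w)) (cdisk a r1) _ (@compact_cdisk _ a r1).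
  - by exists a; rewrite /cdisk /= subrr cabs0 /r1; lra.
  - apply: continuous_withinC => z /sub1 /rU Uz; apply: (@cabs_continuous_comp g w z).
    by have := hol_cont hg Uz.
  rewrite inE /cdisk /= in z0K.
  have z0r := sub1 _ z0K.
  exists z0; split => //; apply/eqP/negPn/negP => ne.
  have ga : cabs (g z0 - w) < rho.
    have := zmin a; rewrite inE /cdisk /= subrr cabs0 => h.
    by apply: le_lt_trans (h _) _; [rewrite /r1; lra | rewrite cabsB].
  have z0i : cabs (z0 - a) < r1.
    rewrite lt_neqAle z0K andbT; apply/eqP => E.
    have := low _ _ z0r ar; rewrite E.
    have := cabs_triangle_sub (g z0 - g a) (w - g a).
    rewrite (_ : g z0 - g a - (w - g a) = g z0 - w); last by ring.
    by move: ga wr; rewrite /rho; lra.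
  have v0 : g z0 - w != 0 by rewrite subr_eq0.
  have cd : cder (fun z => g z - w) z0 (dg z0).
    by apply: cder_eq (cderB (Hdg _ (rU _ z0r)) (cder_cst w z0)) _; rewrite subr0.
  have e1 : 0 < r1 - cabs (z0 - a) by lra.
  have [z1 z1z0 lt1] := @nonzero_step (g z0 - w) (dg z0) (dnz _ z0r) v0 (fun z => g z - w) z0 (erefl _) cd _ e1.
  have := zmin z1; rewrite inE /cdisk /= => h.
  suff : cabs (g z0 - w) <= cabs (g z1 - w) by lra.
  by apply: h; have := cabsD (z1 - z0) (z0 - a); rewrite addrA subrK; lra.
have /choice[sg Hsg] : forall w, exists z, disk (g a) rho w -> disk a r z /\ g z = w.
  move=> w; have [/surj[z Hz]|] := pselect (disk (g a) rho w); first by exists z.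
  by exists a.
exists r, rho, sg; split => //; first by rewrite r0.
split=> // w wr; have [sr gs] := Hsg w wr; split=> //.
have [z0 z0E] : exists z0, z0 = sg w by exists (sg w).
rewrite -z0E in sr gs *.
have [d1 d1E] : exists d1, d1 = dg z0 by exists (dg z0).
have d10 : d1 != 0 by rewrite d1E; exact: dnz.
rewrite -d1E.
have d1p : 0 < cabs d1 by rewrite cabs_gt0.
move=> eps eps0.
pose e' := eps * cabs d1 * (m / 2).
have e'0 : 0 < e' by rewrite /e' !mulr_gt0.
have [del del0 Hdel] := Hdg _ (rU _ sr) _ e'0.
have /openP_disk /(_ _ wr)[q q0 Hq] := @open_disk _ (g a) rho.
exists (Num.min q (del * (m / 2))); first by rewrite lt_min q0 mulr_gt0.
move=> v; rewrite lt_min => /andP[vq vdel].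
have vr : disk (g a) rho v by apply: Hq; apply/diskP.
have [svr gv] := Hsg v vr.
have lo := low _ _ svr sr; rewrite gv gs in lo.
have dz : cabs (sg v - z0) < del.
  by rewrite -(ltr_pM2l m2); apply: le_lt_trans lo _; rewrite mulrC.
have := Hdel _ dz; rewrite gv gs -d1E => h.
rewrite -z0E; have -> : sg v - z0 - d1^-1 * (v - w) = - (v - w - d1 * (sg v - z0)) / d1 by field.
rewrite cabsM cabsN cabsV ler_pdivrMr //; apply: le_trans h _.
rewrite (_ : e' * cabs (sg v - z0) = eps * cabs d1 * (m / 2 * cabs (sg v - z0))); last by rewrite /e'; ring.
rewrite (_ : eps * cabs (v - w) * cabs d1 = eps * cabs d1 * cabs (v - w)); last by ring.
by apply: ler_wpM2l lo; apply: mulr_ge0; apply: ltW.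
Qed.
End Local.

(** * Normal forms and injectivity *)

Section NormalForm.
Context {R : realType}.
Local Notation C := (Cplx R).
Implicit Types (z w a : C) (r e : R) (g h : C -> C) (U : set C).

Lemma kth_root (c : C) k : (0 < k)%N -> exists b : C, b ^+ k = c.
Proof. by move=> k0; exists (k.-root c)%R; rewrite rootCK. Qed.

Lemma nontrivial_root_unity k : (1 < k)%N -> exists om : C, om ^+ k = 1 /\ om != 1.
Proof.
move=> k1; have [x Hx] := @solve_monicpoly C k.-1 (fun=> -1) (ltac:(by rewrite -ltnS prednK // ltnW)).
have S0 : \sum_(i < k) x ^+ i = 0.
  rewrite -(prednK (ltnW k1)) big_ord_recr /= Hx -big_split /= big1 // => i _.
  by rewrite mulN1r subrr.
exists x; split.
  by apply/eqP; rewrite -subr_eq0 subrX1 S0 mulr0.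
apply/eqP => x1; move: S0; rewrite x1.
under eq_bigr => i _ do rewrite expr1n.
by rewrite sumr_const card_ord => /eqP; rewrite pnatr_eq0 gtn_eqF // ltnW.
Qed.

Lemma hol_translate U a : holomorphic_on U (fun z : C => z - a).
Proof. by apply: cder_hol => z _; eexists; exact: cderB (cder_id z) (cder_cst a z). Qed.

Lemma hol_power (U : set C) n : holomorphic_on U (fun z => z ^+ n).
Proof. by apply: cder_hol => z _; eexists; exact: (cderX n (cder_id z)). Qed.

(** Write g = g(a) + (z - a)^k h with h(a) <> 0. Near h(a) the k-th power has a
    holomorphic inverse, so h has a k-th root. *)
Lemma normal_form U g a k : open U -> holomorphic_on U g -> U a -> has_multiplicity g a k ->
  exists r (phi : C -> C), [/\ 0 < r, disk a r `<=` U, holomorphic_on (disk a r) phi,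
     phi a = 0 /\ derive1 phi a != 0 & forall z, disk a r z -> g z = g a + phi z ^+ k].
Proof.
move=> oU hg Ua mk; have [h [hh ha E]] := multiplicity_factor oU hg Ua mk.
have k0 : (0 < k)%N by case: mk.
have [c Hc] := kth_root (h a) k0.
have c0 : c != 0 by apply: contra_neq ha => c0; rewrite -Hc c0 expr0n gtn_eqF.
have d0 : derive1 (fun z : C => z ^+ k) c != 0.
  rewrite (cder_derive1 (cderX k (cder_id c))) mulr1 mulf_neq0 ?expf_neq0 //.
  by rewrite pnatr_eq0 -lt0n.
have [s [rho [sg [_ rho0 _ _ [_ Hsg]]]]] := inverse_function openT (@hol_power setT k) I d0 ltr01.
rewrite Hc in Hsg.
have /contCCP /(_ _ rho0)[t t0 Ht] := hol_cont hh Ua.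
have /openP_disk /(_ _ Ua)[q q0 Hq] := oU.
pose r := Num.min q t; have r0 : 0 < r by rewrite lt_min q0.
have sU : disk a r `<=` U.
  by move=> z /diskP zr; apply: Hq; apply/diskP; apply: lt_le_trans zr _; rewrite ge_min lexx.
have hd z : disk a r z -> disk (h a) rho (h z).
  by move=> /diskP zr; apply/diskP/Ht; apply: lt_le_trans zr _; rewrite ge_min lexx orbT.
have hs : holomorphic_on (disk a r) (fun z => sg (h z)).
  apply: (@hol_comp _ _ (disk (h a) rho)) => //; last exact: hol_sub hh.
  by apply: cder_hol => w /Hsg[_ _ ?]; eexists; eassumption.
have ar := disk_center a r0.
have [_ sk _] := Hsg _ (hd _ ar).
have s0 : sg (h a) != 0 by apply: contra_neq ha => s0; rewrite -sk s0 expr0n gtn_eqF.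
exists r, (fun z => (z - a) * sg (h z)); split.
- exact: r0.
- exact: sU.
- exact (holM (@hol_translate _ a) hs).
- split; first by rewrite subrr mul0r.
  have := cder_derive1 (cderM (cderB (cder_id a) (cder_cst a a)) (hol_cder hs ar)).
  by rewrite subr0 mul1r subrr mul0r addr0 => ->.
- by move=> z /hd /Hsg[_ h2 _]; rewrite exprMn h2 E.
Qed.

(** All powers of z - a split off. On the circle of radius r/3 about z, which stays
    at distance r/4 from a, the cofactor is bounded by M / (r/4)^(n+1), and Cauchy's
    estimate moves this bound to z; the factor |z - a|^(n+1) <= (r/12)^(n+1)
    then wins as n grows. *)
Lemma flat_constant g a r : 0 < r -> holomorphic_on (disk a r) g ->
  (forall j, (0 < j)%N -> derive1n j g a = 0) ->
  forall z, disk a (r / 12) z -> g z = g a.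
Proof.
move=> r0 hg flat z /diskP za.
have r2 : 0 < r / 2 by lra.
have K u : cdisk a (r / 2) u -> disk a r u by rewrite /cdisk /= => ?; apply/diskP; lra.
have [||m _ Hm] := @compact_EVT_max _ _ (fun u => cabs (g u - g a)) (cdisk a (r / 2)) _ (@compact_cdisk _ a (r / 2)).
- by exists a; rewrite /cdisk /= subrr cabs0; lra.
- apply: continuous_withinC => u /K ur; apply: (@cabs_continuous_comp _ g (g a) u).
  by have := hol_cont hg ur.
pose M := cabs (g m - g a).
have HM u : cabs (u - a) <= r / 2 -> cabs (g u - g a) <= M.
  by move=> ur; apply: Hm; rewrite inE.
have M0 : 0 <= M by exact: cabs_ge0.
apply/eqP; rewrite -subr_eq0; apply/eqP; apply: cabs_small => e e0.
have [n Hn] := half_pow_small M0 e0.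
apply: le_trans (ltW Hn).
have fl : forall j, (0 < j < n.+1)%N -> derive1n j g a = 0 by move=> j /andP[j0 _]; exact: flat.
have [h [hh E _]] := hol_factor (@open_disk _ a r) hg (disk_center a r0) fl.
have zr : disk a r z by apply/diskP; lra.
pose F u := (u - z) * h u.
have hF : holomorphic_on (disk a r) F.
  exact (holM (@hol_translate _ z) hh).
have sub u : disk z (r / 2) u -> disk a r u.
  by move=> /diskP uz; apply/diskP; have := cabsD (u - z) (z - a); rewrite addrA subrK; lra.
have Fz : derive1 F z = h z.
  have := cder_derive1 (cderM (cderB (cder_id z) (cder_cst z z)) (hol_cder hh zr)).
  by rewrite subr0 mul1r subrr mul0r addr0.
pose q := r / 4.
have q0 : 0 < q by rewrite /q; lra.
have := @cauchy_estimate _ F (derive1 F) z (r / 2) (r / 3) (r / 3 * (M / q ^+ n.+1)).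
have -> : r / 3 * (M / q ^+ n.+1) / (r / 3) = M / q ^+ n.+1.
  by field; rewrite expf_neq0 ?gt_eqF.
rewrite Fz => CE.
have hz : cabs (h z) <= M / q ^+ n.+1.
  apply: CE; first by lra.
  - by move=> u /sub; exact: hol_cder.
  - by move=> u /sub ur; have := hol_cont (hol_derive (@open_disk _ a r) hF) ur.
  - move=> u uz; rewrite /F cabsM uz; apply: ler_wpM2l; first by lra.
    have ua1 : q <= cabs (u - a).
      have := cabsD (u - a) (a - z); rewrite addrA subrK (cabsB a) uz /q; lra.
    have ua2 : cabs (u - a) <= r / 2.
      by have := cabsD (u - z) (z - a); rewrite addrA subrK uz; lra.
    have := HM _ ua2; rewrite (E u) (addrC (g a)) addrK cabsM cabsX => h1.
    have p1 : 0 < cabs (u - a) ^+ n.+1 by rewrite exprn_gt0; lra.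
    rewrite ler_pdivlMr ?exprn_gt0 //; apply: le_trans h1; rewrite mulrC.
    apply: ler_wpM2r; first exact: cabs_ge0.
    by apply: lerXn2r; rewrite ?nnegrE; lra.
rewrite (E z) (addrC (g a)) addrK cabsM cabsX.
apply: (@le_trans _ _ ((q / 2) ^+ n.+1 * (M / q ^+ n.+1))).
  apply: ler_pM => //; rewrite ?exprn_ge0 ?cabs_ge0 //.
  by apply: lerXn2r; rewrite ?nnegrE ?cabs_ge0 //; rewrite /q; lra.
have -> : (q / 2) ^+ n.+1 * (M / q ^+ n.+1) = M / 2 ^+ n / 2.
  by rewrite expr_div_n (exprS 2); field; rewrite !expf_neq0 ?gt_eqF.
have : 0 <= M / 2 ^+ n by rewrite divr_ge0 // exprn_ge0.
lra.
Qed.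

Lemma exists_multiplicity g a : (exists2 j, (0 < j)%N & derive1n j g a != 0) ->
  exists k, has_multiplicity g a k.
Proof.
move=> [j j0 jn]; have ex : exists j, (0 < j)%N && (derive1n j g a != 0) by exists j; rewrite j0.
case: (ex_minnP ex) => k /andP[k0 kn] kmin; exists k; split=> // i /andP[i0 ik].
apply/eqP/negPn/negP => ne; have := kmin i; rewrite i0 ne => /(_ isT).
by rewrite leqNgt ik.
Qed.

(** A function of multiplicity k > 1 takes equal values at points whose local
    coordinates differ by a k-th root of unity; one without multiplicity is constant
    near [a]. *)
Lemma injective_derive_neq0 U g a : open U -> holomorphic_on U g -> U a ->
  (forall x y, U x -> U y -> g x = g y -> x = y) -> derive1 g a != 0.
Proof.
move=> oU hg Ua inj.
have /openP_disk /(_ _ Ua)[r r0 Hr] := oU.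
have [k mk] : exists k, has_multiplicity g a k.
  apply: exists_multiplicity; apply: contrapT => H.
  have flat j : (0 < j)%N -> derive1n j g a = 0.
    by move=> j0; apply/eqP/negPn/negP => ne; apply: H; exists j.
  have FC := flat_constant r0 (hol_sub Hr hg) flat.
  have r24 : 0 < r / 24 by lra.
  have cz : cabs (a + toC (r / 24) - a) = r / 24.
    by rewrite addrC addKr cabs_real gtr0_norm.
  have zr : disk a (r / 12) (a + toC (r / 24)) by apply/diskP; rewrite cz; lra.
  have zr' : disk a r (a + toC (r / 24)) by apply/diskP; rewrite cz; lra.
  have /eqP := inj _ _ (Hr _ zr') Ua (FC _ zr).
  by rewrite -subr_eq0 -cabs_eq0 cz gt_eqF.
have [k0 kn kj] := mk.
have [k1|k1] : k = 1%N \/ (1 < k)%N by move: k0; case: (k) => [|[|?]]; [|left|right].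
  by move: kn; rewrite k1 derive1n1.
exfalso.
have [s [phi [s0 sU hphi [phia dphi] E]]] := normal_form oU hg Ua mk.
have [t [rho [sg [t0 rho0 _ _ [_ Hsg]]]]] :=
  inverse_function (@open_disk _ a s) hphi (disk_center a s0) dphi s0.
case/andP: t0 => t0 ts.
rewrite phia in Hsg.
have [om [omk om1]] := nontrivial_root_unity k1.
have oma : cabs om = 1.
  by apply/eqP; rewrite -(@eqrXn2 _ k) ?cabs_ge0 // -cabsX omk cabs1 expr1n.
pose c := toC (rho / 2) : C.
have cn : cabs c = rho / 2 by rewrite cabs_real gtr0_norm //; lra.
have cd : disk 0 rho c by apply/diskP; rewrite subr0 cn; lra.
have cd' : disk 0 rho (om * c) by apply/diskP; rewrite subr0 cabsM oma cn; lra.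
have [x1 x2 _] := Hsg _ cd; have [y1 y2 _] := Hsg _ cd'.
have st z : disk a t z -> disk a s z by move=> /diskP zt; apply/diskP; lra.
have := inj _ _ (sU _ (st _ x1)) (sU _ (st _ y1)).
rewrite (E _ (st _ x1)) (E _ (st _ y1)) x2 y2 exprMn omk mul1r => /(_ erefl) Exy.
have : (om - 1) * c = 0 by rewrite mulrBl mul1r -y2 -Exy x2 subrr.
move=> /eqP; rewrite mulf_eq0 subr_eq0 (negPf om1) /= -cabs_eq0 cn gt_eqF //; lra.
Qed.
End NormalForm.

(** * Path lifting and monodromy *)

Section Lifting.
Context {R : realType}.
Local Notation C := (Cplx R).
Implicit Types (z w : C) (r e s t : R) (g : C -> C) (U V : set C) (gam bet : R -> C).

(** Continuity on [0, t] with explicit moduli, so that lifts defined on growing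
    intervals can be compared and glued. *)
Definition cont_upto gam t := forall s, 0 <= s <= t -> forall e, 0 < e ->
  exists2 d, 0 < d & forall u, 0 <= u <= t -> `|u - s| < d -> cabs (gam u - gam s) < e.

Definition is_lift g V gam x t bet := [/\ cont_upto bet t, bet 0 = x,
  forall s, 0 <= s <= t -> V (bet s) & forall s, 0 <= s <= t -> g (bet s) = gam s].

Definition locally_biholomorphic g V :=
  [/\ open V, holomorphic_on V g & forall z, V z -> derive1 g z != 0].

Definition is_section g V w0 rho (sg : C -> C) := 0 < rho /\
  forall w, disk w0 rho w -> [/\ V (sg w), g (sg w) = w & exists d, cder sg w d].

Definition path_lifting g V U := forall gam, cont_upto gam 1 ->
  (forall s, 0 <= s <= 1 -> U (gam s)) -> forall x, V x -> g x = gam 0 ->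
  exists bet, is_lift g V gam x 1 bet.

Lemma cont_upto_le gam t u : u <= t -> cont_upto gam t -> cont_upto gam u.
Proof.
move=> ut H s /andP[s0 su] e e0; have [|d d0 Hd] := H s _ e e0.
  by rewrite s0 (le_trans su ut).
by exists d => // v /andP[v0 vu]; apply: Hd; rewrite v0 (le_trans vu ut).
Qed.

Lemma is_lift_le g V gam x t u bet : u <= t -> is_lift g V gam x t bet -> is_lift g V gam x u bet.
Proof.
move=> ut [cb b0 bV bg]; split=> //; first exact: cont_upto_le cb.
  by move=> s /andP[s0 su]; apply: bV; rewrite s0 (le_trans su ut).
by move=> s /andP[s0 su]; apply: bg; rewrite s0 (le_trans su ut).
Qed.

Lemma local_section g V z e : locally_biholomorphic g V -> V z -> 0 < e ->
  exists r rho sg, [/\ 0 < r <= e, disk z r `<=` V,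
    (forall x y, disk z r x -> disk z r y -> g x = g y -> x = y),
    is_section g V (g z) rho sg &
    forall w, disk (g z) rho w -> disk z r (sg w)].
Proof.
move=> [oV hg dg] Vz e0.
have [r [rho [sg [re rho0 rV inj [_ Hs]]]]] := inverse_function oV hg Vz (dg z Vz) e0.
exists r, rho, sg; split=> //; last by move=> w /Hs[].
by split=> // w /Hs[h1 h2 h3]; split=> //; [exact: rV | eexists; exact: h3].
Qed.

Lemma section_center g V z r rho sg : 0 < r ->
  (forall x y, disk z r x -> disk z r y -> g x = g y -> x = y) ->
  is_section g V (g z) rho sg -> (forall w, disk (g z) rho w -> disk z r (sg w)) ->
  sg (g z) = z.
Proof.
move=> r0 inj [rho0 Hs] Hd; have c := disk_center (g z) rho0.
by apply: inj => //; [exact: Hd | exact: disk_center | case: (Hs _ c)].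
Qed.

(** Local injectivity carries agreement of two lifts from one parameter to the
    neighbouring ones. *)
Lemma lift_uniq g V gam x t (b1 b2 : R -> C) : locally_biholomorphic g V -> t <= 1 ->
  is_lift g V gam x t b1 -> is_lift g V gam x t b2 -> forall s, 0 <= s <= t -> b1 s = b2 s.
Proof.
move=> LB t1 [c1 s1 V1 g1] [c2 s2 V2 g2].
suff P s : 0 <= s <= 1 -> s <= t -> b1 s = b2 s.
  by move=> s /andP[s0 st]; apply: P => //; rewrite s0 (le_trans st t1).
move: s; apply: interval_induction; first by move=> _; rewrite s1 s2.
move=> u /andP[u0 _].
have [ut|tu] := le_or_lt u t; last first.
  exists (u - t); first lra.
  by move=> v w vw _ _ wu _ wt; exfalso; move: wu; rewrite distrC ger0_norm; lra.
have ut' : 0 <= u <= t by rewrite u0.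
have [r [rho [sg [/andP[r0 _] _ inj _ _]]]] := local_section LB (V1 u ut') ltr01.
have r4 : 0 < r / 4 by lra.
have [d1 d10 H1] := c1 u ut' _ r4; have [d2 d20 H2] := c2 u ut' _ r4.
exists (Num.min d1 d2); first by rewrite lt_min d10.
move=> v w /andP[v0 vw] _; rewrite !lt_min => /andP[v1 v2] /andP[w1 w2] IH wt.
have vt : v <= t by exact: le_trans vw wt.
have vt' : 0 <= v <= t by rewrite v0.
have wt' : 0 <= w <= t by rewrite wt andbT (le_trans v0 vw).
have A1 := H1 v vt' v1; have A2 := H2 v vt' v2.
have B1 := H1 w wt' w1; have B2 := H2 w wt' w2.
rewrite (IH vt) in A1; apply: inj; last by rewrite g1 // g2.
  by apply/diskP; lra.
apply/diskP; have := cabsD (b2 w - b2 u) (b2 u - b1 u); rewrite addrA subrK.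
have := cabsD (b2 u - b2 v) (b2 v - b1 u); rewrite addrA subrK (cabsB (b2 u)); lra.
Qed.

Lemma section_cont g V w0 rho sg w : is_section g V w0 rho sg -> disk w0 rho w ->
  forall e, 0 < e -> exists2 d, 0 < d & forall v, cabs (v - w) < d -> cabs (sg v - sg w) < e.
Proof.
by move=> [_ Hs] wr e e0; have [_ _ [d /cder_cont /contCCP /(_ _ e0)]] := Hs w wr.
Qed.

Lemma glue_lift g V gam x s0 t bet w0 rho sg : 0 <= s0 <= t -> cont_upto gam t ->
  is_lift g V gam x s0 bet -> is_section g V w0 rho sg ->
  (forall s, s0 <= s <= t -> disk w0 rho (gam s)) -> sg (gam s0) = bet s0 ->
  is_lift g V gam x t (fun u => if u <= s0 then bet u else sg (gam u)).
Proof.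
move=> /andP[s00 s0t] cg [cb b0 bV bg] sec dsk E; split.
- move=> s /andP[ss st] e e0.
  have [hs|hs] := le_or_lt s s0.
  + have [|d1 d10 H1] := cb s _ e e0; first by rewrite ss.
    have [hs'|hs'] : s < s0 \/ s = s0 by move: hs; rewrite le_eqVlt => /orP[/eqP|]; [right|left].
      exists (Num.min d1 (s0 - s)); first by rewrite lt_min d10 subr_gt0.
      move=> u /andP[u0 ut]; rewrite lt_min => /andP[us1 us2].
      have us0 : u <= s0 by have := ler_norm (u - s); lra.
      by rewrite us0 hs; apply: H1; rewrite ?u0.
    have ds : disk w0 rho (gam s) by apply: dsk; rewrite hs' lexx.
    have [d2 d20 H2] := section_cont sec ds e0.
    have [|d3 d30 H3] := cg s _ _ d20; first by rewrite ss.
    exists (Num.min d1 d3); first by rewrite lt_min d10.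
    move=> u /andP[u0 ut]; rewrite lt_min => /andP[us1 us3]; rewrite hs.
    have [us0|us0] := leP u s0; first by apply: H1; rewrite ?u0.
    rewrite (_ : bet s = sg (gam s)); last by rewrite hs' E.
    by apply/H2/H3; rewrite ?u0.
  + have ds : disk w0 rho (gam s) by apply: dsk; rewrite (ltW hs) st.
    have [d2 d20 H2] := section_cont sec ds e0.
    have [|d3 d30 H3] := cg s _ _ d20; first by rewrite ss.
    exists (Num.min (s - s0) d3); first by rewrite lt_min d30 subr_gt0 hs.
    move=> u /andP[u0 ut]; rewrite lt_min => /andP[us1 us3].
    have us0 : s0 < u by have := ler_norm (s - u); rewrite distrC; lra.
    rewrite !leNgt us0 hs /=; apply/H2/H3 => //; by rewrite u0.
- by rewrite s00.
- move=> s /andP[ss st]; case: leP => hs; first by apply: bV; rewrite ss.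
  by case: sec => _ /(_ (gam s))[] //; apply: dsk; rewrite (ltW hs).
- move=> s /andP[ss st]; case: leP => hs; first by apply: bg; rewrite ss.
  by case: sec => _ /(_ (gam s))[] //; apply: dsk; rewrite (ltW hs).
Qed.

(** By real induction a lift exists on every [0, t[; it extends to t, and beyond,
    through a local section at a cluster point. So path lifting can only fail
    for want of a cluster point in [V] over the end of the path. *)
Lemma path_lifting_cluster g V U : locally_biholomorphic g V ->
  (forall gam x t bet, cont_upto gam 1 -> (forall s, 0 <= s <= 1 -> U (gam s)) ->
     0 < t <= 1 -> (forall s, 0 <= s < t -> is_lift g V gam x s bet) ->
     exists y, [/\ V y, g y = gam t & forall e d, 0 < e -> 0 < d ->
        exists s, [/\ 0 <= s < t, t - d < s & cabs (bet s - y) < e]]) ->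
  path_lifting g V U.
Proof.
move=> LB H gam cg gU x Vx gx.
suff P t : 0 <= t <= 1 -> exists bet, is_lift g V gam x t bet by apply: P; rewrite ler01 lexx.
move: t; apply: real_induction.
- exists (fun=> x); split=> //.
    by move=> s _ e e0; exists 1 => // u _ _; rewrite subrr cabs0.
  by move=> s s0; rewrite gx; congr gam; lra.
- move=> t /andP[t0 t1] IH.
  have /choice[B HB] : forall s, exists bet, 0 <= s < t -> is_lift g V gam x s bet.
    move=> s; have [st|st] := boolP (0 <= s < t); last by exists gam.
    by have [bet Hb] := IH s st; exists bet.
  pose bet s := B s s.
  have Eb s u : 0 <= u <= s -> s < t -> bet u = B s u.
    move=> /andP[u0 us] st.
    have su : 0 <= u < t by rewrite u0 (le_lt_trans us st).
    have ss : 0 <= s < t by rewrite (le_trans u0 us).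
    apply: (lift_uniq (x := x) (t := u) (gam := gam) LB _ (HB u su)); first by lra.
      exact: is_lift_le us (HB s ss).
    by rewrite u0 lexx.
  have Lb s : 0 <= s < t -> is_lift g V gam x s bet.
    move=> st; have /andP[s0 st'] := st; have [c1 s1 V1 g1] := HB s st; split.
    + move=> u us e e0; have [d d0 Hd] := c1 u us e e0; exists d => // v vs vu.
      by rewrite !(Eb s) //; exact: Hd.
    + by rewrite (Eb s) ?lexx.
    + by move=> u us; rewrite (Eb s) //; exact: V1.
    + by move=> u us; rewrite (Eb s) //; exact: g1.
  have [|y [Vy gy cl]] := H gam x t bet cg gU _ Lb; first by rewrite t0.
  have [r [rho [sg [/andP[r0 _] rV inj sec sd]]]] := local_section LB Vy ltr01.
  have rho0 : 0 < rho by case: sec.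
  have [|eta eta0 Heta] := cg t _ _ rho0; first by rewrite (ltW t0).
  have [s0 [/andP[s00 s0t] s0e s0y]] := cl r eta r0 eta0.
  exists (fun u => if u <= s0 then bet u else sg (gam u)).
  have dsk s : s0 <= s <= t -> disk (g y) rho (gam s).
    move=> /andP[s0s st]; apply/diskP; rewrite gy; apply: Heta.
      by rewrite (le_trans s00 s0s) /=; lra.
    by rewrite distrC ger0_norm ?subr_ge0 //; lra.
  have ds0 : disk (g y) rho (gam s0) by apply: dsk; rewrite lexx ltW.
  apply: (glue_lift _ (cont_upto_le t1 cg) (Lb s0 _) sec dsk).
  + by rewrite s00 ltW.
  + by rewrite s00.
  + apply: inj; [exact: sd | by apply/diskP | ].
    have [_ -> _] := sec.2 _ ds0.
    by have [|_ _ _ ->] := Lb s0; rewrite ?s00 ?lexx.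
- move=> t /andP[t0 t1] [bet Lb]; have [cb b0 bV bg] := Lb.
  have tt : 0 <= t <= t by rewrite t0 lexx.
  have [r [rho [sg [/andP[r0 _] rV inj sec sd]]]] := local_section LB (bV t tt) ltr01.
  have rho0 : 0 < rho by case: sec.
  have [|eta eta0 Heta] := cg t _ _ rho0; first by rewrite t0 ltW.
  exists eta => // s /andP[ts ste] s1.
  exists (fun u => if u <= t then bet u else sg (gam u)).
  apply: (glue_lift _ (cont_upto_le s1 cg) Lb sec).
  + by rewrite t0 ltW.
  + move=> u /andP[tu us]; apply/diskP; rewrite bg //; apply: Heta.
      by rewrite (le_trans t0 tu) /=; lra.
    by rewrite ger0_norm ?subr_ge0 //; lra.
  + by rewrite -bg //; exact: section_center inj sec sd.
Qed.

Lemma sections_agree g V w0 rho sg w1 rho1 sg1 p : locally_biholomorphic g V ->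
  is_section g V w0 rho sg -> is_section g V w1 rho1 sg1 ->
  disk w0 rho p -> disk w1 rho1 p -> sg p = sg1 p ->
  exists2 d, 0 < d & forall w, cabs (w - p) < d -> sg w = sg1 w.
Proof.
move=> LB sec sec1 p0 p1 E.
have [Vp _ _] := sec.2 _ p0.
have [r [_ [_ [/andP[r0 _] _ inj _ _]]]] := local_section LB Vp ltr01.
have [d d0 Hd] := section_cont sec p0 r0; have [d1 d10 Hd1] := section_cont sec1 p1 r0.
have /openP_disk /(_ _ p0)[q q0 Hq] := @open_disk R w0 rho.
have /openP_disk /(_ _ p1)[q1 q10 Hq1] := @open_disk R w1 rho1.
exists (Num.min (Num.min d d1) (Num.min q q1)); first by rewrite !lt_min d0 d10 q0.
move=> w; rewrite !lt_min => /andP[/andP[wd wd1] /andP[wq wq1]].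
have w0r : disk w0 rho w by apply: Hq; apply/diskP.
have w1r : disk w1 rho1 w by apply: Hq1; apply/diskP.
have [_ g1 _] := sec.2 _ w0r; have [_ g2 _] := sec1.2 _ w1r.
by apply: inj; [apply/diskP; exact: Hd | apply/diskP; rewrite E; exact: Hd1 | rewrite g1 g2].
Qed.

(** A lift of [gam] is covered by finitely many local sections; paths close to [gam]
    are lifted through the same sections, so their end points are given by the last
    of these. The parameter space [S] with the filter [F] covers homotopies and
    families of paths indexed by their end point alike. *)
Lemma tube (S : Type) (F : set_system S) (FF : Filter F) g V (H : S -> R -> C)
    (gam bet : R -> C) x : locally_biholomorphic g V ->
  is_lift g V gam x 1 bet -> cont_upto gam 1 ->
  (forall k, cont_upto (H k) 1) -> (forall k, H k 0 = gam 0) ->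
  (forall t, 0 <= t <= 1 -> forall e, 0 < e -> exists2 d, 0 < d & \forall k \near F,
     forall u, 0 <= u <= 1 -> `|u - t| < d -> cabs (H k u - gam t) < e) ->
  exists rho sg, [/\ is_section g V (gam 1) rho sg, sg (gam 1) = bet 1 &
    \forall k \near F, disk (gam 1) rho (H k 1) /\
      exists2 b, is_lift g V (H k) x 1 b & b 1 = sg (H k 1)].
Proof.
move=> LB Lb cg cH H0 J; have [cb b0 bV bg] := Lb.
pose P t := exists rho sg, [/\ is_section g V (gam t) rho sg, sg (gam t) = bet t &
    \forall k \near F, disk (gam t) rho (H k t) /\
      exists2 b, is_lift g V (H k) x t b & b t = sg (H k t)].
suff PP t : 0 <= t <= 1 -> P t by apply: PP; rewrite ler01 lexx.
move: t.
have step t : 0 <= t <= 1 -> exists2 eta, 0 < eta & forall t1 t2, 0 <= t1 <= t2 -> t2 <= 1 ->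
    `|t1 - t| < eta -> `|t2 - t| < eta -> P t1 -> P t2.
  move=> t01.
  have [r [rho [ta [/andP[r0 _] rV inj sec sd]]]] := local_section LB (bV t t01) ltr01.
  rewrite (bg t t01) in sec sd.
  have rho0 : 0 < rho by case: sec.
  have rho2 : 0 < rho / 2 by lra.
  have [e1 e10 He1] := cb t t01 _ r0.
  have [e2 e20 He2] := cg t t01 _ rho2.
  have [e3 e30 He3] := J t t01 _ rho0.
  exists (Num.min e1 (Num.min e2 e3)); first by rewrite !lt_min e10 e20.
  move=> t1 t2 /andP[t10 t12] t21; rewrite !lt_min => /and3P[a1 a2 a3] /and3P[c1 c2 c3].
  have t1i : 0 <= t1 <= 1 by rewrite t10 (le_trans t12 t21).
  have t2i : 0 <= t2 <= 1 by rewrite (le_trans t10 t12).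
  have tab u : 0 <= u <= 1 -> `|u - t| < e1 -> `|u - t| < e2 -> ta (gam u) = bet u.
    move=> u01 ue1 ue2.
    have du : disk (gam t) rho (gam u) by apply/diskP; have := He2 u u01 ue2; lra.
    apply: inj; [exact: sd | by apply/diskP; exact: He1 |].
    by have [_ -> _] := sec.2 _ du; rewrite bg.
  move=> [rho1 [sg1 [sec1 E1 N1]]].
  have dt1 : disk (gam t) rho (gam t1) by apply/diskP; have := He2 t1 t1i a2; lra.
  have rho10 : 0 < rho1 by case: sec1.
  have dd1 : disk (gam t1) rho1 (gam t1) by exact: disk_center.
  have [q q0 Hq] := sections_agree LB sec1 sec dd1 dt1 (etrans E1 (esym (tab t1 t1i a1 a2))).
  have [q1 q10 Hq1] := J t1 t1i _ q0.
  have dt2 : disk (gam t) (rho / 2) (gam t2) by apply/diskP; exact: He2.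
  have sub w : disk (gam t2) (rho / 2) w -> disk (gam t) rho w.
    move=> /diskP h; apply/diskP; move/diskP: dt2 => h2.
    by have := cabsD (w - gam t2) (gam t2 - gam t); rewrite addrA subrK; lra.
  have [q2 q20 Hq2] := J t2 t2i _ rho2.
  exists (rho / 2), ta; split.
  - by split=> // w /sub; exact: sec.2.
  - exact: tab.
  have FN : \forall k \near F, (forall u, 0 <= u <= 1 -> `|u - t| < e3 -> cabs (H k u - gam t) < rho) /\
     (forall u, 0 <= u <= 1 -> `|u - t1| < q1 -> cabs (H k u - gam t1) < q).
    by apply: filterS2 He3 Hq1 => s h1 h2; split.
  apply: filterS3 N1 FN Hq2 => s [d1 [b Lbs bE]] [h3 h1] h2.
  have t2c : `|t2 - t2| < q2 by rewrite subrr normr0.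
  have t1c : `|t1 - t1| < q1 by rewrite subrr normr0.
  split; first by apply/diskP; exact: h2.
  exists (fun u => if u <= t1 then b u else ta (H s u)).
    apply: (glue_lift _ (cont_upto_le t21 (cH s)) Lbs sec).
    + by rewrite t10.
    + move=> u /andP[u1 u2]; apply/diskP; apply: h3.
        by rewrite (le_trans t10 u1) (le_trans u2 t21).
      by move: a3 c3; rewrite !ltr_norml => /andP[? ?] /andP[? ?]; apply/andP; split; lra.
    + by rewrite bE; apply/esym/Hq/h1.
  case: leP => // h; have E : t2 = t1 by lra.
  by rewrite E bE; apply/Hq/h1.
apply: interval_induction => //.
have V0 : V (bet 0) by apply: bV; rewrite lexx ler01.
have g0 : g (bet 0) = gam 0 by apply: bg; rewrite lexx ler01.
have [r [rho [ta [/andP[r0 _] rV inj sec sd]]]] := local_section LB V0 ltr01.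
have sc := section_center r0 inj sec sd.
rewrite g0 in sec sc sd.
exists rho, ta; split=> //; apply: nearW => s.
rewrite H0; split; first by apply: disk_center; case: sec.
exists (fun=> x); last by rewrite sc.
split=> //.
+ by move=> u _ e e0; exists 1 => // v _ _; rewrite subrr cabs0.
+ by move=> u _; rewrite -b0.
+ by move=> u u0; rewrite -b0 g0 -(H0 s); congr H; lra.
Qed.

Lemma within_cont_upto gam : {within `[0%R, 1%R], continuous gam} -> cont_upto gam 1.
Proof.
move=> /subspace_continuousP H s s01 e e0.
have /H /cvgC_atP /(_ _ e0) : `[0%R, 1%R]%classic s by rewrite /= in_itv.
rewrite near_withinE => /nbhs_ballP[d d0 Hd]; exists d => // u u01 us.
by apply: Hd; rewrite /ball /= ?in_itv //= distrC.
Qed.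

Lemma within_square_cont (H : R * R -> C) :
  {within `[0%R, 1%R] `*` `[0%R, 1%R], continuous H} ->
  forall s t, 0 <= s <= 1 -> 0 <= t <= 1 -> forall e, 0 < e -> exists2 d, 0 < d &
   forall s' t', 0 <= s' <= 1 -> 0 <= t' <= 1 -> `|s' - s| < d -> `|t' - t| < d ->
     cabs (H (s', t') - H (s, t)) < e.
Proof.
move=> /subspace_continuousP cH s t s01 t01 e e0.
have /cH /cvgC_atP /(_ _ e0) : (`[0%R, 1%R]%classic `*` `[0%R, 1%R]%classic) (s, t).
  by split; rewrite /= in_itv.
rewrite near_withinE => /nbhs_ballP[d d0 Hd]; exists d => // s' t' s'01 t'01 h1 h2.
apply: Hd; first by split; rewrite /ball /= distrC.
by split; rewrite /= in_itv.
Qed.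

(** The lifts of the paths H(s, .) from one starting point end over the same point,
    and by [tube] their end point is locally constant in s. *)
Lemma monodromy g V U (al : R -> C) : locally_biholomorphic g V -> path_lifting g V U ->
  cont_upto al 1 -> (forall s, 0 <= s <= 1 -> V (al s)) ->
  null_homotopic U (fun t => g (al t)) -> al 0 = al 1.
Proof.
move=> LB PL ca aV [H [cH HU H0 H1 Hs]].
pose K s t := H (clamp s, clamp t).
have i0 : (0 : R) \in `[0%R, 1%R] by rewrite in_itv /= lexx ler01.
have i1 : (1 : R) \in `[0%R, 1%R] by rewrite in_itv /= lexx ler01.
have cc (s : R) : clamp s \in `[0%R, 1%R] by rewrite in_itv /= clamp01.
have c0 : clamp (0 : R) = 0 by apply: clamp_id; rewrite lexx ler01.
have c1 : clamp (1 : R) = 1 by apply: clamp_id; rewrite lexx ler01.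
have Kc s t e : 0 < e -> exists2 d, 0 < d & forall s' t', `|s' - s| < d -> `|t' - t| < d ->
    cabs (K s' t' - K s t) < e.
  move=> e0; have [d d0 Hd] := within_square_cont cH (clamp01 s) (clamp01 t) e0.
  exists d => // s' t' h1 h2; apply: Hd; rewrite ?clamp01 //; apply: le_lt_trans (clamp_lip _ _) _ => //.
have K0 s : K s 0 = g (al 0) by rewrite /K c0; case: (Hs _ (cc s)).
have K1 s : K s 1 = g (al 0) by rewrite /K c1; case: (Hs _ (cc s)).
have cK s : cont_upto (K s) 1.
  move=> t _ e e0; have [d d0 Hd] := Kc s t e e0; exists d => // u _ ut.
  by apply: Hd => //; rewrite subrr normr0.
have KU s t : U (K s t) by apply: HU.
have aV0 : V (al 0) by apply: aV; rewrite lexx ler01.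
have lifts s : exists b, is_lift g V (K s) (al 0) 1 b.
  by apply: (PL _ (cK s)) => //; rewrite K0.
pose Q s := forall b, is_lift g V (K s) (al 0) 1 b -> b 1 = al 1.
have one : 0 <= (1:R) <= 1 by rewrite ler01 lexx.
have loc s : exists2 d, 0 < d & forall u b c, `|u - s| < d -> is_lift g V (K s) (al 0) 1 b ->
    is_lift g V (K u) (al 0) 1 c -> b 1 = c 1.
  have [b Lb] := lifts s.
  have [||rho [sg [sec E N]]] := @tube R (nbhs s) _ g V K (K s) b (al 0) LB Lb (cK s) cK.
  - by move=> u; rewrite !K0.
  - move=> t t01 e e0; have [d d0 Hd] := Kc s t e e0; exists d => //.
    by apply/nbhs_ballP; exists d => // u; rewrite /ball /= distrC => us v _; exact: Hd.
  move: N => /nbhs_ballP[d d0 Hd]; exists d => // u b1 c us Lb1 Lc.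
  have [|_ [c' Lc' Ec']] := Hd u; first by rewrite /ball /= distrC.
  rewrite (lift_uniq LB (lexx 1) Lb1 Lb one) (lift_uniq LB (lexx 1) Lc Lc' one) Ec' K1.
  by rewrite -E K1.
have QQ s : 0 <= s <= 1 -> Q s.
  move: s; apply: interval_induction.
    move=> b Lb; apply: (lift_uniq LB (lexx 1) Lb _ one); split=> // t t01.
    rewrite /K c0 clamp_id // H0 //; by rewrite in_itv.
  move=> t _; have [d d0 Hd] := loc t; exists d => // t1 t2 _ _ h1 h2 Q1 c Lc.
  have [b Lb] := lifts t; have [b1 Lb1] := lifts t1.
  by rewrite -(Hd t2 b c) // (Hd t1 b b1) //; exact: Q1.
apply: (QQ 1 one (fun=> al 0)); split=> //.
- by move=> t _ e e0; exists 1 => // u _ _; rewrite subrr cabs0.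
- by move=> t t01; rewrite /K c1 H1.
Qed.

(** Lift [h] along the segments that issue from [x]; by [tube] the end point of the
    lift is locally a section applied to [h], hence holomorphic. *)
Lemma disk_lift g V U (h : C -> C) c r x y : locally_biholomorphic g V -> path_lifting g V U ->
  holomorphic_on (disk c r) h -> (forall z, disk c r z -> U (h z)) ->
  disk c r x -> V y -> g y = h x ->
  exists E : C -> C, [/\ holomorphic_on (disk c r) E, E x = y,
    forall z, disk c r z -> V (E z) & forall z, disk c r z -> g (E z) = h z].
Proof.
move=> LB PL hh hU xr Vy gy.
pose K z t := h (x + toC (clamp t) * (z - x)).
have c0 : clamp (0 : R) = 0 by apply: clamp_id; rewrite lexx ler01.
have c1 : clamp (1 : R) = 1 by apply: clamp_id; rewrite lexx ler01.
have one : 0 <= (1:R) <= 1 by rewrite ler01 lexx.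
have K0 z : K z 0 = h x by rewrite /K c0 toC0 mul0r addr0.
have K1 z : K z 1 = h z by rewrite /K c1 toC1 mul1r addrC subrK.
have seg z t : disk c r z -> disk c r (x + toC (clamp t) * (z - x)).
  by move=> zr; apply: disk_convex => //; exact: clamp01.
have J z t e : disk c r z -> 0 < e -> exists2 d, 0 < d & forall z' u, cabs (z' - z) < d ->
    `|u - t| < d -> cabs (K z' u - K z t) < e.
  move=> zr e0.
  have /contCCP /(_ _ e0)[d d0 Hd] := hol_cont hh (seg z t zr).
  pose L := 1 + cabs (z - x); have L0 : 0 < L by rewrite /L; have := cabs_ge0 (z - x); lra.
  exists (d / 2 / L); first by rewrite !divr_gt0.
  move=> z' u; rewrite !ltr_pdivlMr // => h1 h2; apply: Hd.
  have -> : x + toC (clamp u) * (z' - x) - (x + toC (clamp t) * (z - x)) =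
     toC (clamp u) * (z' - z) + toC (clamp u - clamp t) * (z - x) by rewrite toCB; ring.
  apply: le_lt_trans (cabsD _ _) _; rewrite !cabsM !cabs_real.
  have /andP[u0 u1] := clamp01 u; rewrite (ger0_norm u0).
  have a1 : clamp u * cabs (z' - z) <= cabs (z' - z) * L.
    have := cabs_ge0 (z' - z); have := cabs_ge0 (z - x); rewrite /L; nra.
  have a2 : `|clamp u - clamp t| * cabs (z - x) <= `|u - t| * L.
    by apply: ler_pM; rewrite ?cabs_ge0 // ?clamp_lip // /L; lra.
  lra.
have cK z : disk c r z -> cont_upto (K z) 1.
  move=> zr t _ e e0; have [d d0 Hd] := J z t e zr e0; exists d => // u _ ut.
  by apply: Hd => //; rewrite subrr cabs0.
have lifts z : disk c r z -> exists b, is_lift g V (K z) y 1 b.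
  by move=> zr; apply: (PL _ (cK z zr)) => //; [move=> s _; apply/hU/seg | rewrite K0].
have /choice[B HB] : forall z, exists b, disk c r z -> is_lift g V (K z) y 1 b.
  move=> z; have [/lifts[b]|] := pselect (disk c r z); first by exists b.
  by exists (fun=> y).
exists (fun z => B z 1); split.
- apply: cder_hol => z zr.
  pose K' z' := if pselect (disk c r z') then K z' else K z.
  have [| | |rho [sg [sec E N]]] := @tube C (nbhs z) _ g V K' (K z) (B z) y LB (HB z zr) (cK z zr).
  + by move=> s; rewrite /K'; case: pselect => ?; exact: cK.
  + by move=> s; rewrite /K'; case: pselect => ? /=; rewrite !K0.
  + move=> t t01 e e0; have [d d0 Hd] := J z t e zr e0; exists d => //.
    apply/nbhs_diskP; exists d => // z' /diskP z'z u _ ut; rewrite /K'.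
    by case: pselect => ? /=; apply: Hd => //; rewrite subrr cabs0.
  move: N => /nbhs_diskP[d d0 Hd].
  have /openP_disk /(_ _ zr)[q q0 Hq] := @open_disk R c r.
  have rho0 : 0 < rho by case: sec.
  have [_ _ [ds cds]] := sec.2 _ (disk_center (K z 1) rho0).
  rewrite K1 in cds.
  have m0 : 0 < Num.min d q by rewrite lt_min d0.
  eexists; apply: (@cder_local _ (fun z' => sg (h z')) _ _ _ _ m0).
    move=> z' /diskP; rewrite lt_min => /andP[zd zq].
    have z'r : disk c r z' by apply: Hq; apply/diskP.
    have [|_ [b Lb Eb]] := Hd z'; first by apply/diskP.
    have EK : K' z' = K z' by rewrite /K'; case: pselect.
    rewrite EK in Lb Eb.
    by rewrite -K1 -Eb; exact: (lift_uniq LB (lexx 1) Lb (HB z' z'r) one).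
  exact: (@cder_comp _ sg h _ _ _ cds (hol_cder hh zr)).
- have Lc : is_lift g V (K x) y 1 (fun=> y).
    split=> //; first by move=> t _ e e0; exists 1 => // u _ _; rewrite subrr cabs0.
    by move=> s _; rewrite /K subrr mulr0 addr0.
  exact: (lift_uniq LB (lexx 1) (HB x xr) Lc one).
- by move=> z zr; have [_ _ h3 _] := HB z zr; exact: h3.
- by move=> z zr; have [_ _ _ h4] := HB z zr; rewrite (h4 1 one) K1.
Qed.
End Lifting.

(** * Coverings, the Schwarz-Pick lemma and the hyperbolic density *)

Section Coverings.
Context {R : realType}.
Local Notation C := (Cplx R).
Implicit Types (z w : C) (r e t : R) (g p : C -> C) (U V W : set C).

Lemma path_joined_connected (A : set C) :
  (forall x y, A x -> A y -> exists gam : R -> C, [/\ cont_upto gam 1,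
     (forall s : R, 0 <= s <= 1 -> A (gam s)), gam 0 = x & gam 1 = y]) -> connected A.
Proof.
move=> H B [x Bx] [D oD BD] [E cE BE].
have BA : B `<=` A by rewrite BD => z [].
apply/seteqP; split=> // y Ay.
have [gam [cg gA g0 g1]] := H x y (BA _ Bx) Ay.
suff P s : 0 <= s <= 1 -> B (gam s) by rewrite -g1; apply: P; rewrite ler01 lexx.
move: s; apply: real_induction; first by rewrite g0.
- move=> t /andP[t0 t1] IH; have t01 : 0 <= t <= 1 by rewrite ltW.
  rewrite BE; split; first exact: gA.
  apply: contrapT => nE.
  have oE : open (~` E) by rewrite openC.
  have [r r0 Hr] := (openP_disk (~` E)).1 oE _ nE.
  have [d d0 Hd] := cg t t01 r r0.
  pose v := Num.max 0 (t - d / 2).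
  have v0 : 0 <= v by rewrite /v le_max lexx.
  have vt : v < t by rewrite /v gt_max t0; lra.
  have vd : t - d / 2 <= v by rewrite /v le_max lexx orbT.
  have v01 : 0 <= v <= 1 by rewrite v0 /=; lra.
  have /(Hr _) : disk (gam t) r (gam v).
    by apply/diskP/Hd => //; rewrite distrC gtr0_norm ?subr_gt0 //; lra.
  apply; have : B (gam v) by apply: IH; rewrite v0.
  by rewrite BE => -[].
- move=> t /andP[t0 t1] Bt; have t01 : 0 <= t <= 1 by rewrite t0 ltW.
  have Dt : D (gam t) by move: Bt; rewrite BD => -[].
  have [r r0 Hr] := (openP_disk D).1 oD _ Dt.
  have [d d0 Hd] := cg t t01 r r0; exists d => // s /andP[ts sd] s1.
  have s01 : 0 <= s <= 1 by rewrite s1 andbT; lra.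
  rewrite BD; split; first exact: gA.
  by apply/Hr/diskP/Hd => //; rewrite gtr0_norm ?subr_gt0 //; lra.
Qed.

Lemma segment_cont (a b : C) t : cont_upto (fun s => a + toC s * (b - a)) t.
Proof.
move=> s _ e e0; pose L := 1 + cabs (b - a).
have L0 : 0 < L by rewrite /L; have := cabs_ge0 (b - a); lra.
exists (e / L); first by rewrite divr_gt0.
move=> u _; rewrite ltr_pdivlMr // => us.
rewrite (_ : _ - _ = toC (u - s) * (b - a)); last by rewrite toCB; ring.
rewrite cabsM cabs_real; apply: le_lt_trans us; apply: ler_wpM2l => //.
by rewrite /L; lra.
Qed.

Lemma convex_connected (A : set C) :
  (forall x y (t : R), A x -> A y -> 0 <= t <= 1 -> A (x + toC t * (y - x))) -> connected A.
Proof.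
move=> H; apply: path_joined_connected => x y Ax Ay.
exists (fun s => x + toC s * (y - x)); split.
- exact: segment_cont.
- by move=> s s01; exact: H.
- by rewrite toC0 mul0r addr0.
- by rewrite toC1 mul1r addrC subrK.
Qed.

Lemma connected_disk z r : connected (disk z r).
Proof. by apply: convex_connected => x y t xr yr t01; exact: disk_convex. Qed.

Lemma open_component (A : set C) x : open A -> open (connected_component A x).
Proof.
move=> /openP_disk oA; apply/openP_disk => y Cy.
have [r r0 Hr] := oA y (connected_component_sub Cy); exists r => //.
rewrite (same_connected_component Cy); apply: connected_component_max => //.
  exact: disk_center.
exact: connected_disk.
Qed.

Lemma component_subset (A B : set C) x : A `<=` B ->
  connected_component A x `<=` connected_component B x.
Proof.
move=> AB; have [Ax|nA] := pselect (A x); last by rewrite connected_component_out.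
apply: connected_component_max; first exact: connected_component_refl.
  by move=> y /connected_component_sub /AB.
exact: component_connected.
Qed.

Lemma component_disk z r x : disk z r x -> connected_component (disk z r) x = disk z r.
Proof. by move=> xr; apply: connected_component_id => //; exact: connected_disk. Qed.

Lemma within_cont_eps (A : set C) g : {within A, continuous g} <->
  forall z, A z -> forall e, 0 < e -> exists2 d, 0 < d & forall w, A w -> cabs (w - z) < d ->
    cabs (g w - g z) < e.
Proof.
split.
  move=> /subspace_continuousP H z Az e e0.
  have /H /cvgC_atP /(_ _ e0) := Az.
  rewrite near_withinE => /nbhs_diskP[d d0 Hd]; exists d => // w Aw wz.
  by apply: Hd => //; apply/diskP.
move=> H; apply/subspace_continuousP => z Az; apply/cvgC_atP => e e0.
have [d d0 Hd] := H z Az e e0.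
by rewrite near_withinE; apply/nbhs_diskP; exists d => // w /diskP wz Aw; exact: Hd.
Qed.

Lemma homeo_inverse h k (A B : set C) : homeo h k A B ->
  [/\ (forall a, A a -> B (h a) /\ k (h a) = a) & (forall b, B b -> A (k b) /\ h (k b) = b)].
Proof.
move=> [_ _ hA kB c]; split.
  by move=> a Aa; split; [rewrite -hA; exists a | apply: c; rewrite inE].
move=> b; rewrite -hA => -[a Aa <-]; rewrite c ?inE //.
Qed.

(** The inverse homeomorphism of a sheet coincides near every point with the local
    holomorphic inverse of [g]. *)
Lemma sheet_section g k V A W w rho : open V -> holomorphic_on V g -> A `<=` V -> open A ->
  homeo g k A W -> 0 < rho -> disk w rho `<=` W ->
  locally_biholomorphic g V -> is_section g V w rho k.
Proof.
move=> oV hg AV oA hk rho0 wW LB; split=> // v /wW Wv.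
have [k1 k2] := homeo_inverse hk.
have [Akv gkv] := k2 v Wv.
split=> //; first exact: AV.
have /openP_disk /(_ _ Akv)[r r0 Hr] := oA.
have [s [rho1 [sg [/andP[s0 sr] _ inj sec sd]]]] := local_section LB (AV _ Akv) r0.
rewrite gkv in sec sd.
have [rho10 Hs] := sec.
have vd := disk_center v rho10.
have [_ _ [d cd]] := Hs v vd; exists d.
apply: (cder_local rho10 _ cd) => u ur.
have Au : A (sg u).
  by apply: Hr; move/diskP: (sd _ ur) => ?; apply/diskP; lra.
have [_ gsu _] := Hs u ur; have [_ kgu] := k1 _ Au.
by rewrite -kgu gsu.
Qed.

(** On a sheet [g] is injective, hence its derivative does not vanish. *)
Lemma covering_biholomorphic g V B : open V -> holomorphic_covering g V B ->
  locally_biholomorphic g V.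
Proof.
move=> oV [hg gV loc]; split=> // z Vz.
have Bz : B (g z) by rewrite -gV; exists z.
have [W [F [[oW Wg WB] HF _ cF]]] := loc _ Bz.
have : (V `&` g @^-1` W) z by [].
rewrite -cF => -[A FA Az]; have [oA [k hk]] := HF A FA.
have AV : A `<=` V by move=> a Aa; have : (\bigcup_(A in F) A) a by [exists A]; rewrite cF => -[].
apply: (injective_derive_neq0 oA (hol_sub AV hg) Az) => x y Ax Ay E.
have [k1 _] := homeo_inverse hk.
by have [_ <-] := k1 x Ax; have [_ <-] := k1 y Ay; rewrite E.
Qed.

(** A partial lift enters one sheet over an evenly covered neighbourhood of the end
    point of the path, and continues through the section of that sheet. *)
Lemma covering_path_lifting g V B : open V -> holomorphic_covering g V B -> path_lifting g V B.
Proof.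
move=> oV cov; have LB := covering_biholomorphic oV cov.
apply: (path_lifting_cluster LB) => gam x t bet cg gB /andP[t0 t1] Lb.
have [hg gV loc] := cov.
have t01 : 0 <= t <= 1 by rewrite ltW.
have [W [F [[oW Wg WB] HF _ cF]]] := loc _ (gB t t01).
have /openP_disk /(_ _ Wg)[rho rho0 Hrho] := oW.
have [eta eta0 Heta] := cg t t01 _ rho0.
pose v := Num.max 0 (t - eta / 2).
have v0 : 0 <= v by rewrite /v le_max lexx.
have vt : v < t by rewrite /v gt_max t0; lra.
have vd : t - eta / 2 <= v by rewrite /v le_max lexx orbT.
have dsk s : v <= s <= t -> disk (gam t) rho (gam s).
  move=> /andP[vs st]; apply/diskP/Heta; first by apply/andP; split; lra.
  by rewrite distrC ger0_norm ?subr_ge0 //; lra.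
have vi : 0 <= v < t by rewrite v0.
have vv : 0 <= v <= v by rewrite v0 lexx.
have [_ _ bV bg] := Lb v vi.
have : (V `&` g @^-1` W) (bet v).
  split; first exact: bV.
  by rewrite /preimage /= bg //; apply/Hrho/dsk; rewrite lexx ltW.
rewrite -cF => -[A FA Az]; have [oA [k hk]] := HF A FA.
have AV : A `<=` V by move=> a Aa; have : (\bigcup_(A in F) A) a by [exists A]; rewrite cF => -[].
have sec := sheet_section oV hg AV oA hk rho0 Hrho LB.
have kv : k (gam v) = bet v by have [k1 _] := homeo_inverse hk; rewrite -bg //; case: (k1 _ Az).
have v_le : 0 <= v <= t by rewrite v0 ltW.
have := glue_lift v_le (cont_upto_le t1 cg) (Lb v vi) sec dsk kv.
set b := (fun u => _) => Lb'.
have tt : 0 <= t <= t by rewrite lexx ltW.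
exists (b t); have [cb _ bV' bg'] := Lb'; split; [exact: bV' | exact: bg' |].
move=> e d e0 d0; have [d' d'0 Hd'] := cb t tt e e0.
pose u := Num.max 0 (t - Num.min d d' / 2).
have m0 : 0 < Num.min d d' by rewrite lt_min d0.
have u0 : 0 <= u by rewrite /u le_max lexx.
have ut : u < t by rewrite /u gt_max t0; lra.
have ud : t - Num.min d d' / 2 <= u by rewrite /u le_max lexx orbT.
have md : Num.min d d' <= d by rewrite ge_min lexx.
have md' : Num.min d d' <= d' by rewrite ge_min lexx orbT.
exists u; split; [by rewrite u0 | lra |].
have uu : 0 <= u <= u by rewrite u0 lexx.
have u_lt : 0 <= u < t by rewrite u0.
have ut1 : u <= 1 by lra.
have -> : bet u = b u.
  exact: (lift_uniq LB ut1 (Lb u u_lt) (is_lift_le (ltW ut) Lb') uu).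
apply: Hd'; first by rewrite u0 ltW.
by rewrite distrC gtr0_norm ?subr_gt0 //; lra.
Qed.

Definition cconj (b : C) : C := (complex.Re b -i* complex.Im b)%C.

(** The automorphism of the unit disk that sends [b] to 0. *)
Definition blaschke (b z : C) : C := (z - b) / (1 - cconj b * z).

Lemma cconj_mul (b : C) : cconj b * b = toC (cabs b ^+ 2).
Proof.
rewrite cabs_sqr /cconj /toC; case: b => x y /=.
by apply/eqP; rewrite eq_complex /=; apply/andP; split; apply/eqP; ring.
Qed.

Lemma cabs_cconj (b : C) : cabs (cconj b) = cabs b.
Proof.
apply/eqP; rewrite -(@eqrXn2 _ 2) ?cabs_ge0 // !cabs_sqr /cconj /=; case: b => x y /=.
by rewrite sqrrN.
Qed.

Lemma blaschke_den (b z : C) : cabs b < 1 -> cabs z < 1 -> 1 - cconj b * z != 0.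
Proof.
move=> b1 z1; rewrite -cabs_gt0; have := cabs_triangle_sub 1 (cconj b * z).
rewrite cabs1 cabsM cabs_cconj; have := cabs_ge0 b; have := cabs_ge0 z => h1 h2 h3.
apply: lt_le_trans h3; rewrite subr_gt0.
by apply: le_lt_trans z1; rewrite ler_piMl // ltW.
Qed.

Lemma blaschke_disk (b z : C) : cabs b < 1 -> cabs z < 1 -> cabs (blaschke b z) < 1.
Proof.
move=> b1 z1; have d0 := blaschke_den b1 z1.
rewrite /blaschke cabsM cabsV ltr_pdivrMr ?cabs_gt0 // mul1r.
rewrite -(@ltr_pXn2r _ 2) ?nnegrE ?cabs_ge0 //.
rewrite -subr_gt0.
have -> : cabs (1 - cconj b * z) ^+ 2 - cabs (z - b) ^+ 2 = (1 - cabs b ^+ 2) * (1 - cabs z ^+ 2).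
  rewrite !cabs_sqr /cconj; case: (b) (z) => x y [u v] /=; ring.
by rewrite mulr_gt0 // subr_gt0 expr_lt1 ?cabs_ge0.
Qed.

Lemma blaschke_der (b z : C) : cabs b < 1 -> cabs z < 1 ->
  cder (blaschke b) z (toC (1 - cabs b ^+ 2) / (1 - cconj b * z) ^+ 2).
Proof.
move=> b1 z1; have d0 := blaschke_den b1 z1.
have H1 : cder (fun z => 1 - cconj b * z) z (0 - cconj b * 1).
  exact: cderB (cder_cst 1 z) (cderZ (cconj b) (cder_id z)).
have H2 := @cderV _ (fun z => 1 - cconj b * z) _ _ d0 H1.
have H3 : cder (fun z => z - b) z (1 - 0) := cderB (cder_id z) (cder_cst b z).
apply: cder_eq (cderM H3 H2) _.
rewrite toCB toC1 -cconj_mul; field => //.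
Qed.

(** Cauchy's estimate on circles of radius tending to 1. *)
Lemma schwarz_origin g : holomorphic_on (disk 0 1) g ->
  (forall z, disk 0 1 z -> cabs (g z) <= 1) -> cabs (derive1 g 0) <= 1.
Proof.
move=> hg g1; apply/ler_addgt0Pr => e e0.
have [dg [Hdg Edg Hc]] : exists dg : C -> C, [/\ forall x, disk 0 1 x -> cder g x (dg x),
    derive1 g = dg & forall x, disk 0 1 x -> {for x, continuous dg}].
  exists (derive1 g); split; [exact: hol_cder hg | by [] |].
  exact (hol_cont (hol_derive (@open_disk _ 0 1) hg)).
rewrite Edg.
pose r := (1 + e)^-1.
have re : 0 < 1 + e by lra.
have r0 : 0 < r by rewrite /r invr_gt0.
have r1 : r < 1 by rewrite /r invf_lt1 //; lra.
have -> : 1 + e = 1 / r by rewrite /r invrK mul1r.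
apply: (@cauchy_estimate _ g dg 0 1 r 1 _ Hdg Hc); first by rewrite r0.
by move=> w; rewrite subr0 => wr; apply: g1; apply/diskP; rewrite subr0 wr.
Qed.

(** Conjugating by disk automorphisms moves [x] and its image to the origin. *)
Lemma schwarz_pick g x : holomorphic_on (disk 0 1) g ->
  (forall z, disk 0 1 z -> disk 0 1 (g z)) -> disk 0 1 x ->
  (1 - cabs x ^+ 2) * cabs (derive1 g x) <= 1 - cabs (g x) ^+ 2.
Proof.
move=> hg gD x1.
have D z : disk (0 : C) 1 z <-> cabs z < 1 by rewrite diskP subr0.
have x1' : cabs x < 1 by apply/D.
have nx1 : cabs (- x) < 1 by rewrite cabsN.
have y1 : cabs (g x) < 1 by apply/D/gD.
have [d Hd] : exists d, d = derive1 g x by exists (derive1 g x).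
have cg : cder g x d by rewrite Hd; exact: hol_cder hg _ x1.
rewrite -Hd.
have hB (b : C) : cabs b < 1 -> holomorphic_on (disk 0 1) (blaschke b).
  by move=> b1; apply: cder_hol => z /D z1; eexists; exact: blaschke_der.
pose F z := blaschke (g x) (g (blaschke (- x) z)).
have dB z : disk (0 : C) 1 z -> disk 0 1 (blaschke (- x) z).
  by move=> /D z1; apply/D; exact: blaschke_disk.
have hF : holomorphic_on (disk 0 1) F.
  apply: (@hol_comp _ _ (disk 0 1) (blaschke (g x))); first exact: hB.
    exact (hol_comp hg (hB _ nx1) dB).
  by move=> z z1; apply: gD; exact: dB.
have F1 z : disk 0 1 z -> cabs (F z) <= 1.
  by move=> z1; apply/ltW/blaschke_disk => //; apply/D/gD/dB.
have B0 : blaschke (- x) 0 = x by rewrite /blaschke mulr0 subr0 divr1 opprK add0r.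
have z01 : cabs (0 : C) < 1 by rewrite cabs0.
have c1 := blaschke_der nx1 z01.
have c2 := blaschke_der y1 y1.
have := schwarz_origin hF F1.
have cF : cder F 0 (toC (1 - cabs (g x) ^+ 2) / (1 - cconj (g x) * g x) ^+ 2 *
    (d * (toC (1 - cabs (- x) ^+ 2) / (1 - cconj (- x) * 0) ^+ 2))).
  apply: (@cder_comp _ (blaschke (g x)) (fun z => g (blaschke (- x) z))); first by rewrite B0.
  by apply: (@cder_comp _ g (blaschke (- x))); rewrite ?B0.
rewrite (cder_derive1 cF) mulr0 subr0 expr1n divr1 cabsN cconj_mul.
have gp : 0 < 1 - cabs (g x) ^+ 2 by rewrite subr_gt0 expr_lt1 ?cabs_ge0.
have xp : 0 < 1 - cabs x ^+ 2 by rewrite subr_gt0 expr_lt1 ?cabs_ge0.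
rewrite -toC1 -toCB !(cabsM, cabsV, cabsX, cabs_real) (ger0_norm (ltW gp)) (ger0_norm (ltW xp)).
have -> : (1 - cabs (g x) ^+ 2) / (1 - cabs (g x) ^+ 2) ^+ 2 = (1 - cabs (g x) ^+ 2)^-1.
  by field; rewrite gt_eqF.
by rewrite mulrC ler_pdivrMr // mul1r mulrC.
Qed.

Lemma cover_derive_neq0 (Om : set C) z p x : universal_cover_at Om z p -> disk 0 1 x ->
  0 < (1 - cabs x ^+ 2) * cabs (derive1 p x).
Proof.
move=> cov x1; have [_ _ dn] := covering_biholomorphic (@open_disk _ 0 1) cov.
apply: mulr_gt0; last by rewrite cabs_gt0; exact: dn.
by rewrite subr_gt0 expr_lt1 ?cabs_ge0 //; move/diskP: x1; rewrite subr0.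
Qed.

Lemma hyp_density_ge0 (Om : set C) z : (0 <= hyp_density Om z)%E.
Proof.
apply: le_ereal_inf_tmp => _ [p [x [cov x1 _ ->]]]; rewrite lee_fin divr_ge0 //.
by rewrite ltW // (cover_derive_neq0 cov x1).
Qed.

Lemma density_quotient_le (a b c d : R) : 0 < c * (a * b) -> 0 < d * a -> c * b <= d -> 0 <= a ->
  ((2 / (d * a))%:E <= (2 / (c * (a * b)))%:E)%E.
Proof.
move=> hlow hup h a0; rewrite lee_fin; apply: ler_wpM2l => //; rewrite lef_pV2 ?posrE //.
by rewrite mulrCA mulrC; apply: ler_wpM2r.
Qed.

(** A covering of [W] by the disk lifts to a self-map E of the disk through a covering
    of [Om], and the Schwarz-Pick lemma for E compares the densities. *)
Lemma hyp_density_anti (W Om : set C) z : W `<=` Om -> carries_hyperbolic_metric Om -> W z ->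
  (hyp_density Om z <= hyp_density W z)%E.
Proof.
move=> WO cO Wz; apply: le_ereal_inf_tmp => _ [p [x [cov x1 px ->]]].
have [q covq] := cO z (WO z Wz).
have oD := @open_disk R 0 1.
have LB := covering_biholomorphic oD covq.
have PL := covering_path_lifting oD covq.
have [hp pV _] := cov; have [hq qV _] := covq.
have [y y1 qy] : exists2 y, disk 0 1 y & q y = z.
  have : connected_component Om z z by apply: connected_component_refl; exact: WO.
  by rewrite -qV => -[y y1 qy]; exists y.
have pU u : disk 0 1 u -> connected_component Om z (p u).
  by move=> u1; apply: (component_subset WO); rewrite -pV; exists u.
have [E [hE Ex EV qE]] := disk_lift LB PL hp pU x1 y1 (etrans qy (esym px)).
apply: ge_ereal_inf; eexists; first by exists q, y; split; [exact: covq | exact: y1 | exact: qy |].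
have hlow := cover_derive_neq0 cov x1; have hup := cover_derive_neq0 covq y1.
have dp : derive1 p x = derive1 q y * derive1 E x.
  rewrite (@derive1_local _ p (fun u => q (E u)) 0 1) //; last by move=> u /qE ->.
  apply: cder_derive1; apply: (@cder_comp _ q E); last exact: hol_cder hE _ x1.
  by rewrite Ex; exact: hol_cder hq _ y1.
have SP := schwarz_pick hE EV x1.
rewrite Ex in SP; rewrite dp cabsM in hlow *.
exact (density_quotient_le hlow hup SP (cabs_ge0 _)).
Qed.

Lemma hyp_density_unit_disk z : disk 0 1 z -> (2%:E <= hyp_density (disk 0 1) z)%E.
Proof.
move=> z1; apply: le_ereal_inf_tmp => _ [p [x [cov x1 px ->]]].
have h := cover_derive_neq0 cov x1.
rewrite /universal_cover_at (component_disk z1) in cov; have [hp pV _] := cov.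
have pU u : disk 0 1 u -> disk 0 1 (p u) by move=> u1; rewrite -[X in X (p u)]pV; exists u.
have := schwarz_pick hp pU x1.
move: h (sqr_ge0 (cabs (p x))); move: ((1 - cabs x ^+ 2) * cabs (derive1 p x)) => a a0 b0 ab.
by rewrite lee_fin ler_pdivlMr //; lra.
Qed.

Lemma affine_cover (c : C) r : 0 < r ->
  holomorphic_covering (fun z => c + toC r * z) (disk 0 1) (disk c r).
Proof.
move=> r0.
have rC : toC r != 0 :> C by rewrite -toC0 (inj_eq toC_inj) gt_eqF.
have cd z : cder (fun z => c + toC r * z) z (toC r).
  by apply: cder_eq (cderD (cder_cst c z) (cderZ (toC r) (cder_id z))) _; rewrite add0r mulr1.
have cdi z : cder (fun w => (toC r)^-1 * (w - c)) z (toC r)^-1.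
  by apply: cder_eq (cderZ (toC r)^-1 (cderB (cder_id z) (cder_cst c z))) _; rewrite subr0 mulr1.
have i1 z : disk (0 : C) 1 z -> disk c r (c + toC r * z).
  move=> /diskP; rewrite subr0 => z1; apply/diskP; rewrite addrC addKr cabsM cabs_real gtr0_norm //.
  by rewrite -[ltRHS]mulr1 ltr_pM2l.
have i2 w : disk c r w -> disk (0 : C) 1 ((toC r)^-1 * (w - c)).
  move=> /diskP wr; apply/diskP; rewrite subr0 cabsM cabsV cabs_real gtr0_norm //.
  by rewrite ltr_pdivrMl // mulr1.
have e1 w : c + toC r * ((toC r)^-1 * (w - c)) = w by field.
have e2 z : (toC r)^-1 * (c + toC r * z - c) = z by field.
have im : (fun z => c + toC r * z) @` disk 0 1 = disk c r.
  apply/seteqP; split=> [_ [z z1 <-]|w wr]; first exact: i1.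
  by exists ((toC r)^-1 * (w - c)); [exact: i2 | exact: e1].
split; [by apply: cder_hol => z _; exists (toC r) | exact: im |].
move=> w wr; exists (disk c r), [set disk 0 1]; split.
- by split=> //; exact: open_disk.
- move=> _ ->; split; first exact: open_disk.
  exists (fun w => (toC r)^-1 * (w - c)); split.
  + by apply: continuous_subspaceT => z; have := cder_cont (cd z).
  + by apply: continuous_subspaceT => z; have := cder_cont (cdi z).
  + exact: im.
  + apply/seteqP; split=> [_ [u ur <-]|z z1]; first exact: i2.
    by exists (c + toC r * z); [exact: i1 | exact: e2].
  + by move=> z _; exact: e2.
- by move=> A B /= -> ->.
- by rewrite bigcup_set1; apply/seteqP; split=> [z z1|z []//]; split => //; exact: i1.
Qed.

(** The affine covering has density 2 r / (r^2 - |z - c|^2), which is at most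
    8 / (3 r) on the concentric disk of half the radius. *)
Lemma hyp_density_disk_le (c : C) r z : 0 < r -> cabs (z - c) <= r / 2 ->
  (hyp_density (disk c r) z <= (8 / (3 * r))%:E)%E.
Proof.
move=> r0 zr.
have rC : toC r != 0 :> C by rewrite -toC0 (inj_eq toC_inj) gt_eqF.
have zd : disk c r z by apply/diskP; lra.
pose x := (toC r)^-1 * (z - c).
have cx : cabs x = cabs (z - c) / r by rewrite cabsM cabsV cabs_real gtr0_norm // mulrC.
have cx2 : cabs x <= 1 / 2 by rewrite cx ler_pdivrMr //; lra.
have cd : cder (fun z => c + toC r * z) x (toC r).
  by apply: cder_eq (cderD (cder_cst c x) (cderZ (toC r) (cder_id x))) _; rewrite add0r mulr1.
apply: ge_ereal_inf; eexists.
  exists (fun z => c + toC r * z), x; split.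
  - by rewrite /universal_cover_at (component_disk zd); exact: affine_cover.
  - by apply/diskP; rewrite subr0; lra.
  - by rewrite /x; field.
  - by [].
rewrite (cder_derive1 cd) cabs_real gtr0_norm // lee_fin.
have x0 := cabs_ge0 x.
have h : 3 / 4 <= 1 - cabs x ^+ 2 by nra.
have -> : 8 / (3 * r) = 2 / (3 / 4 * r) by field; rewrite gt_eqF.
apply: ler_wpM2l => //; rewrite lef_pV2 ?posrE ?mulr_gt0 //; last by lra.
by apply: ler_wpM2r => //; exact: ltW.
Qed.
End Coverings.

(** * Hyperbolic distance and diameter *)

Section Distance.
Context {R : realType}.
Local Notation C := (Cplx R).
Implicit Types (z w : C) (r e t : R) (Om U V W A B : set C).

Lemma le_integral_nonneg (f1 f2 : R -> \bar R) (D : set R) :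
  (forall x, D x -> (0 <= f1 x)%E) -> (forall x, D x -> (f1 x <= f2 x)%E) ->
  (\int[lebesgue_measure]_(x in D) f1 x <= \int[lebesgue_measure]_(x in D) f2 x)%E.
Proof.
move=> f10 f12; rewrite !ge0_integralE //; last by move=> x Dx; exact: le_trans (f10 x Dx) (f12 x Dx).
apply: ge_ereal_sup => _ [h hf1 <-]; apply: ereal_sup_ubound; exists h => // x.
apply: le_trans (hf1 x) _; rewrite /patch; case: ifPn => // xD; apply: f12.
by rewrite inE in xD.
Qed.

Lemma speed_ge0 (g : R -> C) t : 0 <= speed g t.
Proof. exact: sqrtr_ge0. Qed.

Lemma mem_itv01 t : `[0%R, 1%R]%classic t <-> 0 <= t <= 1.
Proof. by rewrite /= in_itv. Qed.

Lemma arc_length_ge0 Om (g : R -> C) : (0 <= arc_length Om g)%E.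
Proof.
apply: integral_ge0 => t _; apply: mule_ge0; first exact: hyp_density_ge0.
by rewrite lee_fin speed_ge0.
Qed.

Lemma arc_length_anti W Om (g : R -> C) : W `<=` Om -> carries_hyperbolic_metric Om ->
  (forall t, t \in `[0, 1] -> W (g t)) -> (arc_length Om g <= arc_length W g)%E.
Proof.
move=> WO cO gW; apply: le_integral_nonneg => t t01.
  by apply: mule_ge0; [exact: hyp_density_ge0 | rewrite lee_fin speed_ge0].
apply: lee_wpmul2r; first by rewrite lee_fin speed_ge0.
by apply: hyp_density_anti => //; exact: gW.
Qed.

Lemma sum_arc_ge0 Om (s : seq (R -> C)) : (0 <= \sum_(g <- s) arc_length Om g)%E.
Proof. by apply: sume_ge0 => g _; exact: arc_length_ge0. Qed.

Lemma hyp_dist_ge0 Om z w : (0 <= hyp_dist Om z w)%E.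
Proof. by apply: le_ereal_inf_tmp => _ [s _ <-]; exact: sum_arc_ge0. Qed.

Lemma piecewise_C1_subset W Om s z w : W `<=` Om -> piecewise_C1 W z s w -> piecewise_C1 Om z s w.
Proof.
move=> WO; elim: s z => [//|g s IH] z /= [cg gW g0 /IH ps].
by split=> // t t01; apply/WO/gW.
Qed.

Lemma piecewise_C1_cat Om s1 s2 x y z : piecewise_C1 Om x s1 y -> piecewise_C1 Om y s2 z ->
  piecewise_C1 Om x (s1 ++ s2) z.
Proof.
elim: s1 x => [|g s IH] x /=; first by move=> ->.
by move=> [cg gW g0 ps] p2; split=> //; exact: IH.
Qed.

Lemma sum_arc_anti W Om s z w : W `<=` Om -> carries_hyperbolic_metric Om ->
  piecewise_C1 W z s w ->
  (\sum_(g <- s) arc_length Om g <= \sum_(g <- s) arc_length W g)%E.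
Proof.
move=> WO cO; elim: s z => [|g s IH] z /=; first by rewrite !big_nil.
move=> [cg gW g0 /IH ps]; rewrite !big_cons; apply: leeD => //.
exact: arc_length_anti.
Qed.

Lemma hyp_dist_anti W Om z w : W `<=` Om -> carries_hyperbolic_metric Om ->
  (hyp_dist Om z w <= hyp_dist W z w)%E.
Proof.
move=> WO cO; apply: le_ereal_inf_tmp => _ [s ps <-]; apply: ge_ereal_inf.
exists (\sum_(g <- s) arc_length Om g)%E; last exact: sum_arc_anti ps.
by exists s => //; exact: piecewise_C1_subset ps.
Qed.

Lemma hyp_dist_triangle Om x y z (a b : R) :
  (hyp_dist Om x y <= a%:E)%E -> (hyp_dist Om y z <= b%:E)%E ->
  (hyp_dist Om x z <= (a + b)%:E)%E.
Proof.
move=> ha hb.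
have F u v c : (hyp_dist Om u v <= c%:E)%E -> hyp_dist Om u v \is a fin_num.
  by move=> h; rewrite ge0_fin_numE ?hyp_dist_ge0 //; exact: le_lt_trans h (ltry _).
apply/lee_addgt0Pr => e e0; have e2 : 0 < e / 2 by lra.
have [_ [s1 p1 <-] h1] := lb_ereal_inf_adherent e2 (F _ _ _ ha).
have [_ [s2 p2 <-] h2] := lb_ereal_inf_adherent e2 (F _ _ _ hb).
apply: ge_ereal_inf; exists (\sum_(g <- s1 ++ s2) arc_length Om g)%E.
  by exists (s1 ++ s2) => //; exact: piecewise_C1_cat p1 p2.
rewrite big_cat /=.
have -> : ((a + b)%:E + e%:E = (a%:E + (e / 2)%:E) + (b%:E + (e / 2)%:E))%E.
  by rewrite -!EFinD; congr (_%:E); field.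
apply: leeD.
  by apply: le_trans (ltW h1) _; apply: leeD2r.
by apply: le_trans (ltW h2) _; apply: leeD2r.
Qed.

Lemma hyp_diam_le Om A (c : R) :
  (hyp_diam Om A <= c%:E)%E <-> forall x y, A x -> A y -> (hyp_dist Om x y <= c%:E)%E.
Proof.
split=> [h x y Ax Ay|H].
  by apply: le_trans h; apply: ereal_sup_ubound; exists (x, y).
by apply: ge_ereal_sup => _ [[x y] [/= Ax Ay] <-]; exact: H.
Qed.

Lemma hyp_diam_union Om A B p (a b : R) : A p -> B p ->
  (hyp_diam Om A <= a%:E)%E -> (hyp_diam Om B <= b%:E)%E ->
  (hyp_diam Om (A `|` B) <= (a + b)%:E)%E.
Proof.
move=> Ap Bp /hyp_diam_le hA /hyp_diam_le hB.
have a0 : 0 <= a by rewrite -lee_fin; apply: le_trans (hA p p Ap Ap); exact: hyp_dist_ge0.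
have b0 : 0 <= b by rewrite -lee_fin; apply: le_trans (hB p p Bp Bp); exact: hyp_dist_ge0.
apply/hyp_diam_le => x y [Ax|Bx] [Ay|By].
- by apply: le_trans (hA _ _ Ax Ay) _; rewrite lee_fin; lra.
- exact: hyp_dist_triangle (hA _ _ Ax Ap) (hB _ _ Bp By).
- by rewrite addrC; exact: hyp_dist_triangle (hB _ _ Bx Bp) (hA _ _ Ap Ay).
- by apply: le_trans (hB _ _ Bx By) _; rewrite lee_fin; lra.
Qed.

Lemma hyp_diam_anti W Om A (c : R) : W `<=` Om -> carries_hyperbolic_metric Om ->
  (hyp_diam W A <= c%:E)%E -> (hyp_diam Om A <= c%:E)%E.
Proof.
move=> WO cO /hyp_diam_le h; apply/hyp_diam_le => x y Ax Ay.
exact: le_trans (hyp_dist_anti _ _ WO cO) (h x y Ax Ay).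
Qed.

Lemma hyp_diam_sub Om A B (c : R) : A `<=` B -> (hyp_diam Om B <= c%:E)%E ->
  (hyp_diam Om A <= c%:E)%E.
Proof. by move=> AB /hyp_diam_le h; apply/hyp_diam_le => x y /AB ? /AB ?; exact: h. Qed.

Lemma derive_affineR (a b t : R) : is_derive t (1:R) (fun s : R => a + s * b) b.
Proof.
have := is_deriveD (is_derive_cst a t (1:R)) (is_deriveM (is_derive_id t (1:R)) (is_derive_cst b t (1:R))).
move=> K; apply: (is_derive_eq (K : is_derive t (1:R) (fun s : R => a + s * b) _)).
by rewrite /GRing.scale /= mulr0 mulr1 !add0r.
Qed.

Lemma segment_reim (u v : C) :
  re_part (fun t => u + toC t * (v - u)) = (fun t => complex.Re u + t * complex.Re (v - u)) /\
  im_part (fun t => u + toC t * (v - u)) = (fun t => complex.Im u + t * complex.Im (v - u)).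
Proof.
by split; apply/funext => t; rewrite /re_part /im_part /toC; case: (u) (v) => a b [c d] /=; ring.
Qed.

Lemma segment_C1 (u v : C) : C1 (fun t => u + toC t * (v - u)).
Proof.
have K (a b : R) : (forall t : R, derivable (fun t => a + t * b) t 1) /\
    continuous (derive1 (fun t : R => a + t * b)).
  split=> [t|]; first by case: (derive_affineR a b t).
  have -> : derive1 (fun t : R => a + t * b) = cst b.
    by apply/funext => t; rewrite derive1E; case: (derive_affineR a b t).
  by move=> t; exact: cvg_cst.
have [e1 e2] := segment_reim u v.
by move=> h [->|->]; rewrite ?e1 ?e2; exact: K.
Qed.

Lemma segment_speed (u v : C) t : speed (fun t => u + toC t * (v - u)) t = cabs (v - u).
Proof.
rewrite /speed; have [-> ->] := segment_reim u v.
have E (a b : R) : derive1 (fun t : R => a + t * b) t = b.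
  by rewrite derive1E; case: (derive_affineR a b t).
by rewrite !E -cabs_sqr sqrtr_sqr ger0_norm ?cabs_ge0.
Qed.

Lemma hyp_dist_segment Om (u v : C) (K : R) : 0 <= K ->
  (forall t, 0 <= t <= 1 -> Om (u + toC t * (v - u)) /\
     (hyp_density Om (u + toC t * (v - u)) <= K%:E)%E) ->
  (hyp_dist Om u v <= (K * cabs (v - u))%:E)%E.
Proof.
move=> K0 H; pose g t := u + toC t * (v - u).
apply: ge_ereal_inf; exists (\sum_(g <- [:: g]) arc_length Om g)%E.
  exists [:: g] => //=; split.
  - exact: segment_C1.
  - by move=> t; rewrite in_itv /= => /H[].
  - by rewrite /g toC0 mul0r addr0.
  - by rewrite /g toC1 mul1r addrC subrK.
rewrite big_seq1.
apply: (@le_trans _ _ (\int[lebesgue_measure]_(t in `[0%R, 1%R]) cst (K * cabs (v - u))%:E t)%E).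
  apply: le_integral_nonneg => t /mem_itv01 t01.
    by apply: mule_ge0; [exact: hyp_density_ge0 | rewrite lee_fin speed_ge0].
  rewrite /g segment_speed EFinM; apply: lee_wpmul2r; first by rewrite lee_fin cabs_ge0.
  by have [] := H t t01.
rewrite integral_cst //= lebesgue_measure_itv /= lte_fin ltr01 oppr0 adde0 mule1 //.
Qed.

(** The density of [Om] is at most that of a disk inside [Om], which is bounded near
    the centre, so distances are at most a multiple of Euclidean ones. *)
Lemma small_hyp_disk Om z (c : R) : open Om -> carries_hyperbolic_metric Om -> Om z -> 0 < c ->
  exists2 delta, 0 < delta & disk z (2 * delta) `<=` Om /\
    (hyp_diam Om (disk z (2 * delta)) <= c%:E)%E.
Proof.
move=> /openP_disk oO cO Oz c0; have [r r0 Hr] := oO z Oz.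
pose K := 8 / (3 * r); have K0 : 0 < K by rewrite /K divr_gt0 // mulr_gt0.
pose delta := Num.min (r / 4) (c / (4 * K)).
have d0 : 0 < delta by rewrite lt_min !divr_gt0 // mulr_gt0.
have dr : delta <= r / 4 by rewrite ge_min lexx.
have dc : K * (4 * delta) <= c.
  have : delta <= c / (4 * K) by rewrite ge_min lexx orbT.
  have K4 : 0 < 4 * K by apply: mulr_gt0.
  rewrite ler_pdivlMr // => h.
  by rewrite (_ : K * (4 * delta) = delta * (4 * K)) //; ring.
exists delta => //; split; first by move=> w /diskP wz; apply: Hr; apply/diskP; lra.
apply/hyp_diam_le => x y xd yd.
apply: (@le_trans _ _ (K * cabs (y - x))%:E); last first.
  rewrite lee_fin; apply: le_trans dc; apply: ler_wpM2l; first exact: ltW.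
  move/diskP: xd; move/diskP: yd => h1 h2.
  by have := cabsD (y - z) (z - x); rewrite addrA subrK (cabsB z x); lra.
apply: hyp_dist_segment; first exact: ltW.
move=> t t01; have /diskP h := disk_convex xd yd t01; split.
  by apply: Hr; apply/diskP; lra.
apply: le_trans (hyp_density_anti Hr cO _) _; first by apply/diskP; lra.
by apply: hyp_density_disk_le => //; lra.
Qed.

(** The density of the unit disk is at least 2, and the speed is at least the
    derivative of the real part. *)
Lemma arc_length_disk_lower (g : R -> C) : C1 g -> (forall t, t \in `[0, 1] -> disk 0 1 (g t)) ->
  ((2 * (complex.Re (g 1) - complex.Re (g 0)))%:E <= arc_length (disk 0 1) g)%E.
Proof.
move=> cg gD; have [dR cR] := cg _ (or_introl erefl).
pose F t := 2 * re_part g t; pose f t := 2 * derive1 (re_part g) t.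
have dF (t : R) : is_derive t (1:R) F (f t).
  have K : is_derive t (1:R) (re_part g) (derive1 (re_part g) t).
    by rewrite derive1E; apply: derivableP; exact: dR.
  exact: (is_deriveZ 2 K).
have cF : continuous F.
  by move=> t; apply: differentiable_continuous; apply/derivable1_diffP; case: (dF t).
have cf : continuous f by move=> t; apply: cvgM; [exact: cvg_cst | exact: cR].
have ci (h : R -> R) : continuous h -> {within `[0%R, 1%R], continuous h} by move=> ?; exact: continuous_subspaceT.
have <- : (\int[lebesgue_measure]_(t in `[0%R, 1%R]) (f t)%:E)%E =
    (2 * (complex.Re (g 1) - complex.Re (g 0)))%:E.
  rewrite (@continuous_FTC2 _ f F 0 1) //; first by rewrite -EFinB -mulrBr.
  - exact: ci.
  - split.
    + by move=> t _; case: (dF t).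
    + by apply: cvg_at_right_filter; exact: cF.
    + by apply: cvg_at_left_filter; exact: cF.
  - by move=> t _; rewrite derive1E; case: (dF t).
apply: (@le_trans _ _ (\int[lebesgue_measure]_(t in `[0%R, 1%R]) (`|f t|)%:E)%E).
  apply: le_integral => //=.
  - by apply: continuous_compact_integrable; [exact: segment_compact | exact: ci].
  - apply: (@continuous_compact_integrable _ (fun t => `|f t|)); first exact: segment_compact.
    by apply: ci => t; apply: (continuous_comp (cf t)); exact: norm_continuous.
  - by move=> t _; rewrite lee_fin ler_norm.
apply: le_integral_nonneg => t t01; first by rewrite lee_fin.
apply: (@le_trans _ _ (2%:E * (speed g t)%:E)%E).
  rewrite -EFinM lee_fin /f normrM ger0_norm //; apply: ler_wpM2l => //.
  by rewrite /speed -sqrtr_sqr ler_sqrt ?addr_ge0 ?sqr_ge0 // lerDl sqr_ge0.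
apply: lee_wpmul2r; first by rewrite lee_fin speed_ge0.
by apply: hyp_density_unit_disk; exact: gD.
Qed.

Lemma hyp_dist_disk_lower z w :
  ((2 * (complex.Re w - complex.Re z))%:E <= hyp_dist (disk 0 1) z w)%E.
Proof.
apply: le_ereal_inf_tmp => _ [s + <-]; elim: s z => [|g s IH] z /=.
  by move=> ->; rewrite big_nil subrr mulr0.
move=> [cg gD g0 /IH ps]; rewrite big_cons.
have := arc_length_disk_lower cg gD; rewrite g0 => h.
apply: le_trans (leeD h ps); rewrite -EFinD lee_fin; lra.
Qed.

Lemma cont_upto_within (gam : R -> C) : cont_upto gam 1 -> {within `[0%R, 1%R], continuous gam}.
Proof.
move=> H; apply/subspace_continuousP => s /mem_itv01 s01; apply/cvgC_atP => e e0.
have [d d0 Hd] := H s s01 e e0.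
rewrite near_withinE; apply/nbhs_ballP; exists d => // u; rewrite /ball /= distrC => us.
by rewrite in_itv /= => u01; exact: Hd.
Qed.

Lemma square_within (H : R * R -> C) :
  (forall s t, 0 <= s <= 1 -> 0 <= t <= 1 -> forall e, 0 < e -> exists2 d, 0 < d &
   forall s' t', 0 <= s' <= 1 -> 0 <= t' <= 1 -> `|s' - s| < d -> `|t' - t| < d ->
     cabs (H (s', t') - H (s, t)) < e) ->
  {within `[0%R, 1%R] `*` `[0%R, 1%R], continuous H}.
Proof.
move=> K; apply/subspace_continuousP => -[s t] [/= /mem_itv01 s01 /mem_itv01 t01].
apply/cvgC_atP => e e0; have [d d0 Hd] := K s t s01 t01 e e0.
rewrite near_withinE; apply/nbhs_ballP; exists d => // -[s' t'] [/=].
rewrite /ball /= (distrC s) (distrC t) => h1 h2 [/=]; rewrite !in_itv /= => h3 h4.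
exact: Hd.
Qed.

Lemma simply_connected_disk (c : C) r : simply_connected (disk c r).
Proof.
split.
  move=> x y xr yr; exists (fun s => x + toC s * (y - x)); split.
  - split; first by apply: cont_upto_within; exact: segment_cont.
    by move=> t; rewrite in_itv /= => t01; exact: disk_convex.
  - by rewrite toC0 mul0r addr0.
  - by rewrite toC1 mul1r addrC subrK.
move=> g [/within_cont_upto cg gr] g01.
exists (fun p => g p.2 + toC p.1 * (g 0 - g p.2)); split.
- apply: square_within => s t s01 t01 e e0 /=.
  have e4 : 0 < e / 4 by lra.
  have [d1 d10 H1] := cg t t01 _ e4.
  pose L := 1 + cabs (g 0 - g t); have L0 : 0 < L by rewrite /L; have := cabs_ge0 (g 0 - g t); lra.
  exists (Num.min d1 (e / 4 / L)); first by rewrite lt_min d10 !divr_gt0.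
  move=> s' t' s'01 t'01; rewrite !lt_min => /andP[_ hs] /andP[ht _].
  have -> : g t' + toC s' * (g 0 - g t') - (g t + toC s * (g 0 - g t)) =
    (g t' - g t) + toC (s' - s) * (g 0 - g t) - toC s' * (g t' - g t) by rewrite toCB; ring.
  have a1 := H1 t' t'01 ht.
  apply: le_lt_trans (cabsD _ _) _; rewrite cabsN (cabsM (toC s')) cabs_real.
  apply: le_lt_trans (lerD (cabsD _ _) (lexx _)) _; rewrite cabsM cabs_real.
  have a2 : `|s' - s| * cabs (g 0 - g t) <= e / 4.
    move: hs; rewrite ltr_pdivlMr // /L => h; have := normr_ge0 (s' - s); nra.
  have a3 : `|s'| * cabs (g t' - g t) <= 1 * cabs (g t' - g t).
    apply: ler_wpM2r; first exact: cabs_ge0.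
    by rewrite ger0_norm; case/andP: s'01.
  lra.
- move=> s t; rewrite !in_itv /= => s01 t01; apply: disk_convex => //; apply: gr; rewrite in_itv //=.
  by rewrite lexx ler01.
- by move=> t _ /=; rewrite toC0 mul0r addr0.
- by move=> t _ /=; rewrite toC1 mul1r addrC subrK.
- by move=> s _ /=; rewrite -g01 subrr mulr0 addr0.
Qed.

Lemma identity_degree1 (U : set C) : has_degree id U U 1.
Proof.
move=> w Uw; exists [fset w]%fset, (fun=> 1%N); split.
- apply/seteqP; split=> z /=; rewrite ?in_fset1; first by move=> /eqP ->.
  by move=> [_ ->].
- move=> z _; split=> //; last by case=> [|[]].
  by rewrite derive1n1 (cder_derive1 (cder_id z)) oner_neq0.
- by rewrite big_seq_fset1.
Qed.

(** The identity of the unit disk is an instance in which the component is a disk of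
    radius [eta], and its diameter is positive. *)
Lemma component_diam_bound_pos (N : nat) (eta c : R) : (0 < N)%N -> 0 < eta -> eta < 1 ->
  component_diam_bound N eta c -> 0 < c.
Proof.
move=> N0 eta0 eta1 H.
have dd : disk (0 : C) 1 `&` id @^-1` disk 0 (eta * 1) = disk 0 eta.
  rewrite mulr1; apply/seteqP; split=> z; first by case.
  by move=> ze; split=> //; move/diskP: ze => ?; apply/diskP; lra.
have K : (hyp_diam (disk (0 : C) 1) (disk 0 eta) <= c%:E)%E.
  apply: (H 0 1 (disk 0 1) id) => //.
  - split; [by exists 0; exact: disk_center | exact: open_disk | exact: simply_connected_disk].
  - split; last by exists 1%N => //; exact: identity_degree1.
    split.
    + by rewrite image_id.
    + by apply: cder_hol => z _; eexists; exact: cder_id.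
    + by move=> K cK K1; rewrite setIidr.
  - exists 0; rewrite dd; first exact: disk_center.
    by rewrite component_disk //; exact: disk_center.
have m : disk (0 : C) eta (toC (eta / 2)).
  by apply/diskP; rewrite subr0 cabs_real gtr0_norm; lra.
have /hyp_diam_le /(_ _ _ (disk_center 0 eta0) m) h := K.
have := le_trans (hyp_dist_disk_lower 0 (toC (eta / 2))) h.
by rewrite lee_fin /=; lra.
Qed.
End Distance.

(** * Proper maps, degrees and branched coverings *)

Section Proper.
Context {R : realType}.
Local Notation C := (Cplx R).
Implicit Types (z w a : C) (r e t : R) (g f : C -> C) (U V W A B : set C).

Lemma finite_radius (T : eqType) (s : seq T) (P : T -> R -> Prop) :
  (forall a : T, a \in s -> exists2 d, 0 < d & forall e, 0 < e <= d -> P a e) ->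
  exists2 d, 0 < d & forall e, 0 < e <= d -> forall a : T, a \in s -> P a e.
Proof.
elim: s => [|b s IH] H; first by exists 1.
have [|d d0 Hd] := IH; first by move=> a as_; apply: H; rewrite in_cons as_ orbT.
have [|c c0 Hc] := H b; first by rewrite in_cons eqxx.
exists (Num.min d c); first by rewrite lt_min d0.
move=> e /andP[e0]; rewrite le_min => /andP[ed ec] a; rewrite in_cons => /predU1P[->|as_].
  by apply: Hc; rewrite e0.
by apply: Hd => //; rewrite e0.
Qed.

Lemma separated_radius (s : {fset C}) : exists2 e, 0 < e &
  forall a b, a \in s -> b \in s -> a != b -> 2 * e <= cabs (a - b).
Proof.
have [|d d0 Hd] := @finite_radius C s
  (fun a e => forall b, b \in s -> a != b -> 2 * e <= cabs (a - b)); last first.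
  by exists d => // a b as_ bs; apply: Hd => //; rewrite d0 lexx.
move=> a as_.
have [|d d0 Hd] := @finite_radius C s (fun b e => a != b -> 2 * e <= cabs (a - b)); last first.
  by exists d => // e ed b bs; exact: Hd.
move=> b bs; have [->|ab] := eqVneq a b; first by exists 1.
have ab0 : 0 < cabs (a - b) by rewrite cabs_gt0 subr_eq0.
by exists (cabs (a - b) / 2); [lra | move=> e /andP[_ h] _; lra].
Qed.

Lemma real_root (rho : R) k : (0 < k)%N -> 0 < rho -> exists2 q, 0 < q & q ^+ k = rho.
Proof.
move=> k0 rho0; have [b Hb] := kth_root (toC rho) k0.
have bk : cabs b ^+ k = rho by rewrite -cabsX Hb cabs_real gtr0_norm.
exists (cabs b) => //; rewrite cabs_gt0; apply/eqP => b0.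
by move: bk; rewrite b0 cabs0 expr0n gtn_eqF //= => /eqP; rewrite lt_eqF.
Qed.

(** The coordinate of [normal_form], rescaled: over the disk of radius rho the sheet
    is the preimage under phi of the disk of radius rho^(1/k). *)
Lemma local_power_model U g a k e : open U -> holomorphic_on U g -> U a -> has_multiplicity g a k ->
  0 < e -> exists2 t, 0 < t <= e & disk a t `<=` U /\ exists2 d, 0 < d &
    forall rho, 0 < rho <= d -> let A := disk a t `&` g @^-1` disk (g a) rho in
      [/\ power_model g A (disk (g a) rho) a (g a) k, connected A, A a &
        forall v, disk (g a) rho v -> exists2 z, A z & g z = v].
Proof.
move=> oU hg Ua mk e0; have k0 : (0 < k)%N by case: mk.
have [r [phi [r0 rU hphi [phia dphi] E]]] := normal_form oU hg Ua mk.
have er : 0 < Num.min e (r / 2) by rewrite lt_min e0; lra.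
have [t [rho1 [sg [/andP[t0 te] rho10 tU inj [_ Hsg]]]]] :=
  inverse_function (@open_disk _ a r) hphi (disk_center a r0) dphi er.
rewrite phia in Hsg.
move: te; rewrite le_min => /andP[te tr].
exists t; first by rewrite t0.
split; first by move=> z /tU /rU.
exists (rho1 ^+ k); first by rewrite exprn_gt0.
move=> rho /andP[rho0 rhok] A.
have [q q0 qk] := real_root k0 rho0.
have qC : toC q != 0 :> C by rewrite -toC0 (inj_eq toC_inj) gt_eqF.
have rhoC : toC rho != 0 :> C by rewrite -toC0 (inj_eq toC_inj) gt_eqF.
have qkC : toC q ^+ k = toC rho :> C by rewrite /toC -rmorphXn /= qk.
have q1 : q <= rho1 by rewrite -(@ler_pXn2r _ k) // ?nnegrE ?(ltW q0) ?(ltW rho10) // qk.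
have Ephi z : disk a t z -> g z - g a = phi z ^+ k by move=> /tU /E ->; rewrite addrC addKr.
have AE z : A z <-> disk a t z /\ cabs (phi z) < q.
  split=> -[zt h]; split=> //.
    move/diskP: h; rewrite Ephi // cabsX -qk => h.
    by rewrite -(@ltr_pXn2r _ k) ?nnegrE ?cabs_ge0 ?(ltW q0).
  apply/diskP; rewrite Ephi // cabsX -qk.
  by rewrite ltrXn2r ?cabs_ge0 // gtn_eqF.
have sA u : cabs u < q -> A (sg u) /\ phi (sg u) = u.
  move=> uq; have u1 : disk 0 rho1 u by apply/diskP; rewrite subr0; lra.
  by have [h1 h2 _] := Hsg u u1; split=> //; apply/AE; rewrite h2.
have Aa : A a by apply/AE; rewrite phia cabs0; split=> //; exact: disk_center.
have As z : A z -> sg (phi z) = z.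
  move=> /AE[zt zq]; have [/AE[h1 _] h2] := sA _ zq.
  by apply: inj.
have D u : disk (0 : C) 1 u <-> cabs u < 1 by rewrite diskP subr0.
have qu u : cabs u < 1 -> cabs (toC q * u) < q.
  by move=> u1; rewrite cabsM cabs_real gtr0_norm // -[ltRHS]mulr1 ltr_pM2l.
pose F z := (toC q)^-1 * phi z.
pose F' u := sg (toC q * u).
pose G x := (toC rho)^-1 * (x - g a).
pose G' u := g a + toC rho * u.
have F1 z : A z -> disk 0 1 (F z).
  by move=> /AE[_ zq]; apply/D; rewrite cabsM cabsV cabs_real gtr0_norm // ltr_pdivrMl // mulr1.
have F2 u : disk 0 1 u -> A (F' u) /\ F (F' u) = u.
  move=> /D /qu h; have [h1 h2] := sA _ h; split=> //.
  by rewrite /F /F' h2 mulrA mulVf // mul1r.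
have F3 z : A z -> F' (F z) = z by move=> Az; rewrite /F' /F mulrA mulfV // mul1r; exact: As.
have G1 x : disk (g a) rho x -> disk 0 1 (G x).
  by move=> /diskP h; apply/D; rewrite cabsM cabsV cabs_real gtr0_norm // ltr_pdivrMl // mulr1.
have G2 u : disk 0 1 u -> disk (g a) rho (G' u).
  move=> /D h; apply/diskP; rewrite /G' addrC addKr cabsM cabs_real gtr0_norm //.
  by rewrite -[ltRHS]mulr1 ltr_pM2l.
have G3 u : G (G' u) = u by rewrite /G /G' addrC addKr mulrA mulVf // mul1r.
have G4 x : G' (G x) = x by rewrite /G /G' mulrA mulfV // mul1r addrC subrK.
have cF' : {within disk 0 1, continuous F'}.
  apply/within_cont_eps => u /D /qu u1 eps eps0.
  have u1' : disk 0 rho1 (toC q * u) by apply/diskP; rewrite subr0; lra.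
  have [_ _ cd] := Hsg _ u1'.
  have cd2 := @cder_comp _ sg (fun u => toC q * u) u _ _ cd (cderZ (toC q) (cder_id u)).
  have /contCCP /(_ _ eps0)[d d0 Hd] := cder_cont cd2.
  by exists d => // v _; exact: Hd.
have F'A : F' @` disk 0 1 = A.
  apply/seteqP; split=> [_ [u u1 <-]|z Az]; first by case: (F2 u u1).
  by exists (F z); [exact: F1 | exact: F3].
split.
- exists F, F', G, G'; split.
  + split.
    * apply/within_cont_eps => z /AE[zt _] eps eps0.
      have cd := cderZ (toC q)^-1 (hol_cder hphi (tU _ zt)).
      have /contCCP /(_ _ eps0)[d d0 Hd] := cder_cont cd.
      by exists d => // v _; exact: Hd.
    * exact: cF'.
    * apply/seteqP; split=> [_ [z Az <-]|u u1]; first exact: F1.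
      by have [h1 h2] := F2 u u1; exists (F' u).
    * exact: F'A.
    * by move=> z; rewrite inE; exact: F3.
  + split.
    * apply: continuous_subspaceT => x.
      by have := cder_cont (cderZ (toC rho)^-1 (cderB (cder_id x) (cder_cst (g a) x))).
    * apply: continuous_subspaceT => u.
      by have := cder_cont (cderD (cder_cst (g a) u) (cderZ (toC rho) (cder_id u))).
    * apply/seteqP; split=> [_ [x xr <-]|u u1]; first exact: G1.
      by exists (G' u); [exact: G2 | exact: G3].
    * apply/seteqP; split=> [_ [u u1 <-]|x xr]; first exact: G2.
      by exists (G x); [exact: G1 | exact: G4].
    * by move=> x _; exact: G4.
  + by rewrite /F phia mulr0.
  + by rewrite /G subrr mulr0.
  + move=> z Az; have /AE[zt _] := Az.
    by rewrite /G /F Ephi // exprMn exprVn qkC.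
- by rewrite -F'A; apply: connected_continuous_connected => //; exact: connected_disk.
- exact: Aa.
- move=> v /diskP vr; have [u Hu] := kth_root (v - g a) k0.
  have uq : cabs u < q by rewrite -(@ltr_pXn2r _ k) ?nnegrE ?cabs_ge0 ?(ltW q0) // -cabsX Hu qk.
  have [h1 h2] := sA _ uq; exists (sg u) => //; have /AE[zt _] := h1.
  by have := Ephi _ zt; rewrite h2 Hu => /eqP; rewrite (inj_eq (addIr _)) => /eqP.
Qed.

(** Outside small disks about the points of the fibre, |g - w| is bounded below on the
    compact preimage of a closed disk, so the preimage of a small disk about w lies
    in those disks, where g is a power. *)
Lemma proper_local_structure U V g w (s : {fset C}) (m : C -> nat) r : open U -> open V ->
  proper_holomorphic g U V -> V w -> [set` s] = U `&` g @^-1` [set w] ->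
  (forall z, z \in s -> has_multiplicity g z (m z)) -> 0 < r ->
  exists rho (A : C -> set C), [/\ 0 < rho <= r, disk w rho `<=` V,
    (forall a, a \in s -> [/\ open (A a), A a `<=` U & power_model g (A a) (disk w rho) a w (m a)] /\
        [/\ connected (A a), A a a & forall v, disk w rho v -> exists2 z, A a z & g z = v]),
    trivIset [set` s] A & \bigcup_(a in [set` s]) A a = U `&` g @^-1` disk w rho].
Proof.
move=> oU oV [gUV hg pg] Vw sE ms r0.
have [e e0 He] := separated_radius s.
have sU a : a \in s -> U a /\ g a = w.
  by move=> as_; have : [set` s] a by []; rewrite sE => -[].
have /choice[t Ht] : forall a, exists t, a \in s -> [/\ 0 < t <= e, disk a t `<=` U &
   exists2 d, 0 < d & forall rho, 0 < rho <= d -> let A := disk a t `&` g @^-1` disk w rho in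
      [/\ power_model g A (disk w rho) a w (m a), connected A, A a &
        forall v, disk w rho v -> exists2 z, A z & g z = v]].
  move=> a; have [as_|] := boolP (a \in s); last by exists 0.
  have [Ua gw] := sU a as_.
  have [t te [tU H]] := local_power_model oU hg Ua (ms a as_) e0.
  by exists t => _; split=> //; rewrite -gw.
have [d d0 Hd] := @finite_radius C s (fun a rho => let A := disk a (t a) `&` g @^-1` disk w rho in
      [/\ power_model g A (disk w rho) a w (m a), connected A, A a &
        forall v, disk w rho v -> exists2 z, A z & g z = v])
   (fun a as_ => let: And3 _ _ h := Ht a as_ in h).
have /openP_disk /(_ _ Vw)[q q0 Hq] := oV.
pose K := U `&` g @^-1` cdisk w (q / 2).
have cK : compact K.
  apply: pg; first exact: compact_cdisk.
  by move=> z; rewrite /cdisk /= => h; apply: Hq; apply/diskP; lra.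
pose B := ~` \bigcup_(a in [set` s]) disk a (t a).
have cB : closed B by apply: open_closedC; apply: bigcup_open => a _; exact: open_disk.
have [mu mu0 Hmu] : exists2 mu, 0 < mu & forall z, K z -> B z -> mu <= cabs (g z - w).
  have [[z0 [Kz0 Bz0]]|nKB] := pselect ((K `&` B) !=set0); last first.
    by exists 1 => // z Kz Bz; exfalso; apply: nKB; exists z.
  have [||z1 z1K z1min] := @compact_EVT_min _ _ (fun z => cabs (g z - w)) (K `&` B) _
      (compact_closedI cK cB).
  - by exists z0.
  - apply: continuous_withinC => z [[Uz _] _]; apply: (@cabs_continuous_comp _ g w z).
    by have := hol_cont hg Uz.
  rewrite inE in z1K; have [[Uz1 _] Bz1] := z1K.
  exists (cabs (g z1 - w)); last by move=> z Kz Bz; apply: z1min; rewrite inE.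
  rewrite cabs_gt0 subr_eq0; apply/eqP => E; apply: Bz1.
  have z1s : z1 \in s by have : (U `&` g @^-1` [set w]) z1 by []; rewrite -sE.
  exists z1 => //; apply: disk_center.
  by have [/andP[]] := Ht _ z1s.
pose rho := Num.min (Num.min r d) (Num.min (q / 2) mu).
have rho0 : 0 < rho by rewrite !lt_min r0 d0 mu0 andbT; lra.
have rr : rho <= r by rewrite /rho !ge_min lexx.
have rd : rho <= d by rewrite /rho !ge_min lexx orbT.
have rq : rho <= q / 2 by rewrite /rho !ge_min lexx !orbT.
have rmu : rho <= mu by rewrite /rho !ge_min lexx !orbT.
have rdd : 0 < rho <= d by rewrite rho0.
have wV : disk w rho `<=` V by move=> z /diskP h; apply: Hq; apply/diskP; lra.
exists rho, (fun a => disk a (t a) `&` g @^-1` disk w rho); split => //.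
- by rewrite rho0.
- move=> a as_; have [h1 h2 h3 h4] := Hd _ rdd a as_.
  have [ta tU _] := Ht a as_; split => //; split => //; last by move=> z [/tU].
  apply/openP_disk => z [zt zg].
  have /openP_disk /(_ _ zt)[r1 r10 Hr1] := @open_disk _ a (t a).
  have /openP_disk /(_ _ zg)[r2 r20 Hr2] := @open_disk _ w rho.
  have /contCCP /(_ _ r20)[r3 r30 Hr3] := hol_cont hg (tU _ zt).
  exists (Num.min r1 r3); first by rewrite lt_min r10.
  move=> u /diskP; rewrite lt_min => /andP[u1 u3]; split; first by apply/Hr1/diskP.
  by apply/Hr2/diskP/Hr3.
- move=> a b as_ bs [z [[/diskP za _] [/diskP zb _]]]; apply/eqP/negPn/negP => ab.
  have [/andP[_ ta] _ _] := Ht a as_; have [/andP[_ tb] _ _] := Ht b bs.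
  have := He a b as_ bs ab; have := cabsD (a - z) (z - b).
  by rewrite addrA subrK (cabsB a z); lra.
- apply/seteqP; split=> [z [a as_ [zt zg]]|z [Uz zg]].
    by split=> //; have [_ tU _] := Ht a as_; exact: tU.
  have zK : K z by split=> //; move/diskP: zg; rewrite /preimage /cdisk /=; lra.
  have [[a as_ za]|nB] := pselect ((\bigcup_(a in [set` s]) disk a (t a)) z); first by exists a.
  by have := Hmu z zK nB; move/diskP: zg; lra.
Qed.

Lemma proper_branched_covering U V g d : open U -> open V -> proper_holomorphic g U V ->
  has_degree g U V d -> branched_covering g U V d.
Proof.
move=> oU oV pg dg; split; first by case: pg.
move=> w Vw; have [s [m [sE ms sm]]] := dg w Vw.
have [rho [A [/andP[rho0 _] wV HA tA cA]]] := proper_local_structure oU oV pg Vw sE ms ltr01.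
exists (disk w rho), s, A, m; split => //.
- by split=> //; [exact: open_disk | exact: disk_center].
- by move=> a as_; have [[h1 h2 h3] _] := HA a as_; split=> //; case: (ms a as_).
Qed.

Lemma cont_upto_comp U g (al : R -> C) t : holomorphic_on U g -> cont_upto al t ->
  (forall s, 0 <= s <= t -> U (al s)) -> cont_upto (fun s => g (al s)) t.
Proof.
move=> hg ca aU s st e e0; have /contCCP /(_ _ e0)[d d0 Hd] := hol_cont hg (aU s st).
have [d' d'0 Hd'] := ca s st d d0; exists d' => // u ut us; apply: Hd; exact: Hd'.
Qed.

(** A partial lift stays in the preimage of the path, which is compact, and thus has
    a cluster point. *)
Lemma proper_path_lifting U V g : locally_biholomorphic g U -> proper_holomorphic g U V ->
  path_lifting g U V.
Proof.
move=> LB [gUV hg pg]; apply: (path_lifting_cluster LB) => gam x t bet cg gV /andP[t0 t1] Lb.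
have t01 : 0 <= t <= 1 by rewrite ltW.
pose K := gam @` `[0%R, 1%R].
have cK : compact (U `&` g @^-1` K).
  apply: pg; last by move=> _ [s /mem_itv01 s01 <-]; exact: gV.
  apply: continuous_compact; first exact: cont_upto_within.
  exact: segment_compact.
pose F : set_system C := bet @ (t^'-).
have FK : F (U `&` g @^-1` K).
  have : \forall s \near t^'-, 0 < s < t.
    near=> s; apply/andP; split; near: s; [exact: nbhs_left_gt | exact: nbhs_left_lt].
  apply: filterS => s /andP[s0 st].
  have s_t : 0 <= s < t by rewrite ltW.
  have ss : 0 <= s <= s by rewrite lexx ltW.
  have [_ _ bU bg] := Lb s s_t; split; first exact: bU.
  by exists s; rewrite ?bg //; apply/mem_itv01; rewrite ltW //=; lra.
have [y [[Uy _] cy]] := cK F _ FK.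
have clust e d : 0 < e -> 0 < d -> exists s, [/\ 0 <= s < t, t - d < s & cabs (bet s - y) < e].
  move=> e0 d0.
  pose m := Num.max 0 (t - d).
  have mt : m < t by rewrite /m gt_max t0; lra.
  have FA : F (bet @` [set s | m < s < t]).
    have : \forall s \near t^'-, m < s < t.
      near=> s; apply/andP; split; near: s; [exact: nbhs_left_gt | exact: nbhs_left_lt].
    by apply: filterS => s st; exists s.
  have ny : nbhs y (disk y e) by apply/nbhs_diskP; exists e.
  have [_ [[s /andP[ms st] <-] /diskP sy]] := cy _ _ FA ny.
  have m0 : 0 <= m by rewrite /m le_max lexx.
  have md : t - d <= m by rewrite /m le_max lexx orbT.
  by exists s; split=> //; [rewrite st andbT; lra | lra].
exists y; split=> //.
apply/eqP; rewrite -subr_eq0; apply/eqP; apply: cabs_small => e e0.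
have e2 : 0 < e / 2 by lra.
have /contCCP /(_ _ e2)[d1 d10 H1] := hol_cont hg Uy.
have [d2 d20 H2] := cg t t01 _ e2.
have [s [s_t sd sy]] := clust d1 d2 d10 d20.
have /andP[s0 st] := s_t.
have ss : 0 <= s <= s by rewrite s0 lexx.
have [_ _ bU bg] := Lb s s_t.
have a1 := H1 _ sy; rewrite bg // in a1.
have a2 : cabs (gam s - gam t) < e / 2.
  by apply: H2; [rewrite s0 /=; lra | rewrite distrC gtr0_norm ?subr_gt0 //; lra].
by have := cabsD (g y - gam s) (gam s - gam t); rewrite addrA subrK (cabsB (g y)); lra.
Unshelve. all: by end_near. Qed.

Lemma path_in_cont_upto A (al : R -> C) : path_in A al <->
  cont_upto al 1 /\ forall s, 0 <= s <= 1 -> A (al s).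
Proof.
split=> -[h1 h2]; split.
- exact: within_cont_upto.
- by move=> s s01; apply: h2; rewrite in_itv.
- exact: cont_upto_within.
- by move=> s; rewrite in_itv /=; exact: h2.
Qed.

(** A path between two points of a fibre projects to a loop; the loop is
    null-homotopic, so the path is closed. *)
Lemma path_lifting_injective U V g : locally_biholomorphic g U -> path_lifting g U V ->
  (forall z, U z -> V (g z)) -> path_connected U -> simply_connected V ->
  forall x y, U x -> U y -> g x = g y -> x = y.
Proof.
move=> LB PL gUV pU [_ sV] x y Ux Uy E.
have [al [/path_in_cont_upto[ca aU] a0 a1]] := pU x y Ux Uy.
have [_ hg _] := LB.
rewrite -a0 -a1; apply: (monodromy LB PL ca aU); apply: sV.
  apply/path_in_cont_upto; split; first exact: cont_upto_comp ca aU.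
  by move=> s s01; apply/gUV/aU.
by rewrite a0 a1.
Qed.

Lemma injective_degree_le1 U V g d : proper_holomorphic g U V -> has_degree g U V d ->
  (forall x y, U x -> U y -> g x = g y -> x = y) -> (forall z, U z -> derive1 g z != 0) ->
  V !=set0 -> (d <= 1)%N.
Proof.
move=> pg dg inj dn [w Vw]; have [s [m [sE ms <-]]] := dg w Vw.
have sU a : a \in s -> U a /\ g a = w.
  by move=> as_; have : [set` s] a by []; rewrite sE => -[].
have m1 a : a \in s -> m a = 1%N.
  move=> as_; apply: (multiplicity_uniq (ms a as_)).
  by split=> //; [rewrite derive1n1; exact: dn (sU a as_).1 | case=> [|[]]].
rewrite (eq_big_seq (fun=> 1%N)) // sum1_size.
have : uniq (enum_fset s) by exact: fset_uniq.
case E : (enum_fset s) => [|a [|b l]] //=.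
rewrite in_cons negb_or => /andP[/andP[ab _] _]; exfalso.
have a_s : a \in s by rewrite -[a \in s]/(a \in enum_fset s) E in_cons eqxx.
have b_s : b \in s by rewrite -[b \in s]/(b \in enum_fset s) E !in_cons eqxx orbT.
have [Ua ga] := sU a a_s; have [Ub gb] := sU b b_s.
by move: ab; rewrite (inj a b Ua Ub) ?eqxx // ga gb.
Qed.

Lemma proper_comp U2 U1 U0 f g : proper_holomorphic f U2 U1 -> proper_holomorphic g U1 U0 ->
  proper_holomorphic (fun z => g (f z)) U2 U0.
Proof.
move=> [fU hf pf] [gU hg pg].
have f1 z : U2 z -> U1 (f z) by move=> Uz; apply: fU; exists z.
split.
- by move=> _ [z Uz <-]; apply: gU; exists (f z) => //; exact: f1.
- exact (hol_comp hg hf f1).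
- move=> K cK KU.
  have -> : U2 `&` (fun z => g (f z)) @^-1` K = U2 `&` f @^-1` (U1 `&` g @^-1` K).
    by apply/seteqP; split=> z [Uz h]; split=> //; [split=> //; exact: f1 | case: h].
  by apply: pf; [exact: pg | move=> z []].
Qed.

(** The fibre of the composition is the disjoint union of the fibres of [f] over the
    points of the fibre of [g]; multiplicities multiply. *)
Lemma degree_comp U2 U1 U0 f g d1 d0 : open U2 -> open U1 ->
  proper_holomorphic f U2 U1 -> proper_holomorphic g U1 U0 ->
  has_degree f U2 U1 d1 -> has_degree g U1 U0 d0 ->
  has_degree (fun z => g (f z)) U2 U0 (d0 * d1)%N.
Proof.
move=> oU2 oU1 [fU hf pf] [gU hg pg] df dg w Uw.
have f1 z : U2 z -> U1 (f z) by move=> Uz; apply: fU; exists z.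
have [s0 [m0 [s0E ms0 sm0]]] := dg w Uw.
have s0U a : a \in s0 -> U1 a /\ g a = w.
  by move=> as_; have : [set` s0] a by []; rewrite s0E => -[].
have /choice[S HS] : forall a, exists s : {fset C}, a \in s0 -> exists m : C -> nat,
    [/\ [set` s] = U2 `&` f @^-1` [set a], forall z, z \in s -> has_multiplicity f z (m z) &
        (\sum_(z <- s) m z)%N = d1].
  move=> a; have [as_|] := boolP (a \in s0); last by exists fset0.
  by have [s [m H]] := df a (s0U a as_).1; exists s => _; exists m.
have /choice[M HM] : forall a, exists m : C -> nat, a \in s0 ->
    [/\ [set` S a] = U2 `&` f @^-1` [set a], forall z, z \in S a -> has_multiplicity f z (m z) &
        (\sum_(z <- S a) m z)%N = d1].
  move=> a; have [/HS[m Hm]|] := boolP (a \in s0); first by exists m.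
  by exists (fun=> 0%N).
pose s := (\bigcup_(a <- s0) S a)%fset.
have sP z : z \in s <-> [/\ U2 z, f z \in s0 & z \in S (f z)].
  split.
    move=> /bigfcupP[a /andP[as_ _] za].
    have [SE _ _] := HM a as_.
    have : [set` S a] z by []; rewrite SE => -[Uz fz].
    by rewrite /preimage /= in fz; rewrite fz; split.
  by move=> [Uz fs zS]; apply/bigfcupP; exists (f z) => //; rewrite fs.
exists s, (fun z => m0 (f z) * M (f z) z)%N; split.
- apply/seteqP; split=> z /=.
    by move=> /sP[Uz fs _]; split=> //; rewrite /preimage /=; case: (s0U _ fs).
  move=> [Uz gz]; have fs : f z \in s0.
    have : (U1 `&` g @^-1` [set w]) (f z) by split=> //; exact: f1.
    by rewrite -s0E.
  apply/sP; split=> //; have [SE _ _] := HM _ fs.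
  by have : (U2 `&` f @^-1` [set f z]) z by []; rewrite -SE.
- move=> z /sP[Uz fs zS]; have [_ mS _] := HM _ fs.
  by apply: (multiplicity_comp oU2 oU1 hf hg Uz (f1 z Uz)); [exact: mS | exact: ms0].
transitivity (\sum_(z <- s) \sum_(a <- s0 | f z == a) (m0 a * M a z))%N.
  apply: eq_big_seq => z /sP[Uz fs zS].
  rewrite big_mkcond /= (bigD1_seq (f z)) ?fset_uniq //= eqxx big1 ?addn0 // => a.
  by rewrite eq_sym => /negPf ->.
rewrite (exchange_big_dep xpredT) //= -sm0 big_distrl /=.
apply: eq_big_seq => a as_; have [SE mS smS] := HM a as_.
rewrite -big_filter -smS big_distrr /=; apply: perm_big.
apply: uniq_perm; rewrite ?filter_uniq ?fset_uniq // => z.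
rewrite mem_filter; apply/idP/idP.
  by move=> /andP[/eqP fz /sP[_ _]]; rewrite fz.
move=> zS; have : [set` S a] z by []; rewrite SE => -[Uz fz].
rewrite /preimage /= in fz; rewrite fz eqxx /=.
by apply/sP; rewrite fz.
Qed.
End Proper.

(** * Meromorphic functions and the postsingular set *)

Section Dynamics.
Context {R : realType}.
Local Notation C := (Cplx R).
Local Notation Chat := (Sphere R).
Implicit Types (z w : C) (r e t : R) (U V W A B : set C) (f : C -> Chat).

Lemma finite_pt_inj : injective (@finite_pt R).
Proof. by move=> x y []. Qed.

Lemma continuous_finite_value f z w : {for z, continuous f} -> f z = finite_pt w ->
  forall e, 0 < e -> exists2 d, 0 < d & forall u, cabs (u - z) < d ->
    exists2 v, f u = finite_pt v & cabs (v - w) < e.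
Proof.
move=> cf fz e e0.
have nw : @nbhs _ Chat (f z) (Some @` disk w e).
  rewrite fz; apply: one_point_compactification_some_nbhs; apply/nbhs_diskP; by exists e.
have /nbhs_diskP[d d0 Hd] : nbhs z (f @^-1` (Some @` disk w e)) := cf _ nw.
by exists d => // u uz; have [|v /diskP vw <-] := Hd u; [apply/diskP | exists v].
Qed.

Lemma continuous_infinite_value f z : {for z, continuous f} -> f z = @infty_pt R ->
  forall w M, exists2 d, 0 < d & forall u, cabs (u - z) < d ->
    forall v, f u = finite_pt v -> M < cabs (v - w).
Proof.
move=> cf fz w M.
have nw : @nbhs _ Chat (f z) ((Some @` (~` cdisk w M)) `|` [set None]).
  by rewrite fz; exists (cdisk w M) => //; split; [exact: compact_cdisk | exact: closed_cdisk].
have /nbhs_diskP[d d0 Hd] : nbhs z (f @^-1` ((Some @` (~` cdisk w M)) `|` [set None])) := cf _ nw.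
exists d => // u uz v fu; have [|[v' /negP nv E]|E] := Hd u; first exact/diskP.
  move: nv E; rewrite fu -ltNge => ? [<-] //.
by rewrite fu in E.
Qed.

Definition fpart f : C -> C := finite_part \o f.

Lemma preim1P f V z : iterate_preimage f 1 V z <-> exists2 w, V w & f z = finite_pt w.
Proof.
by split=> -[w Vw E]; exists w => //; [case: E | rewrite /iterate /= E].
Qed.

Lemma preim1_fpart f V z : iterate_preimage f 1 V z -> f z = finite_pt (fpart f z) /\ V (fpart f z).
Proof. by move=> /preim1P[w Vw E]; rewrite /fpart /= E. Qed.

Lemma preim1_open f V : meromorphic f -> open V -> open (iterate_preimage f 1 V).
Proof.
move=> mf /openP_disk oV; apply/openP_disk => z /preim1P[w Vw fz].
have [r r0 Hr] := oV w Vw.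
have [d d0 Hd] := continuous_finite_value (mf z).1 fz r0.
exists d => // u /diskP /Hd[v fu vw]; apply/preim1P; exists v => //.
by apply/Hr/diskP.
Qed.

Lemma chart_finite f z w : f z = finite_pt w -> chart (f z) \o f = fpart f.
Proof. by move=> ->; apply/funext => u; rewrite /fpart /chart /=; case: (f u). Qed.

Lemma critical_point_finite f z w : f z = finite_pt w ->
  critical_point f z <-> derive1 (fpart f) z = 0.
Proof. by move=> fz; rewrite /critical_point (chart_finite fz). Qed.

Lemma fpart_hol f V : meromorphic f -> holomorphic_on (iterate_preimage f 1 V) (fpart f).
Proof.
move=> mf z /preim1P[w _ fz]; have := (mf z).2.
by rewrite (chart_finite fz).
Qed.

Lemma preim0 f V : iterate_preimage f 0 V = V.
Proof.
apply/seteqP; split=> z; first by move=> [w Vw [->]].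
by move=> Vz; exists z.
Qed.

Lemma iterate_infty f n (w : C) : iterate f n (@infty_pt R) <> Some (finite_pt w).
Proof.
rewrite /iterate; case: n => [//|n]; rewrite iterSr /=.
have -> : iter n (obind (fun p : Chat => omap f (p : option C))) None = None by elim: n => [//|n /= ->].
by [].
Qed.

Lemma iterate_Sr f n z : iterate f n.+1 (finite_pt z) = iterate f n (f z).
Proof. by rewrite /iterate iterSr. Qed.

Lemma preimS f n V : iterate_preimage f n.+1 V = iterate_preimage f 1 (iterate_preimage f n V).
Proof.
apply/seteqP; split=> z.
  move=> [w Vw]; rewrite iterate_Sr => E; apply/preim1P.
  case fz : (f z) => [u|].
    by exists u => //; exists w => //; rewrite -[finite_pt u]/(Some u : Chat) -fz.
  by move: E; rewrite fz => /iterate_infty.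
by move=> /preim1P[u [w Vw Eu] fz]; exists w => //; rewrite iterate_Sr fz.
Qed.

Lemma preim_open f n V : meromorphic f -> open V -> open (iterate_preimage f n V).
Proof.
move=> mf oV; elim: n => [|n IH]; first by rewrite preim0.
by rewrite preimS; exact: preim1_open.
Qed.

Lemma preim_subset f n V W : V `<=` W -> iterate_preimage f n V `<=` iterate_preimage f n W.
Proof. by move=> VW z [w Vw E]; exists w => //; exact: VW. Qed.

Lemma preim_invariant f n V Om : iterate_preimage f 1 Om `<=` Om -> V `<=` Om ->
  iterate_preimage f n V `<=` Om.
Proof.
move=> fO VO; elim: n => [|n IH]; first by rewrite preim0.
by rewrite preimS => z /(preim_subset IH) /fO.
Qed.

Lemma iterate_map_preim f n V z : iterate_preimage f n V z ->
  V (iterate_map f n z) /\ iterate f n (finite_pt z) = Some (finite_pt (iterate_map f n z)).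
Proof. by move=> [w Vw E]; rewrite /iterate_map E. Qed.

Lemma iterate_map_S f n V z : iterate_preimage f 1 V z ->
  iterate_map f n.+1 z = iterate_map f n (fpart f z).
Proof. by move=> /preim1_fpart[E _]; rewrite /iterate_map iterate_Sr {1}E. Qed.

Lemma postsingular_forward f z w : {for z, continuous f} -> f z = finite_pt w ->
  postsingular_set f (finite_pt z) -> postsingular_set f (finite_pt w).
Proof.
move=> cf fz Pz B nB; rewrite -fz in nB.
have nz : @nbhs _ Chat (finite_pt z) (Some @` (f @^-1` B)).
  by apply: one_point_compactification_some_nbhs; exact: cf.
have [q [[s [n [Ss Es]]] [z' Bz' E]]] := Pz _ nz.
exists (f z'); split=> //; exists s, n.+1; split=> //.
by rewrite /iterate iterS -/(iterate f n s) Es -E.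
Qed.

Lemma singular_postsingular f s : singular_set f s -> postsingular_set f s.
Proof. by move=> Ss; apply: subset_closure; exists s, 0%N. Qed.

Lemma path_concat (g1 g2 : R -> C) A : cont_upto g1 1 -> cont_upto g2 1 ->
  (forall s : R, 0 <= s <= 1 -> A (g1 s)) -> (forall s : R, 0 <= s <= 1 -> A (g2 s)) -> g1 1 = g2 0 ->
  exists g3 : R -> C, [/\ cont_upto g3 1, forall s : R, 0 <= s <= 1 -> A (g3 s), g3 0 = g1 0 & g3 1 = g2 1].
Proof.
move=> c1 c2 A1 A2 E.
have k0 : clamp (0 : R) = 0 by apply: clamp_id; rewrite lexx ler01.
have k1 : clamp (1 : R) = 1 by apply: clamp_id; rewrite lexx ler01.
have kle (s : R) : s <= 0 -> clamp s = 0.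
  by move=> s0; rewrite /clamp; apply/max_idPl; rewrite ge_min s0 orbT.
have kge (s : R) : 1 <= s -> clamp s = 1.
  by move=> s1; rewrite /clamp (min_idPl s1); apply/max_idPr; exact: ler01.
exists (fun s => g1 (clamp (2 * s)) + g2 (clamp (2 * s - 1)) - g2 0); split.
- move=> s s01 e e0; have e2 : 0 < e / 2 by lra.
  have [d1 d10 H1] := c1 _ (clamp01 (2 * s)) _ e2.
  have [d2 d20 H2] := c2 _ (clamp01 (2 * s - 1)) _ e2.
  exists (Num.min d1 d2 / 2); first by rewrite divr_gt0 // lt_min d10.
  move=> u u01 us.
  have us' : 2 * `|u - s| < Num.min d1 d2 by lra.
  move: us'; rewrite lt_min => /andP[us1 us2].
  have a1 : cabs (g1 (clamp (2 * u)) - g1 (clamp (2 * s))) < e / 2.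
    apply: H1; first exact: clamp01.
    by apply: le_lt_trans (clamp_lip _ _) _; rewrite -mulrBr normrM ger0_norm.
  have a2 : cabs (g2 (clamp (2 * u - 1)) - g2 (clamp (2 * s - 1))) < e / 2.
    apply: H2; first exact: clamp01.
    apply: le_lt_trans (clamp_lip _ _) _.
    have -> : 2 * u - 1 - (2 * s - 1) = 2 * (u - s) by ring.
    by rewrite normrM ger0_norm.
  have -> : g1 (clamp (2 * u)) + g2 (clamp (2 * u - 1)) - g2 0 -
      (g1 (clamp (2 * s)) + g2 (clamp (2 * s - 1)) - g2 0) =
     (g1 (clamp (2 * u)) - g1 (clamp (2 * s))) +
     (g2 (clamp (2 * u - 1)) - g2 (clamp (2 * s - 1))) by ring.
  by apply: le_lt_trans (cabsD _ _) _; lra.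
- move=> s s01; have [h|h] := le_or_lt s (1 / 2).
    rewrite (kle (2 * s - 1)); last by lra.
    by rewrite addrK; apply: A1; exact: clamp01.
  rewrite (kge (2 * s)); last by lra.
  by rewrite E addrC addKr; apply: A2; exact: clamp01.
- have -> : clamp (2 * 0) = 0 :> R by apply: kle; lra.
  have -> : clamp (2 * 0 - 1) = 0 :> R by apply: kle; lra.
  by rewrite addrK.
- have -> : clamp (2 * 1) = 1 :> R by apply: kge; lra.
  have -> : clamp (2 * 1 - 1) = 1 :> R by apply: kge; lra.
  by rewrite E addrC addrA addNr add0r.
Qed.

(** The set of points that can be joined to [x] is open, and so is its complement. *)
Lemma open_connected_path_connected A : open A -> connected A -> path_connected A.
Proof.
move=> oA cA x y Ax Ay.
have /openP_disk oA' := oA.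
pose reach u v := exists gam : R -> C, [/\ cont_upto gam 1, forall s : R, 0 <= s <= 1 -> A (gam s),
   gam 0 = u & gam 1 = v].
have seg u v r : disk u r `<=` A -> 0 < r -> disk u r v -> reach u v /\ reach v u.
  move=> ur r0 vr; have uu := disk_center u r0.
  by split; [exists (fun s => u + toC s * (v - u)) | exists (fun s => v + toC s * (u - v))]; split;
    [exact: segment_cont | move=> s s01; apply: ur; exact: disk_convex
    | rewrite toC0 mul0r addr0 | rewrite toC1 mul1r addrC subrK
    | exact: segment_cont | move=> s s01; apply: ur; exact: disk_convex
    | rewrite toC0 mul0r addr0 | rewrite toC1 mul1r addrC subrK].
have cat u v k : reach u v -> reach v k -> reach u k.
  move=> [g1 [c1 A1 a1 b1]] [g2 [c2 A2 a2 b2]].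
  have [g3 [c3 A3 a3 b3]] := path_concat c1 c2 A1 A2 (etrans b1 (esym a2)).
  by exists g3; split=> //; [rewrite a3 | rewrite b3].
pose B := [set v | A v /\ reach x v].
have BA : B = A.
  apply: cA.
  - exists x; split=> //; exists (fun=> x); split=> //.
    by move=> s _ e e0; exists 1 => // u _ _; rewrite subrr cabs0.
  - exists B; last by apply/seteqP; split=> [v Bv|v []//]; split=> //; case: Bv.
    apply/openP_disk => v [Av xv]; have [r r0 Hr] := oA' v Av; exists r => // u ur.
    by split; [exact: Hr | exact: cat xv (seg _ _ _ Hr r0 ur).1].
  - exists (~` (A `\` B)); last first.
      apply/seteqP; split=> v; first by move=> Bv; split; [case: Bv | case].
      by move=> [Av nB]; apply: contrapT => nBv; apply: nB.
    apply: open_closedC; apply/openP_disk => v [Av nBv]; have [r r0 Hr] := oA' v Av.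
    exists r => // u ur; split; first exact: Hr.
    move=> [Au xu]; apply: nBv; split=> //.
    exact: cat xu (seg _ _ _ Hr r0 ur).2.
have [_ [gam [c1 A1 a1 b1]]] : B y by rewrite BA.
by exists gam; split=> //; apply/path_in_cont_upto.
Qed.

(** If the lift over [0, t[ has no cluster point, it leaves every closed disk, by
    compactness. The reparametrization h(x) = t x / (1 + x) of [0, t[ by
    [0, +oo[ turns it into an asymptotic path. *)
Lemma escaping_lift_asymptotic f (gam bet : R -> C) t : 0 < t <= 1 -> cont_upto gam 1 ->
  (forall s, 0 <= s < t -> f (bet s) = finite_pt (gam s)) ->
  (forall s, 0 <= s < t -> cont_upto bet s) ->
  (forall y, exists2 e, 0 < e & exists2 d, 0 < d & forall s, 0 <= s < t -> t - d < s ->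
     e <= cabs (bet s - y)) ->
  asymptotic_value f (finite_pt (gam t)).
Proof.
move=> /andP[t0 t1] cg fb cb nocl.
have esc M : exists2 d, 0 < d & forall s, 0 <= s < t -> t - d < s -> M < cabs (bet s - 0).
  have [|d d0 Hd] := @compact_uniform_radius R (cdisk 0 M)
    (fun y e => forall s, 0 <= s < t -> t - e < s -> e <= cabs (bet s - y)) (@compact_cdisk _ 0 M).
    move=> y _; have [e e0 [d d0 Hd]] := nocl y.
    exists (Num.min (e / 2) d); first by rewrite lt_min d0; lra.
    move=> x e'; rewrite !lt_min => /andP[xe _] /and3P[e'0 e'e e'd] s st se.
    have h := Hd s st; have {}h : e <= cabs (bet s - y) by apply: h; lra.
    by have := cabsD (bet s - x) (x - y); rewrite addrA subrK; lra.
  exists d => // s st sd; rewrite ltNge; apply/negP => h.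
  by have := Hd (bet s) h s st sd; rewrite subrr cabs0; lra.
pose h (x : R) := t * (x / (1 + x)).
have hx x : 0 <= x -> 0 <= h x < t.
  move=> x0; have x1 : 0 < 1 + x by lra.
  apply/andP; split.
    by apply: mulr_ge0; [exact: ltW | apply: divr_ge0 => //; exact: ltW].
  by rewrite /h -[ltRHS]mulr1 ltr_pM2l // ltr_pdivrMr //; lra.
have hN x d : 0 < d -> 1 / d < x -> t - d < h x.
  move=> d0; rewrite ltr_pdivrMr // => xd.
  have x0 : 0 < x by rewrite -(pmulr_lgt0 _ d0); lra.
  have x1 : 0 < 1 + x by lra.
  have -> : h x = t - t / (1 + x) by rewrite /h; field; rewrite gt_eqF.
  have : t / (1 + x) < d by rewrite ltr_pdivrMr //; nra.
  lra.
have ch x : 0 <= x -> forall e, 0 < e -> exists2 d, 0 < d & forall u, 0 <= u -> `|u - x| < d -> `|h u - h x| < e.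
  move=> x0 e e0; exists e => // u u0 ux.
  have u1 : 0 < 1 + u by lra.
  have x1 : 0 < 1 + x by lra.
  have -> : h u - h x = (u - x) * (t / ((1 + u) * (1 + x))).
    by rewrite /h; field; rewrite !gt_eqF.
  rewrite normrM (ger0_norm (_ : 0 <= t / _)); last by rewrite divr_ge0 ?mulr_ge0 ?ltW.
  apply: le_lt_trans ux; rewrite -[leRHS]mulr1; apply: ler_wpM2l => //.
  rewrite ler_pdivrMr ?mulr_gt0 // mul1r; nra.
exists (fun x => bet (h x)); split.
- apply/subspace_continuousP => x; rewrite /= in_itv /= andbT => x0.
  apply/cvgC_atP => e e0.
  have /andP[hx0 hxt] := hx x x0.
  pose m := (h x + t) / 2.
  have mt : 0 <= m < t by rewrite /m; apply/andP; split; lra.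
  have hm : 0 <= h x <= m by rewrite /m; apply/andP; split; lra.
  have [d d0 Hd] := cb m mt (h x) hm e e0.
  have ed : 0 < Num.min d (m - h x) by rewrite lt_min d0 /m; lra.
  have [d' d'0 Hd'] := ch x x0 _ ed.
  rewrite near_withinE; apply/nbhs_ballP; exists d' => // u; rewrite /ball /= distrC => ux.
  rewrite in_itv /= andbT => u0.
  have := Hd' u u0 ux; rewrite lt_min => /andP[h1 h2].
  apply: Hd => //; have /andP[-> _] := hx u u0; have := ler_norm (h u - h x); lra.
- move=> B [K [cK clK] KB].
  have [M HM] : exists M, K `<=` cdisk 0 M.
    have [[k0 Kk0]|nK] := pselect (K !=set0); last by exists 0 => k Kk; exfalso; apply: nK; exists k.
    have [||k _ kmax] := @compact_EVT_max _ _ (fun z => cabs (z - 0)) K _ cK; first by exists k0.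
      by apply: continuous_withinC => z _; exact: cont_cabs_sub.
    by exists (cabs (k - 0)) => z Kz; apply: kmax; rewrite inE.
  have [d d0 Hd] := esc M.
  suff HH : \forall x \near +oo, B (finite_pt (bet (h x))) by exact HH.
  near=> x; apply: KB; left; exists (bet (h x)) => //.
  have x0 : 0 <= x by near: x; apply: nbhs_pinfty_ge; rewrite num_real.
  have xd : 1 / d < x by near: x; apply: nbhs_pinfty_gt; rewrite num_real.
  move=> /HM; rewrite /cdisk /=.
  by have := Hd (h x) (hx x x0) (hN x d d0 xd); lra.
- move=> B nB; have /nbhs_diskP[e e0 He] : nbhs (gam t) (Some @^-1` B) by [].
  have t01 : 0 <= t <= 1 by rewrite ltW.
  have [d d0 Hd] := cg t t01 e e0.
  suff HH : \forall x \near +oo, B (f (bet (h x))) by exact HH.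
  near=> x.
  have x0 : 0 <= x by near: x; apply: nbhs_pinfty_ge; rewrite num_real.
  have xd : 1 / d < x by near: x; apply: nbhs_pinfty_gt; rewrite num_real.
  have /andP[a b] := hx x x0; have c := hN x d d0 xd.
  have -> : f (bet (h x)) = finite_pt (gam (h x)) by apply: fb; exact: hx.
  apply: He; apply/diskP; apply: Hd; first by rewrite a /=; lra.
  by rewrite distrC gtr0_norm ?subr_gt0 //; lra.
Unshelve. all: by end_near. Qed.

Section Conformal.
Variables (f : C -> Chat) (U : set C).
Hypotheses (mf : meromorphic f) (oU : open U) (nP : ~ meets_postsingular f U).

Lemma no_critical_over x z : connected_component (iterate_preimage f 1 U) x z ->
  derive1 (fpart f) z != 0.
Proof.
move=> Cz; have [fz Uz] := preim1_fpart (connected_component_sub Cz).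
apply/eqP => d0; apply: nP; exists (fpart f z); first exact: Uz.
apply: singular_postsingular; apply: subset_closure; left; exists z; last exact fz.
exact (proj2 (critical_point_finite fz) d0).
Qed.

(** A cluster point of a partial lift is not a pole, since f has finite limit along
    the lift; it then lies over the end of the path and in the same component. A
    lift without cluster point would exhibit an asymptotic value in [U]. *)
Lemma no_singular_path_lifting x :
  path_lifting (fpart f) (connected_component (iterate_preimage f 1 U) x) U.
Proof.
set V := connected_component _ x.
have oV : open V by apply: open_component; exact: preim1_open.
have hV : holomorphic_on V (fpart f)
  by exact (hol_sub (@connected_component_sub _ (iterate_preimage f 1 U) x) (@fpart_hol f U mf)).
have LB : locally_biholomorphic (fpart f) V by split; [exact oV | exact hV | exact (@no_critical_over x)].
apply: (path_lifting_cluster LB) => gam x0 t bet cg gU t0 Lb.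
have /andP[tp t1] := t0.
have t01 : 0 <= t <= 1 by rewrite ltW.
have bV s : 0 <= s < t -> V (bet s) /\ f (bet s) = finite_pt (gam s).
  move=> st; have ss : 0 <= s <= s by case/andP: st => ->; rewrite lexx.
  have [_ _ h1 h2] := Lb s st; split; first exact: h1.
  by have [-> _] := preim1_fpart (connected_component_sub (h1 s ss)); rewrite h2.
have clus y : (forall e d, 0 < e -> 0 < d ->
        exists s, [/\ 0 <= s < t, t - d < s & cabs (bet s - y) < e]) -> V y /\ fpart f y = gam t.
  move=> cl; have fy : f y = finite_pt (gam t).
    case E : (f y) => [w|]; last first.
      have [d d0 Hd] := continuous_infinite_value (mf y).1 E (gam t) 1.
      have [d' d'0 Hd'] := cg t t01 1 ltr01.
      have [s [st sd sy]] := cl d d' d0 d'0.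
      have /andP[s0 st'] := st.
      have h1 := Hd _ sy _ (bV s st).2.
      have h2 : cabs (gam s - gam t) < 1.
        by apply: Hd'; [rewrite s0 /=; lra | rewrite distrC gtr0_norm ?subr_gt0 //; lra].
      by exfalso; lra.
    congr (finite_pt _); apply/eqP; rewrite -subr_eq0; apply/eqP; apply: cabs_small => e e0.
    have e2 : 0 < e / 2 by lra.
    have [d d0 Hd] := continuous_finite_value (mf y).1 E e2.
    have [d' d'0 Hd'] := cg t t01 _ e2.
    have [s [st sd sy]] := cl d d' d0 d'0.
    have /andP[s0 st'] := st.
    have [v] := Hd _ sy; rewrite (bV s st).2 => /finite_pt_inj <- h1.
    have h2 : cabs (gam s - gam t) < e / 2.
      by apply: Hd'; [rewrite s0 /=; lra | rewrite distrC gtr0_norm ?subr_gt0 //; lra].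
    by have := cabsD (w - gam s) (gam s - gam t); rewrite addrA subrK (cabsB w); lra.
  have Py : iterate_preimage f 1 U y by apply/preim1P; exists (gam t) => //; exact: gU.
  split; last by rewrite /fpart /= fy.
  have /openP_disk /(_ _ Py)[r r0 Hr] := preim1_open mf oU.
  have [s [st _ sy]] := cl r 1 r0 ltr01.
  rewrite /V (same_connected_component (bV s st).1).
  apply: (@connected_component_max _ _ (disk y r)) => //; [by apply/diskP | exact: connected_disk | exact: disk_center].
apply: contrapT => nocl.
apply: nP; exists (gam t); first exact: gU.
apply: singular_postsingular; apply: subset_closure; right.
apply: (@escaping_lift_asymptotic f gam bet t) => //.
- by move=> s st; exact: (bV s st).2.
- by move=> s st; case: (Lb s st).
move=> y; apply: contrapT => H; apply: nocl; exists y.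
have cl e d : 0 < e -> 0 < d -> exists s, [/\ 0 <= s < t, t - d < s & cabs (bet s - y) < e].
  move=> e0 d0; apply: contrapT => nex; apply: H; exists e => //; exists d => // s st sd.
  by rewrite leNgt; apply/negP => lt1; apply: nex; exists s.
by have [Vy gy] := clus y cl; split.
Qed.

(** By path lifting and monodromy f is bijective from the component to [U], with a
    holomorphic inverse. There is no branched value, so the conditions on branched
    values hold vacuously. *)
Lemma conformal_controlled (S0 : {fset Chat}) D x : (0 < D)%N -> simply_connected U ->
  iterate_preimage f 1 U x ->
  controlled_branching f S0 D (connected_component (iterate_preimage f 1 U) x) U.
Proof.
move=> D0 sU Px; set V := connected_component _ x.
have Vx : V x by exact: connected_component_refl.
have oV : open V by apply: open_component; exact: preim1_open.
have hV : holomorphic_on V (fpart f)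
  by exact (hol_sub (@connected_component_sub _ (iterate_preimage f 1 U) x) (@fpart_hol f U mf)).
have LB : locally_biholomorphic (fpart f) V by split; [exact oV | exact hV | exact (@no_critical_over x)].
have PL : path_lifting (fpart f) V U := @no_singular_path_lifting x.
have gVU z : V z -> U (fpart f z) by move=> /connected_component_sub /preim1_fpart[].
have pV : path_connected V.
  by apply: open_connected_path_connected => //; exact: component_connected.
have inj := path_lifting_injective LB PL gVU pV sU.
have surj w : U w -> exists z, V z /\ fpart f z = w.
  move=> Uw; have [gam [/path_in_cont_upto[cg gU] g0 g1]] := sU.1 _ _ (gVU x Vx) Uw.
  have [bet [cb b0 bV bg]] := PL gam cg gU x Vx (esym g0).
  have i01 : 0 <= (1 : R) <= 1 by rewrite ler01 lexx.
  by exists (bet 1); rewrite -g1; split; [exact: bV | exact: bg].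
have /choice[sg Hsg] : forall w, exists z, U w -> V z /\ fpart f z = w.
  move=> w; have [/surj[z Hz]|] := pselect (U w); first by exists z.
  by exists x.
have sgK z : V z -> sg (fpart f z) = z.
  by move=> Vz; have [h1 h2] := Hsg _ (gVU z Vz); exact: inj.
have csg w : U w -> exists d, cder sg w d.
  move=> Uw; have [Vs gs] := Hsg w Uw.
  have [r [rho [ta [/andP[r0 _] rV _ sec sd]]]] := local_section LB Vs ltr01.
  rewrite gs in sec sd; have [rho0 Hta] := sec.
  have [_ _ [d cd]] := Hta _ (disk_center w rho0); exists d.
  apply: (cder_local rho0 _ cd) => u ur.
  by have [Vt gt _] := Hta u ur; rewrite -[in RHS]gt sgK.
have hsg : holomorphic_on U sg by exact: cder_hol.
split.
- split.
    split.
    + by move=> _ [z Vz <-]; exact: gVU.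
    + exact: hV.
    + move=> K cK KU; have -> : V `&` fpart f @^-1` K = sg @` K.
        apply/seteqP; split=> [z [Vz Kz]|_ [w Kw <-]]; first by exists (fpart f z) => //; exact: sgK.
        by have [h1 h2] := Hsg w (KU w Kw); split=> //; rewrite /preimage /= h2.
      apply: continuous_compact => //; apply/within_cont_eps => w Kw e e0.
      have /contCCP /(_ _ e0)[d d0 Hd] := hol_cont hsg (KU w Kw).
      by exists d => // u _; exact: Hd.
  exists 1%N => // w Uw; have [Vs gs] := Hsg w Uw.
  exists [fset sg w]%fset, (fun=> 1%N); split.
  + apply/seteqP; split=> z /=; rewrite ?in_fset1.
      by move=> /eqP ->.
    by move=> [Vz <-]; rewrite sgK.
  + move=> z; rewrite in_fset1 => /eqP ->; split=> //; last by case=> [|[]].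
    by rewrite derive1n1; exact: no_critical_over Vs.
  + by rewrite big_seq_fset1.
- move=> s s' [u [Vu cu _]]; exfalso; have := no_critical_over Vu.
  have [fu _] := preim1_fpart (connected_component_sub Vu).
  by rewrite (proj1 (critical_point_finite fu) cu) eqxx.
- split=> // al /path_in_cont_upto[ca aV] a01.
  have [||H [cH HU H0 H1 Hs]] := sU.2 (fun t => fpart f (al t)).
  + by apply/path_in_cont_upto; split; [exact: cont_upto_comp hV ca aV | move=> s s01; apply/gVU/aV].
  + by rewrite a01.
  exists (fun p => sg (H p)); split.
  + apply: square_within => s t s01 t01 e e0.
    have Ust : U (H (s, t)) by apply: HU; rewrite in_itv.
    have /contCCP /(_ _ e0)[d d0 Hd] := hol_cont hsg Ust.
    have [d' d'0 Hd'] := within_square_cont cH s01 t01 d0.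
    by exists d' => // s' t' ? ? ? ?; apply: Hd; exact: Hd'.
  + by move=> s t s01 t01; case: (Hsg _ (HU s t s01 t01)).
  + by move=> t t01; rewrite H0 // sgK //; apply: aV; rewrite in_itv /= in t01.
  + by move=> t t01; rewrite H1 // sgK //; apply: aV; rewrite lexx ler01.
  + by move=> s s01; have [-> ->] := Hs s s01; rewrite sgK //; apply: aV; rewrite lexx ler01.
- move=> s [u [Vu cu _]]; exfalso; have := no_critical_over Vu.
  have [fu _] := preim1_fpart (connected_component_sub Vu).
  by rewrite (proj1 (critical_point_finite fu) cu) eqxx.
Qed.
End Conformal.
End Dynamics.

(** * Proper maps up to pointwise equality *)

Section Pullbacks.
Context {R : realType}.
Local Notation C := (Cplx R).
Local Notation Chat := (Sphere R).
Implicit Types (z w : C) (r e t : R) (U V W A B : set C) (f : C -> Chat) (g h : C -> C).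

Lemma hol_within A g : holomorphic_on A g -> {within A, continuous g}.
Proof.
move=> hg; apply/within_cont_eps => w Aw e e0.
have /contCCP /(_ _ e0)[d d0 Hd] := hol_cont hg Aw.
by exists d => // u _; exact: Hd.
Qed.

Lemma hol_congr U g h : open U -> (forall z, U z -> g z = h z) ->
  holomorphic_on U g -> holomorphic_on U h.
Proof.
move=> /openP_disk oU gh hg; refine (@cder_hol _ _ _ _) => z Uz.
have [r r0 Hr] := oU z Uz; have cd := hol_cder hg Uz.
exists (derive1 g z); apply: (cder_local r0 _ cd) => u ur.
by apply: gh; apply: Hr.
Qed.

Lemma preimage_congr U g h K : (forall z, U z -> g z = h z) ->
  U `&` g @^-1` K = U `&` h @^-1` K.
Proof.
by move=> gh; apply/seteqP; split=> z [Uz Kz]; split=> //; move: Kz; rewrite /preimage /= gh.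
Qed.

Lemma proper_congr U V g h : open U -> (forall z, U z -> g z = h z) ->
  proper_holomorphic g U V -> proper_holomorphic h U V.
Proof.
move=> oU gh [gUV hg cg]; split.
- by move=> _ [z Uz <-]; rewrite -gh //; apply: gUV; exists z.
- exact (hol_congr oU gh hg).
- by move=> K cK KV; rewrite -(preimage_congr K gh); exact: cg.
Qed.

Lemma multiplicity_congr U g h z k : open U -> (forall z, U z -> g z = h z) -> U z ->
  has_multiplicity g z k -> has_multiplicity h z k.
Proof.
move=> /openP_disk oU gh Uz [k0 nz mz]; have [r r0 Hr] := oU z Uz.
have gh' w : disk z r w -> g w = h w by move=> /Hr; exact: gh.
have E j : derive1n j g z = derive1n j h z.
  exact (derive1n_local j gh' (disk_center z r0)).
by split=> [//||j jk]; rewrite -E //; exact: mz.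
Qed.

Lemma degree_congr U V g h d : open U -> (forall z, U z -> g z = h z) ->
  has_degree g U V d -> has_degree h U V d.
Proof.
move=> oU gh dg w Vw; have [s [m [sE mE dE]]] := dg w Vw.
exists s, m; split=> //; first by rewrite -(preimage_congr _ gh).
move=> z zs; apply: multiplicity_congr oU gh _ (mE z zs).
have : [set` s] z by [].
by rewrite sE => -[].
Qed.

Lemma fiber_card U V g d w (s : {fset C}) : has_degree g U V d -> V w ->
  [set` s] = U `&` g @^-1` [set w] -> (#|` s| <= d)%N.
Proof.
move=> dg Vw sE; have [s' [m [sE' mE dE]]] := dg w Vw.
have <- : s' = s.
  apply/fsetP => z; have : [set` s'] z = [set` s] z by rewrite sE sE'.
  by move=> /= E; apply/idP/idP; rewrite E.
rewrite -dE -sum1_size big_seq [leqRHS]big_seq; apply: leq_sum => z zs.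
by case: (mE z zs).
Qed.

(** * Components of iterated preimages *)

Definition pullback f B n z := connected_component (iterate_preimage f n B) z.

Section Components.
Variables (f : C -> Chat) (mf : meromorphic f).

Lemma pullback_open B n z : open B -> open (pullback f B n z).
Proof. by move=> oB; apply: open_component; exact: preim_open. Qed.

Lemma pullback_sub B n z : pullback f B n z `<=` iterate_preimage f n B.
Proof. exact: connected_component_sub. Qed.

Lemma pullback_refl B n z : iterate_preimage f n B z -> pullback f B n z z.
Proof. exact: connected_component_refl. Qed.

Lemma preimS_fpart B n z : iterate_preimage f n.+1 B z <->
  f z = finite_pt (fpart f z) /\ iterate_preimage f n B (fpart f z).
Proof.
rewrite preimS; split; first exact: preim1_fpart.
by move=> [fz Bz]; apply/preim1P; exists (fpart f z).
Qed.

Lemma pullback_forward B n z u : iterate_preimage f n.+1 B z -> pullback f B n.+1 z u ->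
  pullback f B n (fpart f z) (fpart f u).
Proof.
move=> Bz zu.
have hV : holomorphic_on (pullback f B n.+1 z) (fpart f).
  refine (hol_sub _ (@fpart_hol _ f (iterate_preimage f n B) mf)).
  by move=> v /pullback_sub; rewrite preimS.
apply: (@connected_component_max _ _ (fpart f @` pullback f B n.+1 z)).
- by exists z => //; exact: pullback_refl.
- by move=> _ [v /pullback_sub/preimS_fpart[_ Bv] <-].
- apply: connected_continuous_connected; first exact: component_connected.
  exact: hol_within.
- by exists u.
Qed.

(** This is the form in which the definition of a regular set applies: it only speaks
    of components of single preimages. *)
Lemma pullbackS B n z : iterate_preimage f n.+1 B z ->
  pullback f B n.+1 z = connected_component (iterate_preimage f 1 (pullback f B n (fpart f z))) z.
Proof.
move=> Bz; apply/seteqP; split.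
  apply: connected_component_max.
  - exact: pullback_refl.
  - move=> u zu; apply/preim1P; exists (fpart f u); first exact: pullback_forward.
    by have /pullback_sub/preimS_fpart[] := zu.
  - exact: component_connected.
by rewrite /pullback (preimS f n); apply: component_subset; apply: preim_subset; exact: pullback_sub.
Qed.

Lemma pullback_meets_forward B n z : iterate_preimage f n.+1 B z ->
  meets_postsingular f (pullback f B n.+1 z) -> meets_postsingular f (pullback f B n (fpart f z)).
Proof.
move=> Bz [u zu Pu]; exists (fpart f u); first exact: pullback_forward.
have /pullback_sub/preimS_fpart[fu _] := zu.
exact: postsingular_forward (mf u).1 fu Pu.
Qed.

Lemma pullback_same B n z u : pullback f B n z u -> pullback f B n z = pullback f B n u.
Proof. exact: same_connected_component. Qed.

Lemma pullback_disk0 c r z : disk c r z -> pullback f (disk c r) 0 z = disk c r.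
Proof. by move=> Bz; rewrite /pullback preim0 component_disk. Qed.

End Components.

(** * Towers of controlled pullbacks *)

Section Tower.
Variables (f : C -> Chat) (S0 : {fset Chat}) (D : nat).
Hypotheses (mf : meromorphic f) (D0 : (0 < D)%N).

Fixpoint tower B n z : Prop :=
  if n is k.+1 then
    [/\ iterate_preimage f n B z, tower B k (fpart f z) &
        controlled_branching f S0 D (pullback f B n z) (pullback f B k (fpart f z))]
  else B z.

Lemma unbranched_degree_le1 U V d : open U -> simply_connected U ->
  simply_connected V -> V !=set0 -> proper_holomorphic (fpart f) U V ->
  has_degree (fpart f) U V d -> (forall z, U z -> f z = finite_pt (fpart f z)) ->
  (forall s, ~ branched_value f U s) -> (d <= 1)%N.
Proof.
move=> oU sU sV V0 pf df fU nb.
have hf : holomorphic_on U (fpart f) by case: pf.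
have nc z : U z -> derive1 (fpart f) z != 0.
  move=> Uz; apply/eqP => d0; apply: (nb (f z)); exists z.
  by split; [exact Uz | exact (proj2 (critical_point_finite (fU z Uz)) d0) | reflexivity].
have LB : locally_biholomorphic (fpart f) U by split; [exact oU | exact hf | exact nc].
refine (injective_degree_le1 pf df _ nc V0).
apply: (path_lifting_injective LB (proper_path_lifting LB pf)) => //; last by case: sU.
by move=> z Uz; case: pf => gUV _ _; apply: gUV; exists z.
Qed.

Lemma proper_id V : proper_holomorphic id V V.
Proof.
split.
- by move=> _ [z Vz <-].
- by refine (@cder_hol _ _ _ _) => z _; exists 1; exact: cder_id.
- move=> K cK KV; suff -> : V `&` id @^-1` K = K by [].
  by apply/seteqP; split=> [z []//|z Kz]; split=> //; exact: KV.
Qed.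

(** The degree bound is carried along with a set [Bs] of values already used up:
    those of [S0] whose orbits avoid the current pullback. A branched value of the
    next map lies in the current pullback, so it is not in [Bs], and it joins [Bs]
    because its orbit avoids the next pullback. *)
Lemma tower_degree c r n z : 0 < r -> tower (disk c r) n z ->
  simply_connected (pullback f (disk c r) n z) /\
  proper_of_degree_le (iterate_map f n) (pullback f (disk c r) n z) (disk c r) (regular_N S0 D).
Proof.
move=> r0; set B := disk c r.
suff main : tower B n z -> simply_connected (pullback f B n z) /\ exists (Bs : {fset Chat}) d,
  [/\ (Bs `<=` S0)%fset, (d <= D ^ #|` Bs|)%N,
      proper_holomorphic (iterate_map f n) (pullback f B n z) B,
      has_degree (iterate_map f n) (pullback f B n z) B d &
      forall s j y, s \in Bs -> iterate f j s = Some (finite_pt y) -> ~ pullback f B n z y].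
  move=> /main[sc [Bs [d [BS dB p deg _]]]]; split=> //; split=> //; exists d => //.
  by apply: leq_trans dB _; rewrite leq_pexp2l // fsubset_leq_card.
elim: n z => [|n IH] z.
  move=> Bz; rewrite pullback_disk0 //; split; first exact: simply_connected_disk.
  exists fset0, 1%N; split=> //.
  - exact: proper_id.
  - exact: identity_degree1.
move=> [Bz tz [[pf [d1 d1D df]] one sU br]].
have [sV [Bs [d [BS dB p deg av]]]] := IH _ tz.
move: pf df one sU br sV p deg av.
set U := pullback f B n.+1 z; set V := pullback f B n (fpart f z) => pf df one sU br sV p deg av.
have oB : open B by exact: open_disk.
have oU : open U by exact: pullback_open.
have oV : open V by exact: pullback_open.
have Vz : V (fpart f z) by apply: pullback_refl; case/preimS_fpart: Bz.
have fU u : U u -> f u = finite_pt (fpart f u) by move=> /pullback_sub/preimS_fpart[].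
have fV u : U u -> V (fpart f u) by exact: pullback_forward.
have E u : U u -> iterate_map f n (fpart f u) = iterate_map f n.+1 u.
  move=> Uu; apply/esym/(@iterate_map_S _ f n V); apply/preim1P.
  by exists (fpart f u); [exact: fV | exact: fU].
have p' := proper_congr oU E (proper_comp pf p).
have deg' := degree_congr oU E (degree_comp oU oV pf p df deg).
have av' s j y : s \in Bs -> iterate f j s = Some (finite_pt y) -> ~ U y.
  move=> sB Ey Uy; apply: (av s j.+1 (fpart f y) sB); last exact: fV.
  by rewrite /iterate iterS -/(iterate f j s) Ey /= fU.
split=> //.
have [[s bs]|nb] := pselect (exists s, branched_value f U s).
  have [sS sav] := br s bs.
  have sB : s \notin Bs.
    case: bs => u [Uu _ us]; apply/negP => sB.
    apply: (av s 0%N (fpart f u) sB); last exact: fV.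
    by rewrite /iterate /= -us fU.
  exists (s |` Bs)%fset, (d * d1)%N; split=> //.
  - by rewrite fsubUset fsub1set sS.
  - by rewrite cardfsU1 sB expnS mulnC leq_mul.
  - by move=> s' j y; rewrite in_fset1U => /orP[/eqP ->|]; [exact: sav | exact: av'].
have d11 : (d1 <= 1)%N.
  apply: (unbranched_degree_le1 oU sU sV _ pf df fU); first by exists (fpart f z).
  by move=> s bs; apply: nb; exists s.
exists Bs, (d * d1)%N; split=> //.
by rewrite -[(D ^ _)%N]muln1 leq_mul.
Qed.

End Tower.

(** * Lifting points and chaining pieces *)

(** Over a small disk the preimage splits into connected sheets, each mapped onto the
    disk. A sheet that meets the component belongs to it, so the image of the
    component is open and closed in [K]. *)
Lemma proper_component_surj V B g d K x w : open V -> open B ->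
  proper_holomorphic g V B -> has_degree g V B d -> open K -> connected K -> K `<=` B ->
  V x -> K (g x) -> K w ->
  exists2 y, connected_component (V `&` g @^-1` K) x y & g y = w.
Proof.
move=> oV oB pg dg oK cK KB Vx Kx Kw.
have /openP_disk oK' := oK.
set Q := connected_component _ x.
have Qx : Q x by apply: connected_component_refl.
have LOC v : K v -> exists2 rho, 0 < rho & disk v rho `<=` K /\
    forall q, Q q -> disk v rho (g q) -> forall u, disk v rho u -> exists2 y, Q y & g y = u.
  move=> Kv; have [r r0 Hr] := oK' v Kv.
  have [s [m [sE mE _]]] := dg v (KB v Kv).
  have [rho [A [/andP[rho0 rr] _ HA _ AE]]] := proper_local_structure oV oB pg (KB v Kv) sE mE r0.
  have rK : disk v rho `<=` K.
    by move=> u /diskP uv; apply: Hr; apply/diskP; exact: lt_le_trans uv rr.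
  exists rho => //; split=> // q Qq gq u uv.
  have [Vq _] := connected_component_sub Qq.
  have [a sa Aq] : (\bigcup_(a in [set` s]) A a) q by rewrite AE.
  have [_ [cA _ surj]] := HA a sa.
  have [y Ay gy] := surj u uv; exists y => //.
  rewrite /Q (same_connected_component Qq).
  apply: (@connected_component_max _ _ (A a)) => // b Ab.
  have [Vb gb] : (V `&` g @^-1` disk v rho) b by rewrite -AE; exists a.
  by split=> //; exact: rK.
pose B' := [set v | K v /\ exists2 y, Q y & g y = v].
have BK : B' = K.
  apply: cK.
  - by exists (g x); split=> //; exists x.
  - exists B'; last by apply/seteqP; split=> [v Bv|v []//]; split=> //; case: Bv.
    apply/openP_disk => v [Kv [y Qy gy]]; have [rho rho0 [rK H]] := LOC v Kv.
    exists rho => // u uv; split; first exact: rK.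
    by apply: H Qy _ _ uv; rewrite gy; exact: disk_center.
  - exists (~` (K `\` B')); last first.
      apply/seteqP; split=> v; first by move=> Bv; split; [case: Bv | case].
      by move=> [Kv nB]; apply: contrapT => nBv; apply: nB.
    apply: open_closedC; apply/openP_disk => v [Kv nBv]; have [rho rho0 [rK H]] := LOC v Kv.
    exists rho => // u uv; split; first exact: rK.
    move=> [_ [y Qy gy]]; apply: nBv; split=> //.
    by apply: H Qy _ _ (disk_center v rho0); rewrite gy.
by have [_] : B' w by rewrite BK.
Qed.

Lemma path_chain Om (J : finType) (A : J -> set C) V (c : R) (e : rel J) :
  (forall i j, e i j -> exists z, A i z /\ A j z) ->
  (forall j, (hyp_diam Om (A j) <= c%:E)%E) ->
  forall p i x y, path e i p -> A i x -> A (last i p) y ->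
    (hyp_dist Om x y <= ((size p).+1%:R * c)%:E)%E.
Proof.
move=> eA dA; elim=> [|j p IH] i x y /=.
  by move=> _ Ax Ay; rewrite mul1r; apply: (proj1 (hyp_diam_le Om (A i) c)).
move=> /andP[/eA[z [Aiz Ajz]] pp] Ax Ay.
rewrite (_ : _ * c = c + (size p).+1%:R * c); last by rewrite -[in LHS]nat1r mulrDl mul1r.
apply: hyp_dist_triangle (IH j z y pp Ajz Ay).
exact: (proj1 (hyp_diam_le Om (A i) c)).
Qed.

(** The pieces reachable through overlaps from one piece and the remaining pieces form
    two disjoint open sets, so connectedness leaves no remaining piece that meets [V].
    A chain without repetition has at most as many pieces as there are. *)
Lemma chain_diam Om (J : finType) (A : J -> set C) V (c : R) : 0 <= c -> connected V ->
  (forall j, open (A j)) -> (forall j, (hyp_diam Om (A j) <= c%:E)%E) ->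
  (forall x, V x -> exists j, A j x) ->
  (hyp_diam Om V <= (#|J|%:R * c)%:E)%E.
Proof.
move=> c0 cV oA dA cov; apply/hyp_diam_le => x y Vx Vy.
pose e (i j : J) := `[< exists z, A i z /\ A j z >].
have [i Ai] := cov x Vx.
pose O := \bigcup_(j in [set j | connect e i j]) A j.
pose O' := \bigcup_(j in [set j | ~~ connect e i j]) A j.
have oO : open O by apply: bigcup_open => j _; exact: oA.
have oO' : open O' by apply: bigcup_open => j _; exact: oA.
have OO' z : O z -> O' z -> False.
  move=> [j /= ij Aj] [k /= /negP ik Ak]; apply: ik.
  by apply: connect_trans ij (connect1 _); apply/asboolP; exists z.
have VE : V `&` O = V.
  apply: cV.
  - by exists x; split=> //; exists i => //=; exact: connect0.
  - by exists O.
  - exists (~` O'); first exact: open_closedC.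
    apply/seteqP; split=> z [Vz Oz]; split=> //; first by move/(OO' z Oz).
    have [j Aj] := cov z Vz.
    have [ij|ij] := boolP (connect e i j); first by exists j.
    by exfalso; apply: Oz; exists j.
have [_ [j /= /connectP[p pp ej] Aj]] : (V `&` O) y by rewrite VE.
case: (shortenP pp) ej => p' pp' up' _ ej.
have sz : ((size p').+1 <= #|J|)%N.
  by rewrite -[(size p').+1]/(size (i :: p')) -(card_uniqP up') max_card.
have h : (hyp_dist Om x y <= ((size p').+1%:R * c)%:E)%E.
  apply: (@path_chain Om J A V c e _ dA p' i) => //; last by rewrite -ej.
  by move=> a b /asboolP.
by apply: le_trans h _; rewrite lee_fin ler_wpM2r // ler_nat.
Qed.
End Pullbacks.

(** * Pullbacks in a regular set *)

Section Main.
Context {R : realType}.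
Local Notation C := (Cplx R).
Local Notation Chat := (Sphere R).
Variables (N0 : nat) (Cst : nat -> R -> R) (f : C -> Chat) (S0 : {fset Chat}) (D : nat) (Omega : set C).
Hypotheses (hN0 : is_covering_number (R := R) N0)
  (hCst : forall (N : nat) (eta : R), 0 < eta -> eta < 1 -> component_diam_bound N eta (Cst N eta))
  (mf : meromorphic f) (D0 : (0 < D)%N) (hOm : regular_set N0 Cst f S0 D Omega).
Local Notation N := (regular_N S0 D).
Local Notation C0 := (regular_C0 N0 Cst S0 D).

Lemma degree_bound_gt0 : (0 < N)%N.
Proof. by rewrite /regular_N expn_gt0 D0. Qed.

Lemma diam_bound_gt0 : 0 < Cst N (2 / 3).
Proof.
have h1 : 0 < 2 / 3 :> R by lra.
have h2 : 2 / 3 < 1 :> R by lra.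
exact: component_diam_bound_pos degree_bound_gt0 h1 h2 (hCst h1 h2).
Qed.

Lemma regular_C0_gt0 : 0 < C0.
Proof.
rewrite /regular_C0 mulr_gt0 ?diam_bound_gt0 // mulr_gt0 // ltr0n ?degree_bound_gt0 //.
have [[c [_ cov]] _] := hN0; move: c cov; case: N0 => // c cov.
by have [[]] := cov 0 (disk_center 0 ltr01).
Qed.

Lemma controlled_step c r W n z : 0 < r -> disk c r `<=` Omega ->
  iterate_preimage f n.+1 (disk c r) z ->
  simply_connected (pullback f (disk c r) n (fpart f z)) ->
  W `<=` Omega -> pullback f (disk c r) n (fpart f z) `<=` W ->
  (hyp_diam Omega W <= (2 * C0)%:E)%E ->
  meets_postsingular f (connected_component (iterate_preimage f 1 W) z) ->
  controlled_branching f S0 D (pullback f (disk c r) n.+1 z) (pullback f (disk c r) n (fpart f z)).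
Proof.
move=> r0 BO Bz sV WO VW dW mW.
have [_ oO cO iO ctl] := hOm.
have Vz : pullback f (disk c r) n (fpart f z) (fpart f z).
  by apply: pullback_refl; case/preimS_fpart: Bz.
have fz : f z = finite_pt (fpart f z) by case/preimS_fpart: Bz.
have Pz W' : W' (fpart f z) -> iterate_preimage f 1 W' z.
  by move=> W'z; apply/preim1P; exists (fpart f z).
apply: ctl.
- exact: subset_trans VW WO.
- split=> //; first by exists (fpart f z).
  by apply: pullback_open => //; exact: open_disk.
- by exists z; [exact: Pz | rewrite -pullbackS].
exists W, (connected_component (iterate_preimage f 1 W) z); split=> //.
split; first by exists z => //; apply: Pz; exact: VW.
by rewrite pullbackS //; apply: component_subset; exact: preim_subset.
Qed.

Definition controlled_pullbacks n := forall c r z, 0 < r -> disk c (2 * r) `<=` Omega ->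
  (hyp_diam Omega (disk c (2 * r)) <= C0%:E)%E -> iterate_preimage f n (disk c r) z ->
  meets_postsingular f (pullback f (disk c r) n z) ->
  tower f S0 D (disk c r) n z /\ (hyp_diam Omega (pullback f (disk c r) n z) <= C0%:E)%E.

Lemma disk_double (c : C) r : 0 < r -> disk c r `<=` disk c (2 * r).
Proof. by move=> r0 z /diskP h; apply/diskP; lra. Qed.

Lemma half_disk_sub (c w : C) r : 0 < r -> disk c r w -> disk w (2 * (r / 2)) `<=` disk c (2 * r).
Proof.
move=> r0 /diskP wc z /diskP zw; apply/diskP.
by have := cabsD (z - w) (w - c); rewrite addrA subrK; lra.
Qed.

(** As long as a pullback of the half-size disk meets the postsingular set, its union
    with the pullback of the big disk has diameter at most 2 C0, and the component of
    the preimage of this union contains the next big pullback, which meets the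
    postsingular set; so the next step is controlled. Otherwise f is conformal. *)
Lemma half_disk_tower m c r w : (forall k, (k < m)%N -> controlled_pullbacks k) ->
  0 < r -> disk c (2 * r) `<=` Omega ->
  (hyp_diam Omega (disk c (2 * r)) <= C0%:E)%E -> disk c r w ->
  forall n z y, (n <= m)%N -> iterate_preimage f n (disk c r) z ->
    meets_postsingular f (pullback f (disk c r) n z) -> pullback f (disk c r) n z y ->
    iterate_preimage f n (disk w (r / 2)) y -> tower f S0 D (disk w (r / 2)) n y.
Proof.
move=> IH r0 BO dB Bw; have r20 : 0 < r / 2 by lra.
have [_ oO cO iO _] := hOm.
have BO' := subset_trans (half_disk_sub r0 Bw) BO.
have dB' := hyp_diam_sub (half_disk_sub r0 Bw) dB.
have wO : disk w (r / 2) `<=` Omega by move=> u /(disk_double r20); exact: BO'.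
have cO' : disk c r `<=` Omega by move=> u /(disk_double r0); exact: BO.
elim=> [|n IHn] z y nm Bz mz zy By; first by move: By; rewrite preim0.
have nm' : (n <= m)%N by exact: ltnW.
have Bz' : iterate_preimage f n (disk c r) (fpart f z) by case/preimS_fpart: Bz.
have By' : iterate_preimage f n (disk w (r / 2)) (fpart f y) by case/preimS_fpart: By.
have mz' := pullback_meets_forward mf Bz mz.
have zy' : pullback f (disk c r) n (fpart f z) (fpart f y) by exact: pullback_forward.
have ty := IHn _ _ nm' Bz' mz' zy' By'.
have [sV _] := tower_degree mf D0 r20 ty.
split=> //.
have [mV|nV] := pselect (meets_postsingular f (pullback f (disk w (r / 2)) n (fpart f y))).
  have [_ d1] := IH n nm _ _ _ r20 BO' dB' By' mV.
  have [_ d2] := IH n nm _ _ _ r0 BO dB Bz' mz'.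
  apply: (@controlled_step w (r / 2)
    (pullback f (disk w (r / 2)) n (fpart f y) `|` pullback f (disk c r) n (fpart f z))) => //.
  - rewrite subUset; split; apply: subset_trans (@pullback_sub _ _ _ _ _) _;
      exact: preim_invariant.
  - have -> : 2 * C0 = C0 + C0 by ring.
    by apply: (@hyp_diam_union _ _ _ _ (fpart f y)) => //; exact: pullback_refl.
  have [u zu Pu] := mz; exists u => //.
  have zu' : pullback f (disk c r) n.+1 y u by rewrite -(pullback_same zy).
  have By2 : iterate_preimage f n.+1 (disk c r) y by exact: pullback_sub zy.
  move: zu'; rewrite (pullbackS mf By2) -(pullback_same zy'); apply: component_subset.
  by apply: preim_subset => v; right.
rewrite (pullbackS mf By); apply: conformal_controlled => //.
- by apply: pullback_open => //; exact: open_disk.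
- by apply/preim1P; exists (fpart f y); [exact: pullback_refl | case/preimS_fpart: By].
Qed.

Lemma cover_disk c r : 0 < r -> exists w : 'I_N0 -> C, (forall i, disk c r (w i)) /\
  forall z, disk c r z -> exists i, disk (w i) (r / 3) z.
Proof.
move=> r0; have [[v [v1 cov]] _] := hN0.
have rn : toC r != 0 by rewrite -cabs_gt0 cabs_real gtr0_norm.
exists (fun i => c + toC r * v i); split=> [i|z /diskP zc].
  apply/diskP; rewrite addrC addKr cabsM cabs_real gtr0_norm //.
  by have /diskP := v1 i; rewrite subr0 => h; rewrite gtr_pMr.
have [|i _ /diskP h] := cov ((z - c) / toC r).
  by apply/diskP; rewrite subr0 cabsM cabsV cabs_real gtr0_norm // ltr_pdivrMr // mul1r.
exists i; apply/diskP.
have -> : z - (c + toC r * v i) = toC r * ((z - c) / toC r - v i) by field.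
by rewrite cabsM cabs_real gtr0_norm // ltr_pM2l.
Qed.

(** The pieces are the components over the disks of radius r/3 through the points of
    the fibres over the centres. Each lies in a pullback of a disk of radius r/2,
    over which the degree is at most N, so that its diameter is at most C(N, 2/3). *)
Lemma pullback_diam n c r z : (forall k, (k < n.+1)%N -> controlled_pullbacks k) ->
  0 < r -> disk c (2 * r) `<=` Omega ->
  (hyp_diam Omega (disk c (2 * r)) <= C0%:E)%E -> iterate_preimage f n.+1 (disk c r) z ->
  meets_postsingular f (pullback f (disk c r) n.+1 z) -> tower f S0 D (disk c r) n.+1 z ->
  (hyp_diam Omega (pullback f (disk c r) n.+1 z) <= C0%:E)%E.
Proof.
move=> IH r0 BO dB Bz mz tz; have r20 : 0 < r / 2 by lra.
have r30 : 0 < r / 3 by lra.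
have [_ oO cO iO _] := hOm.
have [sV [pV [d dN dV]]] := tower_degree mf D0 r0 tz.
set B := disk c r in Bz mz sV pV dV *; set V := pullback f B n.+1 z in mz sV pV dV *.
set g := iterate_map f n.+1 in pV dV *.
have oB : open B by exact: open_disk.
have oV : open V by exact: pullback_open.
have gB u A : iterate_preimage f n.+1 B u -> A (g u) -> iterate_preimage f n.+1 A u.
  by move=> /iterate_map_preim[_ Eu] Au; exists (g u).
have [w [Bw cov]] := cover_disk c r0.
have /choice[s sE] : forall i, exists s : {fset C}, [set` s] = V `&` g @^-1` [set w i].
  by move=> i; have [s [m [sE _ _]]] := dV (w i) (Bw i); exists s.
pose L := [seq (i, y) | i <- enum 'I_N0, y <- s i].
have sL : (size L <= N0 * N)%N.
  rewrite size_allpairs_dep sumnE big_map big_enum /=.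
  apply: (@leq_trans (\sum_(i < N0) N)); last by rewrite sum_nat_const card_ord.
  by apply: leq_sum => i _; apply: leq_trans (fiber_card dV (Bw i) (sE i)) dN.
pose piece (p : 'I_N0 * C) := pullback f (disk (w p.1) (r / 3)) n.+1 p.2.
have memL p : p \in L -> V p.2 /\ g p.2 = w p.1.
  move=> /allpairsPdep[i [y [_ ys ->]]] /=.
  have : [set` s i] y by [].
  by rewrite sE => -[].
have piece_diam p : p \in L -> (hyp_diam Omega (piece p) <= (Cst N (2 / 3))%:E)%E.
  case: p => i y /memL[/= Vy gy].
  have By : iterate_preimage f n.+1 B y by exact: pullback_sub Vy.
  have By' r' : 0 < r' -> iterate_preimage f n.+1 (disk (w i) r') y.
    by move=> r'0; apply: gB By _; rewrite gy; exact: disk_center.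
  have ty := half_disk_tower IH r0 BO dB (Bw i) (leqnn _) Bz mz Vy (By' _ r20).
  have [sU pU] := tower_degree mf D0 r20 ty.
  set U := pullback f _ n.+1 y in sU pU.
  have Uy : U y by apply: pullback_refl; exact: By'.
  have gD : disk (w i) (r / 3) (g y) by rewrite gy; exact: disk_center.
  have r23 : 2 / 3 * (r / 2) = r / 3 by field.
  have dU : simply_connected_domain U.
    by split=> //; [exists y | apply: pullback_open => //; exact: open_disk].
  have h1 : 0 < 2 / 3 :> R by lra.
  have h2 : 2 / 3 < 1 :> R by lra.
  have half u : disk (w i) (r / 3) u -> disk (w i) (r / 2) u.
    by move=> /diskP h; apply/diskP; lra.
  have pieceU : piece (i, y) `<=` U by apply: component_subset; exact: preim_subset.
  have UO : U `<=` Omega.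
    apply: subset_trans (@pullback_sub _ _ _ _ _) _; apply: preim_invariant => // u ui.
    by apply: BO; apply: (half_disk_sub r0 (Bw i)); exact: disk_double.
  have := hCst h1 h2 r20 dU pU (A := connected_component (U `&` g @^-1` disk (w i) (r / 3)) y).
  rewrite r23 => H; apply: hyp_diam_sub (hyp_diam_anti UO cO (H _)); last first.
    by exists y => //; split.
  apply: connected_component_max.
  - by apply: pullback_refl; exact: By'.
  - by move=> u iu; split; [exact: pieceU | have /pullback_sub/iterate_map_preim[] := iu].
  - exact: component_connected.
have dN0 : (hyp_diam Omega V <= (#|'I_(size L)|%:R * Cst N (2 / 3))%:E)%E.
  apply: (@chain_diam _ _ _ (fun j : 'I_(size L) => piece (tnth (in_tuple L) j))).
  - by rewrite ltW // diam_bound_gt0.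
  - exact: component_connected.
  - by move=> j; apply: pullback_open => //; exact: open_disk.
  - by move=> j; apply: piece_diam; exact: mem_tnth.
  move=> x Vx; have Bx : iterate_preimage f n.+1 B x by exact: pullback_sub Vx.
  have [Bgx _] := iterate_map_preim Bx.
  have [i ix] := cov _ Bgx.
  pose K := B `&` disk (w i) (r / 3).
  have oK : open K by apply: openI => //; exact: open_disk.
  have cK : connected K.
    by apply: convex_connected => u v t [u1 u2] [v1 v2] t01; split; exact: disk_convex.
  have KB : K `<=` B by move=> u [].
  have [y xy gy] := @proper_component_surj _ V B g d K x (w i) oV oB pV dV oK cK KB Vx
    (conj Bgx ix) (conj (Bw i) (disk_center (w i) r30)).
  have [Vy _] := connected_component_sub xy.
  have yL : (i, y) \in L.
    apply/allpairsPdep; exists i, y; split=> //; first by rewrite mem_enum.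
    by have : [set` s i] y by rewrite sE.
  have /tnthP[j Ej] : (i, y) \in in_tuple L by [].
  exists j; rewrite -Ej /piece /=.
  have : connected_component (V `&` g @^-1` K) y x.
    by rewrite -(same_connected_component xy); apply: connected_component_refl.
  apply: component_subset => u [Vu [_ gu]].
  exact: gB (pullback_sub Vu) gu.
apply: le_trans dN0 _; rewrite card_ord lee_fin /regular_C0 -natrM.
by rewrite ler_wpM2r ?ler_nat // ltW // diam_bound_gt0.
Qed.

Lemma all_controlled n : controlled_pullbacks n.
Proof.
elim/ltn_ind: n => -[|n] IH c r z r0 BO dB Bz mz.
  have Bz' : disk c r z by rewrite preim0 in Bz.
  split; first exact Bz'.
  rewrite (pullback_disk0 f Bz').
  exact (hyp_diam_sub (@disk_double c r r0) dB).
have [_ oO cO iO _] := hOm.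
have Bz' : iterate_preimage f n (disk c r) (fpart f z) by case/preimS_fpart: Bz.
have [tz' dz'] := IH n (ltnSn n) c r _ r0 BO dB Bz' (pullback_meets_forward mf Bz mz).
have [sV _] := tower_degree mf D0 r0 tz'.
have cO' : disk c r `<=` Omega by move=> u /(disk_double r0); exact: BO.
have tz : tower f S0 D (disk c r) n.+1 z.
  split=> //; apply: (@controlled_step c r (pullback f (disk c r) n (fpart f z))) => //.
  - by apply: subset_trans (@pullback_sub _ _ _ _ _) _; exact: preim_invariant.
  - by apply: le_trans dz' _; rewrite lee_fin; have := regular_C0_gt0; lra.
  - by rewrite -pullbackS.
split=> //; exact: pullback_diam.
Qed.
End Main.

Theorem theorem2p5 (R : realType) (N0 : nat) (Cst : nat -> R -> R)
    (f : Cplx R -> Sphere R) (S0 : {fset Sphere R}) (D : nat)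
    (Omega : set (Cplx R))
    (hN0 : is_covering_number (R := R) N0)
    (hCst : forall (N : nat) (eta : R), 0 < eta -> eta < 1 ->
      component_diam_bound N eta (Cst N eta))
    (hf : meromorphic f) (hfc : nonconstant f) (hfl : nonlinear f)
    (hS0 : forall s, s \in S0 -> critical_value f s)
    (hD : (0 < D)%N)
    (hOmega : regular_set N0 Cst f S0 D Omega) :
  (forall z : Cplx R, Omega z -> regular_point f (regular_N S0 D) z) /\
  (forall (z0 : Cplx R) (delta : R),
    Omega z0 -> 0 < delta ->
    disk z0 (2 * delta) `<=` Omega ->
    (hyp_diam Omega (disk z0 (2 * delta))
       <= (regular_C0 N0 Cst S0 D)%:E)%E ->
    forall (n : nat) (V : set (Cplx R)),
      is_component (iterate_preimage f n (disk z0 delta)) V ->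
      meets_postsingular f V ->
      [/\ simply_connected V,
          proper_of_degree_le (iterate_map f n) V (disk z0 delta)
            (regular_N S0 D) &
          (hyp_diam Omega V <= (regular_C0 N0 Cst S0 D)%:E)%E]).
Proof.
have main z0 r n V : 0 < r -> disk z0 (2 * r) `<=` Omega ->
    (hyp_diam Omega (disk z0 (2 * r)) <= (regular_C0 N0 Cst S0 D)%:E)%E ->
    is_component (iterate_preimage f n (disk z0 r)) V -> meets_postsingular f V ->
    [/\ simply_connected V, open V,
      proper_of_degree_le (iterate_map f n) V (disk z0 r) (regular_N S0 D) &
      (hyp_diam Omega V <= (regular_C0 N0 Cst S0 D)%:E)%E].
  move=> r0 BO dB [x Bx ->] mV.
  have [tx dx] := all_controlled hN0 hCst hf hD hOmega r0 BO dB Bx mV.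
  have [sV pV] := tower_degree hf hD r0 tx.
  by split=> //; apply: pullback_open => //; exact: open_disk.
split=> [z Oz|z0 r _ r0 BO dB n V cV mV]; last by have [] := main z0 r n V r0 BO dB cV mV.
have [_ oO cO _ _] := hOmega.
have [r r0 [BO dB]] := small_hyp_disk oO cO Oz (regular_C0_gt0 S0 hN0 hCst hD).
exists r => // n U cU mU.
have [sU oU [pU [d dN dU]] _] := main z r n U r0 BO dB cU mU.
split=> //; exists d => //.
exact (proper_branched_covering oU (@open_disk R z r) pU dU).
Qed.
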